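(* Let $H\in(0,1)$, let $\sigma\in\mathbb{R}^{d\times d}$ be invertible and let $F:\mathbb{R}^d\to\mathbb{R}^d$ satisfy Assumption (D) of the context. Assume moreover that there are $r\in(0,1]$, $\overline{C}_F>0$ and $p_1\ge1$ such that for all $\xi_1,\xi_2\in\mathbb{R}^d$ $$\|\mathrm{D}_{\xi_2}F-\mathrm{D}_{\xi_1}F\|_{L(\mathbb{R}^d,\mathbb{R}^d)}\le\overline{C}_F(1+|\xi_1|+|\xi_2|)^{p_1}|\xi_2-\xi_1|^r ,$$ and that the top Lyapunov exponent satisfies $\lambda_1<0$. Then there exists a set $\mathcal{M}\subseteq\mathbb{R}^d\times\Omega$ of full $\mu\times\mathbf{P}$-measure such that for every $0<\nu<-\lambda_1$ there exists a positive random variable $R^\nu:\mathcal{M}\to(0,\infty)$ such that, for every $(x,\omega)\in\mathcal{M}$ and every $y\in\mathbb{R}^d$ with $|y|\le R^\nu(x,\omega)$, $$\sup_{t\ge0}\exp(t\nu)\,\big|\Phi^t_\omega(x+y)-\Phi^t_\omega(x)\big|<\infty .$$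
   Context: **Assumption (D).** There exist $C_1^F,C_2^F,C_3^F>0$ with $\langle F(\xi_2)-F(\xi_1),\xi_2-\xi_1\rangle\le\min\{C_1^F-C_2^F|\xi_2-\xi_1|^2,\ C_3^F|\xi_2-\xi_1|^2\}$ for all $\xi_1,\xi_2\in\mathbb{R}^d$; $F$ is differentiable and for some $C_F>0$, $N\ge1$, $|F(\xi)|\le C_F(1+|\xi|)^N$ and $|\mathrm{D}_\xi F|\le C_F(1+|\xi|)^N$ for all $\xi$; if $\frac12<H<1$ the derivative of $F$ is globally bounded. **Noise.** $\mathcal{B}=\mathcal{B}_H$ is the closure of $C_0^\infty(\mathbb{R}^-,\mathbb{R}^d)$ (smooth compactly supported $\omega:\mathbb{R}^-\to\mathbb{R}^d$ with $\omega(0)=0$, $\mathbb{R}^-=(-\infty,0]$) under the norm $\|\omega\|_{\mathcal{B}_H}=\sup_{s\ne t\le 0}\frac{|\omega(t)-\omega(s)|}{\sqrt{1+|t|+|s|}\,|t-s|^{(1-H)/2}}$. $\mathbf{P}$ is the Gaussian measure on $\mathcal{B}$ whose canonical process is a time-reversed $d$-dimensional Brownian motion. For $t\ge0$: $P_t(\omega^-,\omega^+)(s)=\omega^+(-s-t)-\omega^+(-t)$ for $-t\le s\le0$, $P_t(\omega^-,\omega^+)(s)=\omega^-(s+t)-\omega^+(-t)$ for $s\le -t$. The operator $\mathcal{D}_H:\mathcal{B}_H\to\mathcal{B}_{1-H}$ is the continuous extension of $\mathcal{D}_H\omega(t)=\frac1{\alpha_H}\int_{-\infty}^0(-r)^{H-\frac12}(\dot\omega(t+r)-\dot\omega(r))\,\mathrm{d}r$,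 $\alpha_H=\big(\frac1{2H}+\int_0^\infty((1+s)^{H-\frac12}-s^{H-\frac12})^2\mathrm{d}s\big)^{1/2}$. $\Omega=\mathcal{B}\times\mathcal{B}$ carries $\mathbf{P}\times\mathbf{P}$ and $B^H_t:=-(\mathcal{D}_HP_t(\omega^-,\omega^+))(-t)$ is a fractional Brownian motion. **Dynamics.** For $\omega=(\omega^-,\omega^+)\in\Omega$, $\Phi^t_\omega(x)$ is the unique solution of $\Phi^t_\omega(x)=x+\int_0^tF(\Phi^s_\omega(x))\,\mathrm{d}s+\sigma B_t^H$, $t\ge0$; it is $C^1$ in $x$. It depends on the noise only through $P_t(\omega^-,\omega^+)$; write $\Phi^t_{(\omega^-,\omega^+)}(x)=\varphi^t_{P_t(\omega^-,\omega^+)}(x)$. Let $\mathcal{Q}_t((x,\omega^-);\Gamma)=\int_{\mathcal{B}}\chi_\Gamma(\varphi^t_{P_t(\omega^-,\omega^+)}(x),P_t(\omega^-,\omega^+))\,\mathbf{P}(\mathrm{d}\omega^+)$; $\mu$ is the unique probability measure on $\mathbb{R}^d\times\mathcal{B}$ with $\mathcal{B}$-marginal $\mathbf{P}$ invariant for $(\mathcal{Q}_t)_{t\ge0}$ (existence, uniqueness, and finiteness of all moments of its $\mathbb{R}^d$-marginal are known results of Hairer). $\mu\times\mathbf{P}$ is the product measure on $\mathbb{R}^d\times\mathcal{B}\times\mathcal{B}=\mathbb{R}^d\times\Omega$. **Top Lyapunov exponent.** $\lambda_1\in[-\infty,\infty)$ is the deterministic constant, provided by the multiplicative ergodic theorem,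 with $\lim_{t\to\infty}\frac1t\log\|\mathrm{D}_x\Phi^t_\omega\|=\lambda_1$ for $\mu\times\mathbf{P}$-a.e. $(x,\omega)$. *)

(* Defs.v *)
From HB Require Import structures.
From mathcomp Require Import all_boot all_order all_algebra.
From mathcomp Require Import all_classical all_reals all_analysis.

Set Implicit Arguments.
Unset Strict Implicit.
Unset Printing Implicit Defensive.

Import Order.TTheory GRing.Theory Num.Theory.
Import numFieldNormedType.Exports.

Local Open Scope classical_set_scope.
Local Open Scope ring_scope.

(* The library norm on matrices is the max norm; [enorm] and [opnorm] are the
   Euclidean norm on R^d and the induced operator norm. *)
Definition inner {R : realType} {d : nat} (u v : 'cV[R]_d) : R :=
  \sum_(i < d) u i 0 * v i 0.

Definition enorm {R : realType} {d : nat} (v : 'cV[R]_d) : R :=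
  Num.sqrt (inner v v).

(* Only used for linear maps, for which the supremum is finite. *)
Definition opnorm {R : realType} {d : nat} (f : 'cV[R]_d -> 'cV[R]_d) : R :=
  sup [set enorm (f v) | v in [set v | enorm v <= 1]].

Definition euclid (R : realType) (d : nat) :=
  g_sigma_algebraType (@open 'cV[R]_d).

Definition assumption_D {R : realType} {d : nat} (H : R)
    (F : 'cV[R]_d -> 'cV[R]_d) : Prop :=
  [/\ exists C1 C2 C3 : R, [/\ 0 < C1, 0 < C2, 0 < C3 &
        forall xi1 xi2, inner (F xi2 - F xi1) (xi2 - xi1) <=
          Num.min (C1 - C2 * enorm (xi2 - xi1) ^+ 2)
                  (C3 * enorm (xi2 - xi1) ^+ 2)],
      (forall xi, differentiable F xi),
      exists CF N : R, [/\ 0 < CF, 1 <= N &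
        forall xi, enorm (F xi) <= CF * (1 + enorm xi) `^ N /\
                   opnorm ('d F xi) <= CF * (1 + enorm xi) `^ N] &
      2^-1 < H -> exists K : R, forall xi, opnorm ('d F xi) <= K].

Definition holder_derivative {R : realType} {d : nat}
    (F : 'cV[R]_d -> 'cV[R]_d) : Prop :=
  exists r C p : R, [/\ 0 < r <= 1, 0 < C, 1 <= p &
    forall xi1 xi2, opnorm ('d F xi2 \- 'd F xi1) <=
      C * (1 + enorm xi1 + enorm xi2) `^ p * enorm (xi2 - xi1) `^ r].

(* A path R^- -> R^d that vanishes at 0 is encoded as a function on R that is
   identically 0 on [0, +oo[. *)

(* Smoothness on the closed half-line (up to the boundary point 0) is expressed
   by the existence of a smooth extension g to R. *)
Definition C0infty {R : realType} {d : nat} (w : R -> 'cV[R]_d) : Prop :=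
  [/\ forall t, 0 <= t -> w t = 0,
      exists2 g : R -> 'cV[R]_d,
        forall (i : 'I_d) (n : nat) (t : R),
          derivable (derive1n n (fun u : R => g u i 0)) t 1 &
        forall t, t <= 0 -> w t = g t &
      exists M : R, forall t, t <= M -> w t = 0].

Definition hnorm {R : realType} {d : nat} (H : R) (w : R -> 'cV[R]_d) : \bar R :=
  ereal_sup [set (enorm (w p.1 - w p.2) /
     (Num.sqrt (1 + `|p.1| + `|p.2|) * `|p.1 - p.2| `^ ((1 - H) / 2)))%:E
     | p in [set p : R * R | [/\ p.1 <= 0, p.2 <= 0 & p.1 != p.2]]].

Definition noise_paths (R : realType) (d : nat) (H : R) : set (R -> 'cV[R]_d) :=
  [set w | (forall t, 0 <= t -> w t = 0) /\
           forall e : R, 0 < e ->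
             exists2 f, C0infty f & (hnorm H (w \- f)%R < e%:E)%E].
Arguments noise_paths {R} d H.

Definition noise_path (R : realType) (d : nat) (H : R) : Type :=
  {w : R -> 'cV[R]_d | w \in noise_paths d H}.
Arguments noise_path {R} d H.

HB.instance Definition _ (R : realType) (d : nat) (H : R) :=
  Choice.on (noise_path d H).

Definition hdist {R : realType} {d : nat} {H : R} (v w : noise_path d H)
    : \bar R :=
  hnorm H (val v \- val w).

Definition hopen (R : realType) (d : nat) (H : R) : set (set (noise_path d H)) :=
  [set U | forall v, U v ->
     exists2 e : R, 0 < e & forall w, (hdist w v < e%:E)%E -> U w].
Arguments hopen {R} d H.

Lemma noise_paths0 (R : realType) (d : nat) (H : R) :
  (fun=> 0) \in noise_paths d H.
Proof.
rewrite inE; split=> // e e0; exists (fun=> 0).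
  split=> //; last by exists 0.
  exists (fun=> 0) => // i n t.
  have -> : derive1n n (fun u : R => (0 : 'cV[R]_d) i 0) = cst 0.
    elim: n => [|n IHn]; first by apply/funext => u; rewrite derive1n0 mxE.
    rewrite derive1nS IHn; apply/funext => u.
    by rewrite derive1E derive_cst.
  exact: derivable_cst.
apply: (@le_lt_trans _ _ 0%E); last by rewrite lte_fin.
apply: ge_ereal_sup => _ [p _ <-].
suff -> : @enorm R d ((cst 0 \- cst 0) p.1 - (cst 0 \- cst 0) p.2) = 0.
  by rewrite mul0r.
rewrite /= !subr0 /enorm /inner big1 ?sqrtr0// => i _.
by rewrite !mxE mulr0.
Qed.

HB.instance Definition _ (R : realType) (d : nat) (H : R) :=
  isPointed.Build (noise_path d H)
    (exist _ (fun=> 0) (noise_paths0 d H)).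

Definition noise (R : realType) (d : nat) (H : R) :=
  g_sigma_algebraType (hopen d H).
Arguments noise {R} d H.

(* u |-> w (- u), u >= 0, is a standard d-dimensional Brownian motion under P;
   continuity and the start at 0 are built into [noise]. *)
Definition reversed_brownian {R : realType} {d : nat} {H : R}
    (P : probability (noise d H) R) : Prop :=
  forall (n : nat) (t : nat -> R) (A : nat -> 'I_d -> set R),
    0 <= t 0%N -> (forall k, t k < t k.+1) ->
    (forall k i, measurable (A k i)) ->
    P [set w : noise d H | forall (k : 'I_n) (i : 'I_d),
         A k i ((val w (- t k.+1) - val w (- t k)) i 0)] =
    (\prod_(k < n) \prod_(i < d)
       normal_prob 0 (Num.sqrt (t k.+1 - t k)) (A k i))%E.

(* The noise space Omega = B x B consists of pairs (past, future), both encoded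
   as paths on the negative half-line. *)
Definition is_noise_update {R : realType} {d : nat} {H : R}
    (Pt : R -> noise d H * noise d H -> noise d H) : Prop :=
  forall (t : R) (w : noise d H * noise d H), 0 <= t ->
    (forall s, - t <= s <= 0 ->
       val (Pt t w) s = val w.2 (- s - t) - val w.2 (- t)) /\
    (forall s, s <= - t ->
       val (Pt t w) s = val w.1 (s + t) - val w.2 (- t)).

Definition alphaH {R : realType} (H : R) : R :=
  Num.sqrt ((2 * H)^-1 +
    \int[lebesgue_measure]_(s in `[0, +oo[)
      (((1 + s) `^ (H - 2^-1) - s `^ (H - 2^-1)) ^+ 2)).

(* The operator D_H : B_H -> B_{1-H}, characterised as the continuous extension
   of the explicit formula on C_0^infty. *)
Definition is_DH {R : realType} {d : nat} (H : R)
    (DH : noise d H -> noise d (1 - H)) : Prop :=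
  (forall (w : noise d H) (e : R), 0 < e -> exists2 delta : R, 0 < delta &
     forall v : noise d H,
       (hdist v w < delta%:E)%E -> (hdist (DH v) (DH w) < e%:E)%E) /\
  (forall w : noise d H, C0infty (val w) ->
     forall (t : R) (i : 'I_d), t <= 0 ->
       (val (DH w) t) i 0 = (alphaH H)^-1 *
         \int[lebesgue_measure]_(r in `]-oo, 0])
           ((- r) `^ (H - 2^-1) *
            (derive1 (fun u : R => val w u i 0) (t + r)
             - derive1 (fun u : R => val w u i 0) r))).

Definition fbm {R : realType} {d : nat} {H : R}
    (Pt : R -> noise d H * noise d H -> noise d H)
    (DH : noise d H -> noise d (1 - H))
    (t : R) (w : noise d H * noise d H) : 'cV[R]_d :=
  - val (DH (Pt t w)) (- t).

Definition is_flow {R : realType} {d : nat} {H : R}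
    (F : 'cV[R]_d -> 'cV[R]_d) (sigma : 'M[R]_d)
    (B : R -> noise d H * noise d H -> 'cV[R]_d)
    (Phi : R -> noise d H * noise d H -> 'cV[R]_d -> 'cV[R]_d) : Prop :=
  forall (w : noise d H * noise d H) (x : 'cV[R]_d),
    {within `[0, +oo[, continuous (fun t => Phi t w x)} /\
    forall t : R, 0 <= t ->
      Phi t w x =
        x + (\col_i \int[lebesgue_measure]_(s in `[0, t]) (F (Phi s w x) i 0))
          + sigma *m B t w.

(* phi^t_{P_t(w-,w+)}(x) is by definition Phi^t_{(w-,w+)}(x). *)
Definition Qkernel {R : realType} {d : nat} {H : R}
    (P : probability (noise d H) R)
    (Pt : R -> noise d H * noise d H -> noise d H)
    (Phi : R -> noise d H * noise d H -> 'cV[R]_d -> 'cV[R]_d)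
    (t : R) (z : euclid R d * noise d H)
    (G : set (euclid R d * noise d H)) : \bar R :=
  (\int[P]_wp (\1_G (Phi t (z.2, wp) z.1, Pt t (z.2, wp)))%:E)%E.

Definition stationary {R : realType} {d : nat} {H : R}
    (P : probability (noise d H) R)
    (Pt : R -> noise d H * noise d H -> noise d H)
    (Phi : R -> noise d H * noise d H -> 'cV[R]_d -> 'cV[R]_d)
    (mu : probability (euclid R d * noise d H)%type R) : Prop :=
  (forall A : set (noise d H), measurable A -> mu (setT `*` A) = P A) /\
  (forall t : R, 0 <= t ->
    forall G : set (euclid R d * noise d H), measurable G ->
      (\int[mu]_z Qkernel P Pt Phi t z G)%E = mu G).

(* Points of R^d x Omega are nested as ((x, w-), w+), to match mu \x P. *)
Definition omega {R : realType} {d : nat} {H : R}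
    (z : (euclid R d * noise d H) * noise d H) : noise d H * noise d H :=
  (z.1.2, z.2).

Definition top_lyapunov {R : realType} {d : nat} {H : R}
    (P : probability (noise d H) R)
    (Phi : R -> noise d H * noise d H -> 'cV[R]_d -> 'cV[R]_d)
    (mu : probability (euclid R d * noise d H)%type R)
    (lambda1 : \bar R) : Prop :=
  lambda1 != +oo%E /\
  {ae (mu \x P)%E, forall z,
     ((t^-1)%:E * lne (opnorm ('d (Phi t (omega z)) (z.1.1 : 'cV[R]_d)))%:E)%E
       @[t --> +oo%R] --> lambda1}.

(* Main.v *)
(* Shifting the future noise by one unit of time turns the time-one map into a
   skew product T that preserves mu x P.  Two levels of regularity are attached
   to a point z: the size of a gauge dominating the flow on [0, 1], and the size of
   sup_k exp (kap k) |D Phi^k|, which is finite almost everywhere when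
   kap < - lambda1.  Both change by at most a constant factor in one direction of
   T, and a maximal ergodic inequality then makes them grow subexponentially
   along almost every orbit; this avoids any integrability hypothesis.  The
   Hoelder condition on DF gives the first-order expansion of Phi^1 with an error
   of order |y|^(1 + r), polynomial in the gauge.  The linearised motion from time
   n to time n + k is therefore at most c exp (eps n - kap k), and for eps small
   against kap r the discrete Duhamel formula keeps small perturbations below
   exp (- kap n).  The exceptional null sets are united over rational kap. *)
Require Import Defs.
From HB Require Import structures.
From mathcomp Require Import all_boot all_order all_algebra.
From mathcomp Require Import all_classical all_reals all_analysis.
From mathcomp Require Import measurable_realfun lra ring zify.

Set Implicit Arguments.
Unset Strict Implicit.
Unset Printing Implicit Defensive.

Import Order.TTheory GRing.Theory Num.Theory.
Import numFieldNormedType.Exports.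

Local Open Scope classical_set_scope.
Local Open Scope ring_scope.

(** * Euclidean norm and linear maps *)

(** [Phi] is given through its integral equation and [DH] through continuity and a formula on smooth
    paths, so measurability, cocycle property, differentiability and growth must all be derived. One
    Gronwall estimate for one-sided bounds does most of this. It yields uniqueness, hence the
    cocycle property and the dependence of the flow on the noise up to time 1; it bounds orbits by
    the noise; and, applied to linear combinations of solutions, it yields the derivative of the
    time-one map. The noise sigma-algebra is generated by norm-open sets, whereas the Brownian law
    is prescribed on finitely many increments; separability of the norm bridges the two. Levels are
    geometric, K^M, so that a factor K in one step moves a point by one level. A point that at time
    n is above level j + n/q then spends about n/q consecutive times above level j. This is a
    fraction of at least 1/(q+1) of a time window starting at 0, and the maximal inequality bounds
    the set of such points by q+1 times the measure of level j. The derivative level is controlled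
    forwards in time and the gauge backwards, hence the two alternatives in
    [never_tempered_null]. *)

Lemma innerC (R : realType) (d : nat) (u v : 'cV[R]_d) : inner u v = inner v u.
Proof. by rewrite /inner; under eq_bigr do rewrite mulrC. Qed.

Lemma innerDl (R : realType) (d : nat) (u v w : 'cV[R]_d) :
  inner (u + v) w = inner u w + inner v w.
Proof.
by rewrite /inner -big_split/=; apply: eq_bigr => i _; rewrite mxE mulrDl.
Qed.

Lemma innerZl (R : realType) (d : nat) a (u w : 'cV[R]_d) :
  inner (a *: u) w = a * inner u w.
Proof.
by rewrite /inner mulr_sumr; apply: eq_bigr => i _; rewrite mxE mulrA.
Qed.

Lemma innerDr (R : realType) (d : nat) (u v w : 'cV[R]_d) :
  inner w (u + v) = inner w u + inner w v.
Proof. by rewrite !(innerC w) innerDl. Qed.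

Lemma innerZr (R : realType) (d : nat) a (u w : 'cV[R]_d) :
  inner w (a *: u) = a * inner w u.
Proof. by rewrite !(innerC w) innerZl. Qed.

Lemma innerNl (R : realType) (d : nat) (u w : 'cV[R]_d) :
  inner (- u) w = - inner u w.
Proof. by rewrite -scaleN1r innerZl mulN1r. Qed.

Lemma innerNr (R : realType) (d : nat) (u w : 'cV[R]_d) :
  inner w (- u) = - inner w u.
Proof. by rewrite !(innerC w) innerNl. Qed.

Lemma inner_ge0 (R : realType) (d : nat) (u : 'cV[R]_d) : 0 <= inner u u.
Proof. by apply: sumr_ge0 => i _; rewrite -expr2 sqr_ge0. Qed.

Lemma enorm_ge0 (R : realType) (d : nat) (u : 'cV[R]_d) : 0 <= enorm u.
Proof. exact: sqrtr_ge0. Qed.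

Lemma sqr_enorm (R : realType) (d : nat) (u : 'cV[R]_d) :
  enorm u ^+ 2 = inner u u.
Proof. by rewrite sqr_sqrtr// inner_ge0. Qed.

Lemma coord_le_enorm (R : realType) (d : nat) (u : 'cV[R]_d) i :
  `|u i 0| <= enorm u.
Proof.
rewrite -sqrtr_sqr ler_wsqrtr// /inner (bigD1 i)//= -expr2 lerDl.
by apply: sumr_ge0 => j _; rewrite -expr2 sqr_ge0.
Qed.

Lemma enorm_le_sum (R : realType) (d : nat) (u : 'cV[R]_d) :
  enorm u <= \sum_i `|u i 0|.
Proof.
have s0 : 0 <= \sum_i `|u i 0| by apply: sumr_ge0.
rewrite -(ler_pXn2r (n := 2)) ?nnegrE ?enorm_ge0// sqr_enorm.
rewrite expr2 mulr_suml; apply: ler_sum => i _.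
rewrite -expr2 -(@real_normK _ (u i 0)) ?num_real// expr2 ler_wpM2l//.
by rewrite (bigD1 i)//= lerDl sumr_ge0.
Qed.

Lemma enorm0 (R : realType) (d : nat) : enorm (0 : 'cV[R]_d) = 0.
Proof. by rewrite /enorm /inner big1 ?sqrtr0// => i _; rewrite mxE mul0r. Qed.

Lemma enorm0_eq0 (R : realType) (d : nat) (u : 'cV[R]_d) : enorm u = 0 -> u = 0.
Proof.
move=> u0; apply/matrixP => i j; rewrite ord1 mxE; apply/eqP.
by rewrite -normr_le0 -[leRHS]u0 coord_le_enorm.
Qed.

Lemma enormZ (R : realType) (d : nat) a (u : 'cV[R]_d) :
  enorm (a *: u) = `|a| * enorm u.
Proof.
rewrite /enorm innerZl innerZr mulrA -expr2 sqrtrM ?sqr_ge0//.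
by rewrite sqrtr_sqr.
Qed.

Lemma enormN (R : realType) (d : nat) (u : 'cV[R]_d) : enorm (- u) = enorm u.
Proof. by rewrite -scaleN1r enormZ normrN1 mul1r. Qed.

Lemma enormB (R : realType) (d : nat) (u v : 'cV[R]_d) :
  enorm (u - v) = enorm (v - u).
Proof. by rewrite -enormN opprB. Qed.

Lemma inner_le (R : realType) (d : nat) (u v : 'cV[R]_d) :
  inner u v <= enorm u * enorm v.
Proof.
have [/enorm0_eq0 -> |u0] := eqVneq (enorm u) 0.
  by rewrite enorm0 mul0r -(scale0r 0) innerZl mul0r.
have [b0|b0] := leP (inner u v) 0.
  by rewrite (le_trans b0)// mulr_ge0// enorm_ge0.
rewrite -(ler_pXn2r (n := 2)) ?nnegrE ?mulr_ge0 ?enorm_ge0 ?(ltW b0)//.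
rewrite exprMn !sqr_enorm.
have a0 : 0 < inner u u by rewrite -sqr_enorm exprn_gt0// lt0r u0 enorm_ge0.
(* With a = <u,u>, b = <u,v>, c = <v,v>, the squared length of a v - b u is a (a c - b^2), and a > 0
   can be cancelled. *)
have := inner_ge0 (inner u u *: v - inner u v *: u).
rewrite !(innerDl, innerDr, innerNl, innerNr, innerZl, innerZr) (innerC v u).
move: a0; move: (inner u u) (inner u v) (inner v v) => a b c a0 h.
rewrite -subr_ge0 -(pmulr_rge0 _ a0).
by apply: le_trans h _; rewrite le_eqVlt; apply/orP; left; apply/eqP; ring.
Qed.

Lemma ler_enormD (R : realType) (d : nat) (u v : 'cV[R]_d) :
  enorm (u + v) <= enorm u + enorm v.
Proof.
rewrite -(ler_pXn2r (n := 2)) ?nnegrE ?addr_ge0 ?enorm_ge0//.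
rewrite sqrrD !sqr_enorm innerDl !innerDr (innerC v u).
by have := inner_le u v; lra.
Qed.

Lemma ler_enorm_sum (R : realType) (d n : nat) (u : 'I_n -> 'cV[R]_d) :
  enorm (\sum_i u i) <= \sum_i enorm (u i).
Proof.
elim/big_ind2 : _ => [|x1 x2 y1 y2 h1 h2|//]; first by rewrite enorm0.
by rewrite (le_trans (ler_enormD _ _))// lerD.
Qed.

Lemma ler_enorm_dist (R : realType) (d : nat) (u v : 'cV[R]_d) :
  enorm u <= enorm v + enorm (u - v).
Proof. by rewrite -{1}(subrK v u) addrC ler_enormD. Qed.

(** With [enorm_le_norm] this connects the Euclidean norm to the max norm, in which continuity and
    differentiability are expressed. *)
Lemma norm_le_enorm (R : realType) (d : nat) (u : 'cV[R]_d) :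
  `|u| <= enorm u.
Proof.
have -> : `|u| = mx_norm u by [].
have [->|u0] := eqVneq (mx_norm u) 0; first exact: enorm_ge0.
have [[i j] /= ->] := mx_norm_neq0 u0.
by rewrite (ord1 j) coord_le_enorm.
Qed.

Lemma coord_le_norm (R : realType) (d : nat) (u : 'cV[R]_d) i :
  `|u i 0| <= `|u|.
Proof.
have -> : `|u| = mx_norm u by [].
by rewrite mx_normrE; apply/bigmax_geP; right; exists (i, 0).
Qed.

Lemma enorm_le_norm (R : realType) (d : nat) (u : 'cV[R]_d) :
  enorm u <= d%:R * `|u|.
Proof.
apply: le_trans (enorm_le_sum u) _.
rewrite mulr_natl -[X in _ *+ X]card_ord -sumr_const.
by apply: ler_sum => i _; exact: coord_le_norm.
Qed.

Definition evec (R : realType) (d : nat) (i : 'I_d) : 'cV[R]_d :=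
  delta_mx i 0.

Lemma sum_evec (R : realType) (d : nat) (u : 'cV[R]_d) :
  u = \sum_i u i 0 *: evec R i.
Proof.
apply/matrixP => i j; rewrite ord1 summxE (bigD1 i)//= big1 ?addr0.
  by rewrite !mxE !eqxx mulr1.
by move=> k ki; rewrite !mxE eq_sym (negbTE ki) mulr0.
Qed.

Lemma enorm_evec (R : realType) (d : nat) (i : 'I_d) : enorm (evec R i) = 1.
Proof.
rewrite /enorm /inner (bigD1 i)//= big1 ?addr0.
  by rewrite !mxE !eqxx mulr1 sqrtr1.
by move=> k ki; rewrite !mxE (negbTE ki) mulr0.
Qed.

Lemma linear_evec (R : realType) (d : nat) (f : 'cV[R]_d -> 'cV[R]_d) :
  linear f -> forall v, f v = \sum_i v i 0 *: f (evec R i).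
Proof.
move=> lf v.
pose g := HB.pack_for {linear 'cV[R]_d -> 'cV[R]_d} f
  (GRing.isLinear.Build _ _ _ _ f lf).
rewrite {1}(sum_evec v) -[f]/(g : _ -> _) linear_sum.
by apply: eq_bigr => i _; rewrite linearZ.
Qed.

Lemma linear_le_sum (R : realType) (d : nat) (f : 'cV[R]_d -> 'cV[R]_d) :
  linear f -> forall v,
  enorm (f v) <= (\sum_i enorm (f (evec R i))) * enorm v.
Proof.
move=> lf v; rewrite (linear_evec lf) (le_trans (ler_enorm_sum _))//.
rewrite mulr_suml; apply: ler_sum => i _.
by rewrite enormZ mulrC ler_wpM2l ?enorm_ge0// coord_le_enorm.
Qed.

(** Prerequisite for every use of [opnorm]: a [sup] is an upper bound only when the set is bounded
    above. *)
Lemma opnorm_has_ubound (R : realType) (d : nat) (f : 'cV[R]_d -> 'cV[R]_d) :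
  linear f ->
  has_ubound [set enorm (f v) | v in [set v | enorm v <= 1]].
Proof.
move=> lf; exists (\sum_i enorm (f (evec R i))) => _ [v /= v1 <-].
rewrite (le_trans (linear_le_sum lf v))// ler_piMr//.
by apply: sumr_ge0 => i _; exact: enorm_ge0.
Qed.

Lemma opnorm_ge (R : realType) (d : nat) (f : 'cV[R]_d -> 'cV[R]_d) v :
  linear f -> enorm v <= 1 -> enorm (f v) <= opnorm f.
Proof.
by move=> lf v1; apply: ub_le_sup; [exact: opnorm_has_ubound|exists v].
Qed.

Lemma opnormP (R : realType) (d : nat) (f : 'cV[R]_d -> 'cV[R]_d) v :
  linear f -> enorm (f v) <= opnorm f * enorm v.
Proof.
move=> lf; have lfZ a u : f (a *: u) = a *: f u.
  by rewrite [LHS](linear_evec lf) (linear_evec lf u) scaler_sumr;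
    apply: eq_bigr => i _; rewrite mxE scalerA.
have [/enorm0_eq0 -> |v0] := eqVneq (enorm v) 0.
  by rewrite -(scale0r 0) lfZ !scale0r enorm0 mulr0.
have v_gt0 : 0 < enorm v by rewrite lt0r v0 enorm_ge0.
have := @opnorm_ge _ _ f ((enorm v)^-1 *: v) lf.
rewrite lfZ !enormZ gtr0_norm ?invr_gt0// mulVf// lexx => /(_ isT).
by rewrite mulrC ler_pdivrMr.
Qed.

(** * Integral equations *)

Lemma continuous_itv_integrable (R : realType) (f : R -> R) a b :
  continuous f -> lebesgue_measure.-integrable `[a, b] (EFin \o f).
Proof.
move=> cf; apply: continuous_compact_integrable; first exact: segment_compact.
exact: continuous_subspaceT.
Qed.

(** The primitive starts at -1, to the left of 0, so that it has a two-sided derivative at every t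
    >= 0, the endpoint included. *)
Lemma antiderivative (R : realType) (f : R -> R) : continuous f ->
  exists G : R -> R, (forall t : R, -1 < t -> is_derive t 1 G (f t)) /\
    forall t : R, 0 <= t ->
      \int[lebesgue_measure]_(s in `[0, t]) f s = G t - G 0.
Proof.
move=> cf; exists (fun t => \int[lebesgue_measure]_(s in `[-1, t]) f s); split.
  move=> t t1.
  have [df E] := @continuous_FTC1_closed R f (-1) t (t + 1)
    (ltr_pwDr ltr01 (lexx _)) (continuous_itv_integrable _ _ cf) t1 (cf t).
  by split; [exact: df|rewrite -E derive1E].
move=> t t0.
have := @Rintegral_itvB R f (BLeft (-1)) (BRight t) 0.
rewrite /= => -> //.
- rewrite Rintegral_itv_obnd_cbnd//.
  apply: integrableS (continuous_itv_integrable 0 t cf) => //.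
  by move=> x /=; rewrite !in_itv/= => /andP[/ltW -> ->].
- exact: continuous_itv_integrable.
- by rewrite bnd_simp; lra.
Qed.

(** Only the inner product of the velocity with the solution enters, so a one-sided bound on the
    drift is enough. The norm is not differentiable at 0; its square is therefore shifted by
    [k ^+ 2], and [k] is sent to 0. *)
Lemma gronwall (R : realType) (d : nat) (u f : R -> 'cV[R]_d) (z : 'cV[R]_d)
    (C e T : R) : 0 <= C -> 0 <= e ->
  (forall i, continuous (fun s => f s i 0)) ->
  (forall (t : R) i, 0 <= t <= T ->
     u t i 0 = z i 0 + \int[lebesgue_measure]_(s in `[0, t]) f s i 0) ->
  (forall t : R, 0 <= t <= T ->
     inner (f t) (u t) <= C * enorm (u t) ^+ 2 + e * enorm (u t)) ->
  forall t : R, 0 <= t <= T -> enorm (u t) <= expR (C * t) * (enorm z + t * e).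
Proof.
move=> C0 e0 cf hu hfu t /andP[t0 tT].
have /choice[G hG] := fun i => @antiderivative R (fun s => f s i 0) (cf i).
(* The hypothesis describes [u] on [0, T] only; [V] coincides with it there and is differentiable at
   every s > -1. *)
pose V s : 'cV[R]_d := \col_i (z i 0 + (G i s - G i 0)).
have uV (s : R) : 0 <= s <= T -> u s = V s.
  move=> sT; apply/matrixP => i j; rewrite ord1 mxE hu//.
  by have [_ ->] := hG i; [|case/andP: sT].
have dV (s : R) i : -1 < s -> is_derive s 1 (fun s => V s i 0) (f s i 0).
  move=> s1; have [/(_ s s1) dG _] := hG i.
  have -> : (fun s => V s i 0) = (cst (z i 0 - G i 0) + G i).
    by apply/funext => r; rewrite mxE fctE /=; ring.
  by apply: is_derive_eq; rewrite add0r.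
suff main (k : R) : 0 < k -> enorm (u t) <= expR (C * t) * (enorm z + k + t * e).
  apply/ler_addgt0Pr => k k0.
  (* With k exp(-Ct) in the role of [k], the regularisation contributes exactly k after
     multiplication by exp(Ct). *)
  have ek : 0 < k * expR (- (C * t)) by rewrite mulr_gt0// expR_gt0.
  apply: (le_trans (main _ ek)).
  have E : expR (C * t) * expR (- (C * t)) = 1 by rewrite -expRD subrr expR0.
  rewrite le_eqVlt; apply/orP; left; apply/eqP.
  transitivity (expR (C * t) * (enorm z + t * e) +
    k * (expR (C * t) * expR (- (C * t)))); first by ring.
  by rewrite E mulr1.
move=> k0.
pose q s := inner (V s) (V s) + k ^+ 2.
have q0 (s : R) : 0 < q s by rewrite ltr_wpDl ?inner_ge0// exprn_gt0.
have dq (s : R) : -1 < s -> is_derive s 1 q (2 * inner (f s) (V s)).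
  move=> s1.
  have -> : q = (\sum_(i < d) ((fun s => V s i 0) * (fun s => V s i 0))) +
      cst (k ^+ 2).
    by apply/funext => r; rewrite /q /inner fctE /= fct_sumE.
  pose D i := f s i 0 * V s i 0 + V s i 0 * f s i 0.
  have dS : is_derive s 1
      (\sum_(i < d) ((fun s => V s i 0) * (fun s => V s i 0))) (\sum_(i < d) D i).
    apply: is_derive_sum => i.
    have := dV s i s1; move=> di.
    by apply: is_derive_eq; rewrite /D /GRing.scale/=; ring.
  apply: is_derive_eq; rewrite addr0 /inner mulr_sumr; apply: eq_bigr => i _.
  by rewrite /D; ring.
(* For s >= 0 the derivative of [phi] is at most e (exp(-Cs) - 1) <= 0, so [phi] is nonincreasing on
   [0, t]. *)
pose phi s := Num.sqrt (q s) * expR (- C * s) - s * e.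
have dphi (s : R) : -1 < s -> is_derive s 1 phi
   ((2 * inner (f s) (V s)) * (2 * Num.sqrt (q s))^-1 * expR (- C * s) -
     C * Num.sqrt (q s) * expR (- C * s) - e).
  move=> s1.
  have h1 := dq s s1.
  have h2 : is_derive s 1 (Num.sqrt \o q)
     ((2 * inner (f s) (V s)) * (2 * Num.sqrt (q s))^-1).
    have h3 := is_derive1_sqrt (q0 s).
    have h4 := @is_derive1_comp _ _ q s _ _ h3 h1.
    by apply: is_derive_eq; rewrite mulrC.
  have h5 : is_derive s 1 (expR \o (fun s => - C * s)) (- C * expR (- C * s)).
    have h6 := is_derive_expR (- C * s).
    have h7 : is_derive s 1 (fun s => - C * s) (- C).
      have -> : (fun s => - C * s) = (- C) *: id by [].
      by apply: is_derive_eq; rewrite /GRing.scale/= mulr1.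
    have h8 := @is_derive1_comp _ _ (fun s => - C * s) s _ _ h6 h7.
    by apply: is_derive_eq; rewrite mulrC.
  have -> : phi = (Num.sqrt \o q) * (expR \o (fun s => - C * s)) - e *: id.
    by apply/funext => r; rewrite /phi !fctE /= /GRing.scale/= [e * r]mulrC.
  apply: is_derive_eq; rewrite /GRing.scale/= mulr1; ring.
have phi_le : phi t <= phi 0.
  have := @ler0_derive1_le_cc R phi 0 t; apply => //.
  - by move=> s; rewrite in_itv/= => /andP[s0 _]; have [] := dphi s (lt_trans (ltrN10 R) s0).
  - move=> s; rewrite in_itv/= => /andP[s0 st].
    have s1 : -1 < s by lra.
    have d1 := dphi s s1; rewrite derive1E derive_val.
    have sT : 0 <= s <= T by apply/andP; split; lra.
    have := hfu s sT; rewrite uV// sqr_enorm => h.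
    have sq0 : 0 < Num.sqrt (q s) by rewrite sqrtr_gt0.
    have E1 : expR (- C * s) <= 1 by rewrite -expR0 ler_expR; nra.
    have E0 := expR_gt0 (- C * s).
    have n0 := enorm_ge0 (V s).
    have ns : enorm (V s) <= Num.sqrt (q s).
      by rewrite /enorm ler_wsqrtr// lerDl sqr_ge0.
    have ns2 : inner (V s) (V s) <= Num.sqrt (q s) ^+ 2.
      by rewrite sqr_sqrtr ?(ltW (q0 _))// lerDl sqr_ge0.
    have -> : 2 * inner (f s) (V s) * (2 * Num.sqrt (q s))^-1 =
        inner (f s) (V s) / Num.sqrt (q s) by field; rewrite gt_eqF.
    have : inner (f s) (V s) / Num.sqrt (q s) <= C * Num.sqrt (q s) + e.
      rewrite ler_pdivrMr//; apply: le_trans h _.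
      rewrite mulrDl -mulrA -expr2; apply: lerD; exact: ler_wpM2l.
    move=> h2.
    have : inner (f s) (V s) / Num.sqrt (q s) * expR (- C * s) <=
       (C * Num.sqrt (q s) + e) * expR (- C * s) by rewrite ler_wpM2r// ltW.
    nra.
  - apply: derivable_within_continuous => s; rewrite in_itv/= => /andP[s0 _].
    by have [] := dphi s (lt_le_trans (ltrN10 R) s0).
  - by rewrite in_itv/= lexx t0.
  - by rewrite in_itv/= lexx t0.
have sqrtD : Num.sqrt (q 0) <= enorm z + k.
  have V0 : V 0 = z by apply/matrixP => i j; rewrite ord1 mxE subrr addr0.
  rewrite -(ler_pXn2r (n := 2)) ?nnegrE ?sqrtr_ge0 ?addr_ge0 ?enorm_ge0 ?(ltW k0)//.
  rewrite sqr_sqrtr ?(ltW (q0 _))// /q V0 -sqr_enorm sqrrD.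
  by rewrite lerD2r lerDl mulrn_wge0// mulr_ge0// ?enorm_ge0// ltW.
have tT' : 0 <= t <= T by rewrite t0.
rewrite uV//.
have ns : enorm (V t) <= Num.sqrt (q t).
  by rewrite /enorm ler_wsqrtr// lerDl sqr_ge0.
apply: le_trans ns _.
rewrite -(ler_pM2r (expR_gt0 (- C * t))) mulrAC -expRD mulNr subrr expR0 mul1r.
move: phi_le; rewrite /phi !mulNr mulr0 oppr0 expR0 mulr1 mul0r subr0.
lra.
Qed.

(** Trades the real growth exponents of the hypotheses for natural ones, so that products of powers
    can be handled algebraically. *)
Lemma powR_le_nat (R : realType) (p : R) :
  exists n : nat, forall a : R, 1 <= a -> a `^ p <= a ^+ n.
Proof.
exists (Num.truncn p).+1 => a a1.
rewrite -powR_mulrn ?(le_trans ler01)//.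
rewrite ler_powR//; have [p0|p0] := leP 0 p; first by rewrite ltW// truncnS_gt.
by rewrite (le_trans (ltW p0)).
Qed.

Lemma is_derive_line (R : realType) (d : nat) (F : 'cV[R]_d -> 'cV[R]_d)
    (x h v : 'cV[R]_d) (s : R) : differentiable F (x + s *: h) ->
  is_derive s 1 (fun s : R => inner (F (x + s *: h)) v)
    (inner ('d F (x + s *: h) h) v).
Proof.
move=> dF.
have c (i : 'I_d) : is_derive s 1 (fun s : R => F (x + s *: h) i 0)
    ('d F (x + s *: h) h i 0).
  have h1 : is_diff s (fun s : R => x + s *: h) (fun s : R => s *: h).
    have h0 : is_diff s (fun s : R => s *: h) (fun s : R => s *: h).
      exact: (is_diff_scalel s h).
    have := is_diffD (is_diff_cst x s) h0.
    have -> : (cst x + (fun s : R => s *: h)) = (fun s : R => x + s *: h).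
      by apply/funext.
    suff -> : (cst 0 + (fun s : R => s *: h)) = (fun s : R => s *: h) by [].
    by apply/funext => r; rewrite fctE/= add0r.
  have h2 : is_diff (x + s *: h) F ('d F (x + s *: h)) by exact: DiffDef.
  have h3 := is_diff_comp h1 h2.
  have h4 : is_diff (F (x + s *: h)) (fun N : 'cV[R]_d => N i 0 : R)
      ('d (fun N : 'cV[R]_d => N i 0 : R) (F (x + s *: h))).
    by apply: DiffDef => //; exact: differentiable_coord.
  have h5 := is_diff_comp h3 h4.
  split.
    by apply: diff_derivable; case: h5.
  rewrite deriveE; last by case: h5.
  case: h5 => _ ->/=; rewrite scale1r.
  have lc : linear (fun N : 'cV[R]_d => N i 0 : R^o).
    by move=> a u w; rewrite !mxE.
  pose g := HB.pack_for {linear 'cV[R]_d -> R^o} (fun N : 'cV[R]_d => N i 0)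
    (GRing.isLinear.Build _ _ _ _ (fun N : 'cV[R]_d => N i 0 : R^o) lc).
  rewrite (_ : (fun N : 'cV[R]_d => N i 0) = (g : _ -> _)) // diff_lin//.
  exact: coord_continuous.
have -> : (fun s : R => inner (F (x + s *: h)) v) =
    \sum_(i < d) ((v i 0) *: (fun s : R => F (x + s *: h) i 0)).
  apply/funext => r; rewrite fct_sumE; apply: eq_bigr => i _.
  by rewrite fctE/= /GRing.scale/= mulrC.
have -> : inner ('d F (x + s *: h) h) v =
    \sum_(i < d) (v i 0 *: ('d F (x + s *: h) h i 0 : R^o)).
  by apply: eq_bigr => i _; rewrite mulrC.
by apply: is_derive_sum => i; have ci := c i; exact: is_deriveZ.
Qed.

(** The mean value theorem fails for vector-valued maps, so it is applied to the pairing with a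
    fixed [v]. The point [c] depends on [v], which suffices when [v] is the very vector to be
    estimated. *)
Lemma mean_value_inner (R : realType) (d : nat) (F : 'cV[R]_d -> 'cV[R]_d)
    (x h v : 'cV[R]_d) : (forall x, differentiable F x) ->
  exists2 c : R, 0 <= c <= 1 &
    inner (F (x + h) - F x) v = inner ('d F (x + c *: h) h) v.
Proof.
move=> dF.
have [||c] := @MVT_segment R (fun s : R => inner (F (x + s *: h)) v)
  (fun s => inner ('d F (x + s *: h) h) v) 0 1 ler01.
- by move=> s _; exact: is_derive_line.
- apply: derivable_within_continuous => s _.
  by have [] := @is_derive_line R d F x h v s (dF _).
rewrite in_itv/= => c01; rewrite scale1r scale0r addr0 subr0 mulr1 => E.
by exists c => //; rewrite innerDl innerNl.
Qed.

(** Divide the one-sided bound between x and x + h v by h^2 and let h decrease to 0; a limit from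
    the right is enough and fixes the sign of h. *)
Lemma derive_one_sided (R : realType) (d : nat) (F : 'cV[R]_d -> 'cV[R]_d) C :
  (forall x y, inner (F y - F x) (y - x) <= C * enorm (y - x) ^+ 2) ->
  forall x v, differentiable F x -> inner ('d F x v) v <= C * enorm v ^+ 2.
Proof.
move=> FC x v dF; have := @is_derive_line R d F x v v 0.
rewrite scale0r addr0 => /(_ dF)[dg <-].
have : (fun h : R => h^-1 *: (inner (F (x + (h + 0) *: v)) v - inner (F (x + 0 *: v)) v))
    @ 0^'+ --> 'D_1 (fun s : R => inner (F (x + s *: v)) v) 0.
  apply: cvg_dnbhs_at_right; move: dg; rewrite /derivable.
  under eq_fun do rewrite /= [_ *: 1]mulr1.
  move=> dg; suff -> : 'D_1 (fun s : R => inner (F (x + s *: v)) v) 0 =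
      lim (h^-1 *: (inner (F (x + (h + 0) *: v)) v - inner (F (x + 0 *: v)) v)
        @[h --> 0^']) by exact: dg.
  by rewrite -derive1E.
move=> /[dup] cvg /cvg_lim <-//.
apply: limr_le; first by apply/cvg_ex; eexists; exact: cvg.
near=> h.
have h0 : 0 < h by near: h; exact: nbhs_right_gt.
rewrite addr0 scale0r addr0 [_ *: _]mulrC ler_pdivrMr//.
have := FC x (x + h *: v).
rewrite addrAC subrr add0r innerZr enormZ innerDl innerNl gtr0_norm//.
rewrite exprMn => hh; rewrite -(ler_pM2l h0); apply: le_trans hh _.
by rewrite le_eqVlt; apply/orP; left; apply/eqP; ring.
Unshelve. all: by end_near. Qed.

Lemma linearB_fct (R : realType) (d : nat)
    (f g : {linear 'cV[R]_d -> 'cV[R]_d}) : linear (f \- g).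
Proof.
move=> a u v /=; rewrite (linearP f) (linearP g) scalerBr.
by rewrite opprD addrACA.
Qed.

Lemma linear_linear (R : realType) (d : nat)
    (f : {linear 'cV[R]_d -> 'cV[R]_d}) : linear f.
Proof. by move=> a u v; rewrite linearP. Qed.

Lemma first_order_expansion (R : realType) (d : nat)
    (F : 'cV[R]_d -> 'cV[R]_d) :
  (forall x, differentiable F x) -> holder_derivative F ->
  exists (r C : R) (p : nat), [/\ 0 < r <= 1, 0 < C &
    forall x h, enorm (F (x + h) - F x - 'd F x h) <=
      C * (1 + 2 * enorm x + enorm h) ^+ p * enorm h `^ (1 + r)].
Proof.
move=> dF [r [C [p [r01 C0 p1 hF]]]].
have [n hn] := powR_le_nat p.
exists r, C, n; split=> // x h.
(* The remainder is paired with itself: |v|^2 is then the pairing of (DF(x + c h) - DF(x)) h with v,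
   and one factor |v| cancels. *)
set v := F (x + h) - F x - 'd F x h.
have [c c01 E] := mean_value_inner x h v dF.
have r0 : 0 < r by case/andP: r01.
have nh := enorm_ge0 h; have nx := enorm_ge0 x.
have hch : enorm (c *: h) <= enorm h.
  rewrite enormZ ler_piMl// ger0_norm; lra.
have e1 : inner v v <= enorm (('d F (x + c *: h) \- 'd F x) h) * enorm v.
  apply: le_trans (inner_le _ _).
  rewrite {1}/v innerDl innerNl E /= innerDl innerNl.
  by rewrite lexx.
have [v0|v0] := eqVneq (enorm v) 0.
  by rewrite v0 mulr_ge0 ?powR_ge0// mulr_ge0 ?(ltW C0)// exprn_ge0//; lra.
have v_gt0 : 0 < enorm v by rewrite lt0r v0 enorm_ge0.
move: e1; rewrite -sqr_enorm expr2 ler_pM2r// => /le_trans; apply.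
apply: le_trans (opnormP _ (linearB_fct _ _)) _.
rewrite powRD; last by rewrite gt_eqF//=; lra.
rewrite powRr1// (mulrC (enorm h)) mulrA ler_wpM2r//.
apply: le_trans (hF _ _) _.
have -> : x + c *: h - x = c *: h by rewrite addrAC subrr add0r.
apply: ler_pM.
- by rewrite mulr_ge0 ?(ltW C0)// powR_ge0.
- exact: powR_ge0.
- rewrite ler_wpM2l ?(ltW C0)//.
  have := ler_enormD x (c *: h); have := enorm_ge0 (x + c *: h) => h1 h2.
  apply: le_trans (hn _ _) _; first by lra.
  by apply: lerXn2r; rewrite ?nnegrE; lra.
- by apply: ge0_ler_powR; rewrite ?nnegrE ?enorm_ge0// ltW.
Qed.

Lemma assumption_D_bounds (R : realType) (d : nat) (H : R)
    (F : 'cV[R]_d -> 'cV[R]_d) : assumption_D H F ->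
  exists (C K : R) (n : nat), [/\ 0 < C,
    forall x y, inner (F y - F x) (y - x) <= C * enorm (y - x) ^+ 2,
    forall x, differentiable F x,
    0 < K &
    forall x, enorm (F x) <= K * (1 + enorm x) ^+ n /\
      forall v, enorm ('d F x v) <= K * (1 + enorm x) ^+ n * enorm v].
Proof.
move=> [[C1 [C2 [C [_ _ C0 hC]]]] dF [K [N [K0 _ hK]]] _].
have [n hn] := powR_le_nat N.
exists C, K, n; split=> //.
  by move=> x y; apply: le_trans (hC x y) _; rewrite ge_min lexx orbT.
move=> x; have [h1 h2] := hK x.
have h3 : (1 + enorm x) `^ N <= (1 + enorm x) ^+ n.
  by apply: hn; rewrite lerDl enorm_ge0.
have h4 := ler_wpM2l (ltW K0) h3.
split; first exact: le_trans h1 h4.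
move=> v; apply: le_trans (opnormP _ (@linear_linear _ _ _)) _.
by rewrite ler_wpM2r ?enorm_ge0// (le_trans h2 h4).
Qed.

(** The integrand must be continuous on the whole line for [antiderivative] to apply; this is why
    flows are frozen before time 0 through [Num.max 0 t]. The relation is stable under linear
    combinations, so Gronwall can be applied to combinations of solutions. *)
Definition int_eq (R : realType) (d : nat) (T : R) (z : 'cV[R]_d)
    (f u : R -> 'cV[R]_d) : Prop :=
  (forall i, continuous (fun s => f s i 0)) /\
  forall (t : R) i, 0 <= t <= T ->
    u t i 0 = z i 0 + \int[lebesgue_measure]_(s in `[0, t]) f s i 0.

Lemma int_eq_lin (R : realType) (d : nat) (T a : R) (z z' : 'cV[R]_d)
    (f f' u u' : R -> 'cV[R]_d) :
  int_eq T z f u -> int_eq T z' f' u' ->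
  int_eq T (z + a *: z') (fun s => f s + a *: f' s) (fun s => u s + a *: u' s).
Proof.
move=> [cf uf] [cf' uf']; split.
  move=> i; rewrite (_ : (fun s => _) = (fun s => f s i 0 + a * f' s i 0)).
    move=> t; apply: cvgD; first exact: cf.
    by apply: cvgM; [exact: cvg_cst|exact: cf'].
  by apply/funext => s; rewrite !mxE.
move=> t i tT; rewrite !mxE uf// uf'//.
rewrite [X in _ = _ + X](_ : _ =
  \int[lebesgue_measure]_(s in `[0, t]) (f s i 0 + a * f' s i 0)); last first.
  by apply: eq_Rintegral => s _; rewrite !mxE.
rewrite RintegralD//; last 2 first.
- exact: continuous_itv_integrable.
- apply: continuous_itv_integrable => s.
  by apply: cvgM; [exact: cvg_cst|exact: cf'].
rewrite RintegralZl//; last exact: continuous_itv_integrable.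
by ring.
Qed.

Lemma int_eqB (R : realType) (d : nat) (T : R) (z z' : 'cV[R]_d)
    (f f' u u' : R -> 'cV[R]_d) :
  int_eq T z f u -> int_eq T z' f' u' ->
  int_eq T (z - z') (fun s => f s - f' s) (fun s => u s - u' s).
Proof.
move=> h h'; have := int_eq_lin (-1) h h'; rewrite scaleN1r.
by under eq_fun do rewrite scaleN1r;
  under [X in int_eq _ _ _ X]eq_fun do rewrite scaleN1r.
Qed.

Lemma int_eq0 (R : realType) (d : nat) (T : R) :
  int_eq T 0 (fun=> 0 : 'cV[R]_d) (fun=> 0).
Proof.
split; first by move=> i t; exact: cvg_cst.
move=> t i _; rewrite mxE.
by rewrite Rintegral_cst// mul0r addr0.
Qed.

Lemma int_eq_sum (R : realType) (d n : nat) (T : R) (a : 'I_n -> R)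
    (z : 'I_n -> 'cV[R]_d) (f u : 'I_n -> R -> 'cV[R]_d) :
  (forall i, int_eq T (z i) (f i) (u i)) ->
  int_eq T (\sum_i a i *: z i) (fun s => \sum_i a i *: f i s)
    (fun s => \sum_i a i *: u i s).
Proof.
elim: n a z f u => [|n IHn] a z f u h.
  rewrite big_ord0; have := int_eq0 d T.
  by under [X in _ -> int_eq _ _ X _]eq_fun do rewrite big_ord0;
    under [X in _ -> int_eq _ _ _ X]eq_fun do rewrite big_ord0.
rewrite big_ord_recr/=.
under [X in int_eq _ _ X _]eq_fun do rewrite big_ord_recr/=.
under [X in int_eq _ _ _ X]eq_fun do rewrite big_ord_recr/=.
by apply: int_eq_lin => //; apply: IHn => i; exact: h.
Qed.

Lemma int_eq_gronwall (R : realType) (d : nat) (C e T : R) (z : 'cV[R]_d)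
    (f u : R -> 'cV[R]_d) : 0 <= C -> 0 <= e -> int_eq T z f u ->
  (forall t : R, 0 <= t <= T ->
     inner (f t) (u t) <= C * enorm (u t) ^+ 2 + e * enorm (u t)) ->
  forall t : R, 0 <= t <= T -> enorm (u t) <= expR (C * t) * (enorm z + t * e).
Proof. by move=> C0 e0 [cf uf] h t tT; exact: (@gronwall _ _ u f z C e T). Qed.

(* [b] is the additive forcing: X' = F(X) + b' in integrated form. *)
Definition is_solution (R : realType) (d : nat) (F : 'cV[R]_d -> 'cV[R]_d)
    (b : R -> 'cV[R]_d) (T : R) (x : 'cV[R]_d) (X : R -> 'cV[R]_d) : Prop :=
  int_eq T x (fun s => F (X s)) (fun t => X t - b t).

Lemma is_solution_eq (R : realType) (d : nat) (F : 'cV[R]_d -> 'cV[R]_d)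
    (b b' : R -> 'cV[R]_d) (T : R) (x : 'cV[R]_d) (X : R -> 'cV[R]_d) :
  (forall t, 0 <= t <= T -> b t = b' t) ->
  is_solution F b T x X -> is_solution F b' T x X.
Proof. by move=> bb' [cX hX]; split=> // t i tT; rewrite -bb'// hX. Qed.

(** The forcing [b], which need not be differentiable, cancels, and the difference is an honest
    integral to which Gronwall applies. *)
Lemma solution_diff (R : realType) (d : nat) (F : 'cV[R]_d -> 'cV[R]_d)
    (b : R -> 'cV[R]_d) (T : R) (x y : 'cV[R]_d) (X Y : R -> 'cV[R]_d) :
  is_solution F b T x X -> is_solution F b T y Y ->
  int_eq T (x - y) (fun s => F (X s) - F (Y s)) (fun s => X s - Y s).
Proof.
move=> hX hY; have := int_eqB hX hY.
by under [X in int_eq _ _ _ X]eq_fun do rewrite opprB addrA subrK.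
Qed.

(** Gronwall with [e = 0]. For equal initial values this is uniqueness, in which form it serves
    [flow_noise_eq] and [flow_step]. *)
Lemma solution_contract (R : realType) (d : nat) (F : 'cV[R]_d -> 'cV[R]_d)
    (C : R) (b : R -> 'cV[R]_d) (T : R) (x y : 'cV[R]_d) (X Y : R -> 'cV[R]_d) :
  0 <= C ->
  (forall x y, inner (F y - F x) (y - x) <= C * enorm (y - x) ^+ 2) ->
  is_solution F b T x X -> is_solution F b T y Y ->
  forall t, 0 <= t <= T -> enorm (X t - Y t) <= expR (C * t) * enorm (x - y).
Proof.
move=> C0 hC hX hY t tT.
have := int_eq_gronwall C0 (lexx 0) (solution_diff hX hY) _ tT.
by rewrite mulr0 addr0; apply => s sT; rewrite mul0r addr0.
Qed.

(** Gronwall for X - b: the one-sided bound compares F(X) with F(b), and F(b) remains as the error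
    term [e]. *)
Lemma solution_bound (R : realType) (d : nat) (F : 'cV[R]_d -> 'cV[R]_d)
    (C m e : R) (b : R -> 'cV[R]_d) (T : R) (x : 'cV[R]_d) (X : R -> 'cV[R]_d) :
  0 <= C -> 0 <= e ->
  (forall x y, inner (F y - F x) (y - x) <= C * enorm (y - x) ^+ 2) ->
  (forall t, 0 <= t <= T -> enorm (b t) <= m) ->
  (forall t, 0 <= t <= T -> enorm (F (b t)) <= e) ->
  is_solution F b T x X ->
  forall t, 0 <= t <= T ->
    enorm (X t) <= expR (C * t) * (enorm x + t * e) + m.
Proof.
move=> C0 e0 hC hb hFb hX t tT.
have : enorm (X t - b t) <= expR (C * t) * (enorm x + t * e).
  apply: (int_eq_gronwall C0 e0 hX) => // s sT.
  have := hC (b s) (X s); rewrite innerDl innerNl lerBlDr => /le_trans; apply.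
  rewrite lerD2l (le_trans (inner_le _ _))// ler_wpM2r ?enorm_ge0//.
  exact: hFb.
by have := ler_enorm_dist (X t) (b t); have := hb t tT; lra.
Qed.

Lemma flow_continuous (R : realType) (d : nat) (H : R)
    (F : 'cV[R]_d -> 'cV[R]_d) (sigma : 'M[R]_d)
    (B : R -> noise d H * noise d H -> 'cV[R]_d)
    (Phi : R -> noise d H * noise d H -> 'cV[R]_d -> 'cV[R]_d) :
  is_flow F sigma B Phi ->
  forall w x, continuous (fun t : R => Phi (Num.max 0 t) w x).
Proof.
move=> hPhi w x; have [cP _] := hPhi w x.
move/continuous_within_itvcyP : cP => [c0 c1] t.
rewrite /continuous_at; have [t0|t0|t0] := ltgtP t 0.
- have h : \forall s \near t, Phi 0 w x = Phi (Num.max 0 s) w x.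
    near=> s; have s0 : s < 0 by near: s; exact: lt_nbhsl.
    by rewrite max_l// ltW.
  by apply: cvg_trans (near_eq_cvg h) _; exact: cvg_cst.
- have h : \forall s \near t, Phi s w x = Phi (Num.max 0 s) w x.
    near=> s; have s0 : 0 < s by near: s; exact: lt_nbhsr.
    by rewrite max_r// ltW.
  apply: cvg_trans (near_eq_cvg h) _.
  by have := c0 t; rewrite in_itv/= t0 => /(_ isT).
- rewrite t0; apply/cvgrPdist_lt => e e0.
  move/cvgrPdist_lt : c1 => /(_ e e0); rewrite near_withinE => h.
  near=> s; have [s0|s0] := leP s 0; first by rewrite subrr normr0.
  by apply: (near h s) => //; near: s.
Unshelve. all: by end_near. Qed.

Lemma flow_solution (R : realType) (d : nat) (H : R)
    (F : 'cV[R]_d -> 'cV[R]_d) (sigma : 'M[R]_d)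
    (B : R -> noise d H * noise d H -> 'cV[R]_d)
    (Phi : R -> noise d H * noise d H -> 'cV[R]_d -> 'cV[R]_d) :
  (forall x, differentiable F x) -> is_flow F sigma B Phi ->
  forall w x T, is_solution F (fun t => sigma *m B t w) T x
    (fun t => Phi (Num.max 0 t) w x).
Proof.
move=> dF hPhi w x T; have [cP eP] := hPhi w x; split.
  move=> i.
  have c1 := @flow_continuous _ _ _ _ _ _ _ hPhi w x.
  have c2 : continuous (fun s : R => F (Phi (Num.max 0 s) w x)).
    move=> s; apply: (@continuous_comp _ _ _ _ F s (c1 s)).
    exact/differentiable_continuous/dF.
  move=> t.
  exact: (@continuous_comp _ _ _ _ (fun N : 'cV[R]_d => N i 0) t (c2 t)
    (@coord_continuous _ _ _ i 0 _)).
move=> t i /andP[t0 _]; rewrite (max_r t0) eP// addrK !mxE; congr (_ + _).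
apply: eq_Rintegral => s; rewrite inE/= in_itv/= => /andP[s0 _].
by rewrite max_r.
Qed.

(** * Differentiability of the time-one map *)

Lemma linear_cV_continuous (R : realType) (d : nat)
  (f : {linear 'cV[R]_d -> 'cV[R]_d}) : continuous f.
Proof.
move=> x; apply/(@cvgrPdist_le _ _ _ (nbhs x) _ f) => e e0.
pose L := (\sum_i enorm (f (evec R i))) * d%:R.
have L0 : 0 <= L.
  by rewrite mulr_ge0// sumr_ge0// => i _; exact: enorm_ge0.
have L1 : 0 < L + 1 by rewrite ltr_wpDl.
near=> y.
have h : `|x - y| <= e / (L + 1).
  near: y; have := @cvgr_dist_le _ _ _ (nbhs x) _ id x cvg_id (e / (L + 1)).
  by apply; rewrite divr_gt0.
rewrite -linearB (le_trans (norm_le_enorm _))//.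
rewrite (le_trans (linear_le_sum (linear_linear f) _))//.
apply: (@le_trans _ _ (L * `|x - y|)).
  rewrite /L -mulrA ler_wpM2l ?enorm_le_norm//.
  by rewrite sumr_ge0// => i _; exact: enorm_ge0.
apply: (@le_trans _ _ ((L + 1) * `|x - y|)); first by rewrite ler_wpM2r// lerDl.
by rewrite mulrC -ler_pdivlMr.
Unshelve. all: by end_near. Qed.

Lemma differentiable_expansion (R : realType) (d : nat)
    (f : 'cV[R]_d -> 'cV[R]_d) (x : 'cV[R]_d) (M : 'M[R]_d) (K r : R) :
  0 <= K -> 0 < r ->
  (forall z, enorm z <= 1 ->
     enorm (f (x + z) - f x - M *m z) <= K * enorm z `^ (1 + r)) ->
  differentiable f x /\ 'd f x = (fun z => M *m z) :> ('cV[R]_d -> 'cV[R]_d).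
Proof.
move=> K0 r0 hM.
have cM : continuous (mulmx M : 'cV[R]_d -> 'cV[R]_d).
  exact: linear_cV_continuous.
have exp : f \o shift x = cst (f x) + (mulmx M : 'cV[R]_d -> _) +o_ (0 : 'cV[R]_d) id.
  apply/eqaddoP => e e0.
  pose L := K * d%:R * d%:R `^ r.
  have L0 : 0 <= L by rewrite mulr_ge0 ?powR_ge0// mulr_ge0.
  have L1 : 0 < L + 1 by rewrite ltr_wpDl.
  (* The first entry puts [z] into the Euclidean unit ball, where the hypothesis holds; the second
     makes the r-th power of the max norm of [z] at most e / (L + 1). *)
  pose del := Num.min (1 / (d%:R + 1)) ((e / (L + 1)) `^ r^-1).
  have del0 : 0 < del.
    by rewrite lt_min powR_gt0 ?divr_gt0//= ltr_wpDl.
  near=> z.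
  have hz : `|z| <= del.
    near: z; have := @cvgr0_norm_le _ _ _ (nbhs (0:'cV[R]_d)) _ id cvg_id del.
    by apply.
  move: hz; rewrite le_min => /andP[hz1 hz2].
  have ez1 : enorm z <= 1.
    apply: le_trans (enorm_le_norm z) _.
    have := ler_wpM2l (ler0n R d) hz1; move=> /le_trans; apply.
    by rewrite mulrA mulr1 ler_pdivrMr ?ltr_wpDl// mul1r lerDl.
  have -> : (f \o shift x - (cst (f x) + mulmx M)) z = f (x + z) - f x - M *m z.
    by rewrite !fctE /= (addrC z) opprD addrA.
  apply: le_trans (norm_le_enorm _) _; apply: le_trans (hM _ ez1) _.
  rewrite powRD; last by rewrite gt_eqF//=; lra.
  rewrite powRr1 ?enorm_ge0//.
  have h1 : enorm z `^ r <= d%:R `^ r * (e / (L + 1)).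
    have : enorm z `^ r <= (d%:R * `|z|) `^ r.
      apply: ge0_ler_powR; rewrite ?nnegrE ?enorm_ge0 ?enorm_le_norm ?(ltW r0)//.
    move=> /le_trans; apply; rewrite powRM// ler_wpM2l ?powR_ge0//.
    have : `|z| `^ r <= ((e / (L + 1)) `^ r^-1) `^ r.
      by apply: ge0_ler_powR; rewrite ?nnegrE ?powR_ge0 ?(ltW r0).
    by rewrite -powRrM mulVf ?gt_eqF// powRr1// divr_ge0// ltW.
  have h2 := enorm_le_norm z.
  have : enorm z * enorm z `^ r <= (d%:R * `|z|) * (d%:R `^ r * (e / (L + 1))).
    by apply: ler_pM; rewrite ?enorm_ge0 ?powR_ge0.
  move=> /(ler_wpM2l K0) /le_trans; apply.
  have -> : K * (d%:R * `|z| * (d%:R `^ r * (e / (L + 1)))) =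
      e * (L / (L + 1)) * `|z| by rewrite /L; field; rewrite gt_eqF.
  rewrite ler_wpM2r// ler_piMr ?(ltW e0)//.
  by rewrite ler_pdivrMr// mul1r lerDl.
have E := diff_unique cM exp.
split; last exact: E.
by apply/diff_locallyP; rewrite E; split.
Unshelve. all: by end_near. Qed.

(** A map that agrees, up to a superlinear error, with its own difference quotients at every scale
    [eps] has a linear part. Tested on small multiples of the basis vectors, the hypothesis makes
    those quotients Cauchy, and their limits are the columns of [M]. *)
Lemma approx_linear (R : realType) (d : nat) (phi : 'cV[R]_d -> 'cV[R]_d)
    (K r : R) : 0 <= K -> 0 < r ->
  (forall z eps, enorm z <= 1 -> 0 < eps <= 1 ->
     enorm (phi z - \sum_i (z i 0 / eps) *: phi (eps *: evec R i)) <=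
       K * (enorm z `^ (1 + r) + (\sum_i `|z i 0|) * eps `^ r)) ->
  exists M : 'M[R]_d, forall z, enorm z <= 1 ->
    enorm (phi z - M *m z) <= K * enorm z `^ (1 + r).
Proof.
move=> K0 r0 hphi.
have r1 : r^-1 > 0 by rewrite invr_gt0.
(* The exponent is chosen so that the r-th power of [eps n] is exactly 1/(n+1). *)
pose eps (n : nat) : R := n.+1%:R `^ (- r^-1).
have eps0 n : 0 < eps n by rewrite powR_gt0.
have eps1 n : eps n <= 1.
  rewrite /eps -[leRHS](powRr0 n.+1%:R) ler_powR//; first by rewrite ler1n.
  by rewrite oppr_le0 ltW.
have epsr n : eps n `^ r = n.+1%:R^-1.
  by rewrite /eps -powRrM mulNr mulVf ?gt_eqF// powR_inv1.
pose a i n := (eps n)^-1 *: phi (eps n *: evec R i).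
(* The hypothesis for the vector [eps n *: evec R i] at scale [eps m], divided by [eps n]. *)
have hd i n m : enorm (a i n - a i m) <= K * (n.+1%:R^-1 + m.+1%:R^-1).
  have := hphi (eps n *: evec R i) (eps m).
  rewrite enormZ enorm_evec mulr1 gtr0_norm// eps1 eps0 => /(_ isT).
  rewrite eps1 => /(_ isT).
  have -> : \sum_i0 ((eps n *: evec R i) i0 0 / eps m) *: phi (eps m *: evec R i0)
      = eps n *: a i m.
    rewrite (bigD1 i)//= big1 ?addr0.
      by rewrite !mxE !eqxx mulr1 /a scalerA.
    by move=> k ki; rewrite !mxE (negbTE ki) mulr0 mul0r scale0r.
  have -> : \sum_i0 `|(eps n *: evec R i) i0 0| = eps n.
    rewrite (bigD1 i)//= big1 ?addr0.
      by rewrite !mxE !eqxx mulr1 gtr0_norm.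
    by move=> k ki; rewrite !mxE (negbTE ki) mulr0 normr0.
  rewrite powRD; last by rewrite gt_eqF//=; lra.
  rewrite powRr1 ?(ltW (eps0 _))// !epsr => h.
  have -> : a i n - a i m = (eps n)^-1 *: (phi (eps n *: evec R i) - eps n *: a i m).
    by rewrite scalerBr scalerA mulVf ?gt_eqF// scale1r.
  rewrite enormZ gtr0_norm ?invr_gt0// mulrC ler_pdivrMr//.
  by apply: le_trans h _; rewrite le_eqVlt; apply/orP; left; apply/eqP; ring.
have hcvg i : cvg (a i n @[n --> \oo]).
  apply: cauchy_cvg; apply: cauchy_exP => e e0.
  have [N hN] : exists N : nat, K * (2 * N.+1%:R^-1) < e.
    exists (Num.truncn (2 * K / e)); rewrite mulrA ltr_pdivrMr//.
    by rewrite -ltr_pdivrMl// mulrC [K * 2]mulrC truncnS_gt.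
  exists (a i N); exists N => // n /= nN.
  rewrite -ball_normE /= (le_lt_trans (norm_le_enorm _))//.
  apply: le_lt_trans (hd _ _ _) _; apply: le_lt_trans _ hN.
  rewrite ler_wpM2l// mulr_natl mulr2n lerD2l lef_pV2 ?posrE//.
  by rewrite ler_nat.
pose D i := lim (a i n @[n --> \oo]).
exists (\matrix_(j, i) D i j 0) => z z1.
have -> : (\matrix_(j, i) D i j 0) *m z = \sum_i z i 0 *: D i.
  apply/matrixP => j k; rewrite ord1 mxE summxE; apply: eq_bigr => i _.
  by rewrite !mxE mulrC.
apply/ler_addgt0Pr => e e0.
pose S := \sum_i `|z i 0|.
have S0 : 0 <= S by exact: sumr_ge0.
have c0 : 0 < e / (2 * (S + 1) * (d%:R + 1)).
  by rewrite divr_gt0// mulr_gt0// ?mulr_gt0// ltr_wpDl.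
have [n [hn1 hn2]] : exists n : nat,
    (forall i, `|D i - a i n| <= e / (2 * (S + 1) * (d%:R + 1))) /\
    K * (S * n.+1%:R^-1) <= e / 2.
  have h1 i : \forall n \near \oo, `|D i - a i n| <= e / (2 * (S + 1) * (d%:R + 1)).
    by have /cvgrPdist_le := hcvg i; exact.
  have h2 : \forall n \near \oo, K * (S * n.+1%:R^-1) <= e / 2.
    exists (Num.truncn (2 * (K * S) / e)) => // n /= hn.
    rewrite mulrA ler_pdivrMr// -ler_pdivrMl ?divr_gt0//.
    apply: (@le_trans _ _ (Num.truncn (2 * (K * S) / e)).+1%:R).
      rewrite ltW//; apply: le_lt_trans (truncnS_gt _).
      by rewrite le_eqVlt; apply/orP; left; apply/eqP; field; rewrite gt_eqF.
    by rewrite ler_nat.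
  have h3 : \forall n \near \oo, forall i, `|D i - a i n| <= e / (2 * (S + 1) * (d%:R + 1)).
    exact: filter_forall.
  have [n h] : exists n, (forall i, `|D i - a i n| <= e / (2 * (S + 1) * (d%:R + 1))) /\ K * (S * n.+1%:R^-1) <= e / 2.
    exact: (@filter_ex _ (nbhs \oo) _ _ (filterI h3 h2)).
  by exists n.
have -> : phi z - \sum_i z i 0 *: D i =
    (phi z - \sum_i (z i 0 / eps n) *: phi (eps n *: evec R i)) -
    \sum_i z i 0 *: (D i - a i n).
  have -> : \sum_i (z i 0 / eps n) *: phi (eps n *: evec R i) =
      \sum_i z i 0 *: a i n by apply: eq_bigr => i _; rewrite scalerA.
  have -> : \sum_i z i 0 *: (D i - a i n) =
      \sum_i z i 0 *: D i - \sum_i z i 0 *: a i n.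
    by rewrite -sumrB; apply: eq_bigr => i _; rewrite scalerBr.
  by rewrite opprB addrA subrK.
apply: le_trans (ler_enormD _ _) _; rewrite enormN.
have p1 := hphi z (eps n) z1; move: p1; rewrite eps0 eps1 => /(_ isT) p1.
have p2 : enorm (\sum_i z i 0 *: (D i - a i n)) <= e / 2.
  apply: le_trans (ler_enorm_sum _) _.
  apply: (@le_trans _ _ (\sum_i `|z i 0| * (d%:R * (e / (2 * (S + 1) * (d%:R + 1)))))).
    apply: ler_sum => i _; rewrite enormZ ler_wpM2l//.
    by rewrite (le_trans (enorm_le_norm _))// ler_wpM2l.
  rewrite -mulr_suml -/S.
  have -> : S * (d%:R * (e / (2 * (S + 1) * (d%:R + 1)))) =
      (e / 2) * ((S / (S + 1)) * (d%:R / (d%:R + 1))).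
    by field; rewrite !gt_eqF// ltr_wpDl.
  rewrite ler_piMr ?divr_ge0// ?(ltW e0)//.
  have q (b : R) : 0 <= b -> 0 <= b / (b + 1) <= 1.
    move=> b0; rewrite divr_ge0 ?addr_ge0//= ler_pdivrMr ?ltr_wpDl//.
    by rewrite mul1r lerDl.
  have /andP[q1 q2] := q S S0; have /andP[q3 q4] := q d%:R (ler0n R d).
  by rewrite mulr_ile1.
move: p1; rewrite epsr -/S mulrDr => p1.
rewrite [e]splitr addrA lerD//.
by apply: le_trans p1 _; rewrite lerD2l.
Qed.

(* The flow of [F] inherits from the one-sided bound and the Hoelder derivative
   a first-order expansion, without solving the linearised equation: the
   differences [X (x + z) - X x] are approximately linear in [z]. *)
Lemma flow_expansion (R : realType) (d : nat) (F : 'cV[R]_d -> 'cV[R]_d)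
    (C r C' : R) (p : nat) :
  0 <= C -> 0 < r <= 1 -> 0 < C' ->
  (forall x y, inner (F y - F x) (y - x) <= C * enorm (y - x) ^+ 2) ->
  (forall x, differentiable F x) ->
  (forall x h, enorm (F (x + h) - F x - 'd F x h) <=
      C' * (1 + 2 * enorm x + enorm h) ^+ p * enorm h `^ (1 + r)) ->
  exists2 K : R, 0 < K &
  forall (b : R -> 'cV[R]_d) (X : 'cV[R]_d -> R -> 'cV[R]_d) x G,
  (forall y, is_solution F b 1 y (X y)) ->
  (forall t, 0 <= t <= 1 -> 1 + 2 * enorm (X x t) <= G) ->
  differentiable (fun y => X y 1) x /\
  forall z, enorm z <= 1 ->
    enorm (X (x + z) 1 - X x 1 - 'd (fun y => X y 1) x z) <=
      K * G ^+ p * enorm z `^ (1 + r).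
Proof.
move=> C0 /andP[r0 r1] C'0 hC dF hF.
pose E := expR C.
have E1 : 1 <= E by rewrite /E -expR0 ler_expR.
have E0 : 0 < E by apply: lt_le_trans E1.
exists (E * (C' * (1 + E) ^+ p * E ^+ 2)).
  by rewrite !mulr_gt0 ?exprn_gt0// ltr_wpDl.
move=> b X x G hX hG.
have G1 : 1 <= G.
  have := hG 0; rewrite lexx ler01 => /(_ isT).
  by apply: le_trans; rewrite lerDl mulr_ge0 ?enorm_ge0.
pose K1 := C' * (G + E) ^+ p * E ^+ 2.
have K1_0 : 0 <= K1.
  by rewrite !mulr_ge0 ?exprn_ge0 ?(ltW C'0) ?(ltW E0)// addr_ge0//; lra.
have contr z t : 0 <= t <= 1 -> enorm (X (x + z) t - X x t) <= E * enorm z.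
  move=> /andP[t0 t1].
  have := solution_contract C0 hC (hX (x + z)) (hX x) (t := t).
  rewrite t0 t1 addrAC subrr add0r => /(_ isT) /le_trans; apply.
  by rewrite ler_wpM2r ?enorm_ge0// ler_expR ler_piMr.
(* Error of linearising [F] along the unperturbed orbit; Gronwall keeps the displacement below E
   |z|, so the error is of order |z|^(1 + r). *)
pose rho z t := F (X (x + z) t) - F (X x t) - 'd F (X x t) (X (x + z) t - X x t).
have hrho z t : enorm z <= 1 -> 0 <= t <= 1 ->
    enorm (rho z t) <= K1 * enorm z `^ (1 + r).
  move=> z1 t01; rewrite /rho; set del := X (x + z) t - X x t.
  have XE : X (x + z) t = X x t + del by rewrite /del addrCA subrr addr0.
  rewrite XE.
  apply: le_trans (hF _ _) _.
  have h1 : enorm del <= E * enorm z by exact: contr.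
  have h2 : enorm del <= E.
    by apply: le_trans h1 _; rewrite ler_piMr// ltW.
  rewrite /K1 -[leLHS]mulrA -[leRHS]mulrA -[leRHS]mulrA ler_wpM2l ?(ltW C'0)//.
  apply: ler_pM.
  - by rewrite exprn_ge0// !addr_ge0 ?enorm_ge0// mulr_ge0 ?enorm_ge0.
  - exact: powR_ge0.
  - have := hG t t01; have := enorm_ge0 (X x t); have := enorm_ge0 del.
    by move=> ? ? ?; apply: lerXn2r; rewrite ?nnegrE; lra.
  - apply: (@le_trans _ _ ((E * enorm z) `^ (1 + r))).
      by apply: ge0_ler_powR; rewrite ?nnegrE ?mulr_ge0 ?enorm_ge0 ?(ltW E0)//; lra.
    rewrite powRM ?enorm_ge0 ?(ltW E0)// ler_wpM2r ?powR_ge0//.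
    rewrite -powR_mulrn ?(ltW E0)// ler_powR//; lra.
have [M hM] : exists M : 'M[R]_d, forall z, enorm z <= 1 ->
    enorm ((X (x + z) 1 - X x 1) - M *m z) <= (E * K1) * enorm z `^ (1 + r).
  apply: (approx_linear (phi := fun z => X (x + z) 1 - X x 1)) => //.
    by rewrite mulr_ge0 ?(ltW E0).
  move=> z eps z1 /andP[e0 e1].
  pose c i := z i 0 / eps.
  pose u s := (X (x + z) s - X x s) -
    \sum_i c i *: (X (x + eps *: evec R i) s - X x s).
  pose f s := (F (X (x + z) s) - F (X x s)) -
    \sum_i c i *: (F (X (x + eps *: evec R i) s) - F (X x s)).
  (* The initial value is 0 because [z] is the combination of the vectors [eps *: evec R i] with
     coefficients [c]. *)
  have hu : int_eq 1 0 f u.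
    have h1 := solution_diff (hX (x + z)) (hX x).
    have h2 := int_eq_sum c (fun i => solution_diff (hX (x + eps *: evec R i)) (hX x)).
    have := int_eqB h1 h2.
    suff -> : x + z - x - \sum_i c i *: (x + eps *: evec R i - x) = 0 by [].
    have xz (z' : 'cV[R]_d) : x + z' - x = z' by rewrite addrC addKr.
    rewrite xz [X in X - _]sum_evec -sumrB big1// => i _.
    rewrite xz scalerA /c mulfVK ?gt_eqF//.
    by rewrite subrr.
  pose e := K1 * (enorm z `^ (1 + r) + (\sum_i `|z i 0|) * eps `^ r).
  have e_0 : 0 <= e.
    by rewrite mulr_ge0// addr_ge0 ?powR_ge0// mulr_ge0 ?powR_ge0 ?sumr_ge0.
  suff gr : enorm (u 1) <= expR (C * 1) * (enorm (0 : 'cV[R]_d) + 1 * e).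
    by apply: le_trans gr _; rewrite enorm0 add0r mul1r mulr1 -/E /e mulrA.
  apply: (int_eq_gronwall C0 e_0 hu); last by rewrite ler01 lexx.
  move=> t t01.
  (* The velocity of [u] is DF(X) u plus linearisation errors. Since DF inherits the one-sided
     bound, Gronwall applies with these errors as [e]. *)
  have fE : f t = 'd F (X x t) (u t) +
      (rho z t - \sum_i c i *: rho (eps *: evec R i) t).
    rewrite /u linearB linear_sum /=.
    have -> : \sum_i 'd F (X x t) (c i *: (X (x + eps *: evec R i) t - X x t)) =
        \sum_i c i *: 'd F (X x t) (X (x + eps *: evec R i) t - X x t).
      by apply: eq_bigr => i _; rewrite linearZ.
    have -> : \sum_i c i *: rho (eps *: evec R i) t =
       \sum_i c i *: (F (X (x + eps *: evec R i) t) - F (X x t)) -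
       \sum_i c i *: 'd F (X x t) (X (x + eps *: evec R i) t - X x t).
      by rewrite -sumrB; apply: eq_bigr => i _; rewrite -scalerBr.
    rewrite /f /rho.
    move: ('d F (X x t) (X (x + z) t - X x t)) => A.
    move: (\sum_i _ *: 'd _ _ _) (\sum_i _) (F (X (x + z) t) - F (X x t)) => B D L.
    apply/matrixP => i j; rewrite !mxE; ring.
  rewrite fE innerDl lerD//; first by apply: derive_one_sided.
  apply: le_trans (inner_le _ _) _; rewrite ler_wpM2r ?enorm_ge0//.
  apply: le_trans (ler_enormD _ _) _; rewrite enormN /e mulrDr lerD//.
    exact: hrho.
  apply: le_trans (ler_enorm_sum _) _; rewrite mulr_suml mulr_sumr.
  apply: ler_sum => i _; rewrite enormZ /c normrM normfV (gtr0_norm e0).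
  have := hrho (eps *: evec R i) t; rewrite enormZ enorm_evec mulr1 (gtr0_norm e0).
  move=> /(_ e1 t01); rewrite powRD; last by rewrite gt_eqF//=; lra.
  rewrite powRr1 ?(ltW e0)// => h.
  have -> : K1 * (`|z i 0| * eps `^ r) =
      `|z i 0| / eps * (K1 * (eps * eps `^ r)) by field; rewrite gt_eqF.
  by rewrite ler_wpM2l// divr_ge0// ltW.
(* Since G >= 1, one has G + E <= (1 + E) G; this factors out the power of [G] and leaves a constant
   independent of the orbit. *)
have EK1 : E * K1 <= E * (C' * (1 + E) ^+ p * E ^+ 2) * G ^+ p.
  have h : (G + E) ^+ p <= (1 + E) ^+ p * G ^+ p.
    by rewrite -exprMn; apply: lerXn2r; rewrite ?nnegrE; nra.
  have -> : E * K1 = (E * C' * E ^+ 2) * (G + E) ^+ p by rewrite /K1; ring.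
  have -> : E * (C' * (1 + E) ^+ p * E ^+ 2) * G ^+ p =
    (E * C' * E ^+ 2) * ((1 + E) ^+ p * G ^+ p) by ring.
  by rewrite ler_wpM2l// !mulr_ge0 ?exprn_ge0 ?(ltW E0) ?(ltW C'0).
have K0 : 0 <= E * K1 by rewrite mulr_ge0 ?(ltW E0).
have [dX eX] := @differentiable_expansion R d (fun y => X y 1) x M (E * K1) r K0 r0 hM.
split=> // z z1; rewrite eX; apply: le_trans (hM _ z1) _.
by rewrite ler_wpM2r ?powR_ge0.
Qed.

(** * Euler scheme *)

Lemma unit_itv_unif_continuous (R : realType) (g : R -> R) : continuous g ->
  forall e : R, 0 < e -> exists2 del : R, 0 < del &
    forall s t : R, 0 <= s <= 1 -> `|s - t| < del -> `|g s - g t| < e.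
Proof.
move=> cg e e0.
have /compact_near_coveringP := @segment_compact R 0 1.
move=> /(_ R (0 : R)^'+ (fun del s => forall t : R, `|s - t| < del -> `|g s - g t| < e)).
have H : forall s : R, `[0, 1]%classic s ->
    \forall x' \near s & i \near (0 : R)^'+,
      forall t : R, `|x' - t| < i -> `|g x' - g t| < e.
  move=> s _; have /cvgrPdist_lt /(_ (e / 2)) := cg s.
  rewrite divr_gt0// => /(_ isT) /nbhs_ballP[r /= r0 hr].
  have r20 : 0 < r / 2 by rewrite divr_gt0.
  exists (ball s (r / 2), [set del | 0 < del < r / 2]) => /=.
    split; first exact: nbhsx_ballx.
    exists (r / 2) => //= y /=; rewrite sub0r normrN => h y0.
    by rewrite y0 (le_lt_trans (ler_norm _) h).
  move=> [x' del] /= [hx /andP[d0 dr]] t ht.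
  have h1 : `|s - x'| < r.
    by move: hx; rewrite -ball_normE /= => hx; lra.
  have h2 : `|s - t| < r.
    have : `|s - t| <= `|s - x'| + `|x' - t| by rewrite ler_distD.
    by move: hx; rewrite -ball_normE /= => hx; lra.
  have a1 : `|g s - g x'| < e / 2 by apply: hr; rewrite -ball_normE.
  have a2 : `|g s - g t| < e / 2 by apply: hr; rewrite -ball_normE.
  have : `|g x' - g t| <= `|g x' - g s| + `|g s - g t| by rewrite ler_distD.
  rewrite (distrC (g x') (g s)); lra.
move=> /(_ _ H) h.
have [del [d0 hd]] : exists del : R, 0 < del /\
    (`[0, 1]%classic `<=` (fun s => forall t : R, `|s - t| < del -> `|g s - g t| < e)).
  have h' : \forall del \near (0 : R)^'+, 0 < del by exact: nbhs_right_gt.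
  exact: (@filter_ex _ (0 : R)^'+ _ _ (filterI h' h)).
by exists del => // s t s01; apply: (hd s); rewrite /= in_itv/=.
Qed.

(* Euler scheme for [X - b]. *)
Fixpoint euler (R : realType) (d : nat) (F : 'cV[R]_d -> 'cV[R]_d)
    (b : R -> 'cV[R]_d) (h : R) (x : 'cV[R]_d) (k : nat) : 'cV[R]_d :=
  if k is k'.+1 then
    euler F b h x k' + h *: F (euler F b h x k' + b (k'%:R * h))
  else x.

(** Serves the measurability of the flow: each Euler step depends measurably on starting point and
    noise. [L] is a Lipschitz constant of [F] only for displacements of length at most 1 from the
    ball of radius [G], so the induction must keep the scheme near the solution. *)
Lemma euler_cvg (R : realType) (d : nat) (F : 'cV[R]_d -> 'cV[R]_d)
    (b : R -> 'cV[R]_d) (x : 'cV[R]_d) (X : R -> 'cV[R]_d) (G L : R) :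
  is_solution F b 1 x X -> (forall t, 0 <= t <= 1 -> enorm (X t) <= G) ->
  0 <= L ->
  (forall y h, enorm y <= G -> enorm h <= 1 ->
     enorm (F (y + h) - F y) <= L * enorm h) ->
  forall e : R, 0 < e -> exists N : nat, forall n : nat, (N <= n)%N ->
    enorm (X 1 - (euler F b n.+1%:R^-1 x n.+1 + b 1)) <= e.
Proof.
move=> [cX hX] XG L0 hL e e0.
(* Capping the final error at 1 keeps the scheme in the unit tube around [X], where [L] is valid. *)
pose m := Num.min e 1.
have m0 : 0 < m by rewrite lt_min e0 ltr01.
pose eta := m / expR L.
have eta0 : 0 < eta by rewrite divr_gt0 ?expR_gt0.
pose eta1 := eta / (d%:R + 1).
have d1 : 0 < d%:R + 1 :> R by rewrite ltr_wpDl.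
have eta10 : 0 < eta1 by rewrite divr_gt0.
have [del del0 hdel] : exists2 del : R, 0 < del & forall i (s t : R),
    0 <= s <= 1 -> `|s - t| < del -> `|F (X s) i 0 - F (X t) i 0| < eta1.
  have h i : exists del : R, 0 < del /\ forall s t : R, 0 <= s <= 1 ->
      `|s - t| < del -> `|F (X s) i 0 - F (X t) i 0| < eta1.
    by have [del d0 hd] := unit_itv_unif_continuous (cX i) eta10; exists del.
  have /choice[f hf] := h.
  exists (\big[Num.min/1]_i f i).
    elim/big_ind : _ => // [a c a0 c0|i _]; first by rewrite lt_min a0.
    by have [] := hf i.
  move=> i s t s01 st; have [_] := hf i; apply => //.
  by apply: lt_le_trans st _; exact: bigmin_le_cond.
exists (Num.truncn del^-1) => n hn.
pose h : R := n.+1%:R^-1.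
have h0 : 0 < h by rewrite invr_gt0.
have hd : h < del.
  rewrite /h -[ltRHS]invrK ltf_pV2 ?posrE ?invr_gt0//.
  by apply: lt_le_trans (truncnS_gt _) _; rewrite ler_nat.
pose V t := X t - b t.
(* Consistency error of one step: in each coordinate the mean value theorem turns the increment of X
   - b into h times the drift at an intermediate time, which is uniformly close to the drift at the
   left end. *)
have step (k : nat) : (k < n.+1)%N ->
    enorm (V (k.+1%:R * h) - V (k%:R * h) - h *: F (X (k%:R * h))) <= h * eta.
  move=> kn.
  have b1 : 0 <= k%:R * h by rewrite mulr_ge0// ltW.
  have b2 : k.+1%:R * h = k%:R * h + h by rewrite -natr1 mulrDl mul1r.
  have b3 : k.+1%:R * h <= 1 by rewrite ler_pdivrMr// mul1r ler_nat.
  have co i : `|(V (k.+1%:R * h) - V (k%:R * h) - h *: F (X (k%:R * h))) i 0| <=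
      h * eta1.
    have [A [dA EA]] := antiderivative (cX i).
    have -> : (V (k.+1%:R * h) - V (k%:R * h) - h *: F (X (k%:R * h))) i 0 =
       A (k.+1%:R * h) - A (k%:R * h) - h * F (X (k%:R * h)) i 0.
      rewrite [in LHS]mxE [X in X + _]mxE [X in _ + X + _]mxE.
      rewrite !hX; [|apply/andP; split; lra|apply/andP; split; lra].
      by rewrite !EA; [rewrite !mxE; ring|lra|lra].
    have [|||c] := @MVT_segment R A (fun s => F (X s) i 0) (k%:R * h) (k.+1%:R * h).
    - by rewrite b2 lerDl ltW.
    - by move=> s; rewrite in_itv/= => /andP[s1 _]; apply: dA; lra.
    - apply: derivable_within_continuous => s; rewrite in_itv/= => /andP[s1 _].
      by have [] := dA s (lt_le_trans (lt_le_trans (ltrN10 R) b1) s1).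
    rewrite in_itv/= => /andP[c1 c2] ->.
    have -> : k.+1%:R * h - k%:R * h = h by rewrite b2 addrAC subrr add0r.
    rewrite [X in _ - X]mulrC -mulrBl normrM mulrC gtr0_norm// ler_wpM2l ?(ltW h0)//.
    apply/ltW/hdel; first by apply/andP; split; lra.
    by rewrite ger0_norm; lra.
  apply: le_trans (enorm_le_sum _) _.
  apply: (@le_trans _ _ (\sum_(i < d) h * eta1)); first by apply: ler_sum.
  rewrite sumr_const card_ord -mulr_natl mulrCA ler_wpM2l ?(ltW h0)//.
  by rewrite /eta1 mulrCA ler_piMr ?(ltW eta0)// ler_pdivrMr// mul1r lerDl.
(* Discrete Gronwall: each step multiplies the error by at most 1 + h L <= exp(L h) and adds h
   eta. *)
have main (k : nat) : (k <= n.+1)%N ->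
    enorm (V (k%:R * h) - euler F b h x k) <= expR (L * (k%:R * h)) * (k%:R * h * eta).
  elim: k => [_|k IHk kn].
    rewrite /= !mul0r mulr0.
    suff -> : V 0 = x by rewrite subrr enorm0.
    apply/matrixP => i j; rewrite ord1 hX ?lexx ?ler01// set_itv1.
    by rewrite Rintegral_set1 addr0.
  have {}IHk := IHk (ltnW kn).
  have b1 : 0 <= k%:R * h by rewrite mulr_ge0// ltW.
  have b2 : k.+1%:R * h = k%:R * h + h by rewrite -natr1 mulrDl mul1r.
  have b3 : k.+1%:R * h <= 1 by rewrite ler_pdivrMr// mul1r ler_nat.
  have k01 : 0 <= k%:R * h <= 1 by apply/andP; split; lra.
  set dl := euler F b h x k - V (k%:R * h).
  have hdl : enorm dl <= expR (L * (k%:R * h)) * (k%:R * h * eta).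
    by rewrite /dl enormB.
  have dl1 : enorm dl <= 1.
    apply: le_trans hdl _; apply: (@le_trans _ _ (expR L * eta)).
      apply: ler_pM.
      - exact: expR_ge0.
      - by rewrite mulr_ge0//; exact: ltW.
      - by rewrite ler_expR ler_piMr//; lra.
      - by rewrite ler_piMl//; [exact: ltW|lra].
    by rewrite /eta mulrC mulfVK ?gt_eqF ?expR_gt0// /m ge_min lexx orbT.
  have yE : euler F b h x k + b (k%:R * h) = X (k%:R * h) + dl.
    by apply/matrixP => i j; rewrite /dl /V !mxE; ring.
  rewrite [euler _ _ _ _ _]/= yE.
  have -> : V (k.+1%:R * h) - (euler F b h x k + h *: F (X (k%:R * h) + dl)) =
     (V (k.+1%:R * h) - V (k%:R * h) - h *: F (X (k%:R * h))) +
     ((- dl) - h *: (F (X (k%:R * h) + dl) - F (X (k%:R * h)))).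
    by apply/matrixP => i j; rewrite /dl /V !mxE; ring.
  apply: le_trans (ler_enormD _ _) _.
  have s1 := step k kn.
  have s2 := hL _ dl (XG _ k01) dl1.
  have s3 : enorm (- dl - h *: (F (X (k%:R * h) + dl) - F (X (k%:R * h)))) <=
      (1 + h * L) * enorm dl.
    apply: le_trans (ler_enormD _ _) _; rewrite !enormN enormZ (gtr0_norm h0).
    by rewrite mulrDl mul1r lerD2l -mulrA ler_wpM2l// ltW.
  have s4 : 1 + h * L <= expR (L * h) by rewrite mulrC expR_ge1Dx.
  have s5 : (1 + h * L) * enorm dl <=
     expR (L * h) * (expR (L * (k%:R * h)) * (k%:R * h * eta)).
    apply: ler_pM => //; first by rewrite addr_ge0//; apply: mulr_ge0 => //; exact: ltW.
    exact: enorm_ge0.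
  rewrite b2 mulrDr expRD.
  have E1 : 1 <= expR (L * (k%:R * h)) by rewrite -[leLHS](@expR0 R) ler_expR; apply: mulr_ge0.
  have E2 : 1 <= expR (L * h) by rewrite -[leLHS](@expR0 R) ler_expR; apply: mulr_ge0 => //; exact: ltW.
  have s6 : h * eta <= expR (L * (k%:R * h)) * expR (L * h) * (h * eta).
    rewrite ler_peMl// ?mulr_ege1//; apply: mulr_ge0; exact: ltW.
  rewrite b2 in s1; apply: le_trans (lerD s1 (le_trans s3 s5)) _.
  apply: le_trans (lerD s6 (lexx _)) _.
  by rewrite le_eqVlt; apply/orP; left; apply/eqP; ring.
have := main n.+1 (leqnn _).
have -> : n.+1%:R * h = 1 by rewrite /h mulfV.
rewrite mulr1 mul1r => m1.
have -> : X 1 - (euler F b h x n.+1 + b 1) = V 1 - euler F b h x n.+1.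
  by rewrite /V opprD addrA addrAC.
apply: le_trans m1 _.
by rewrite /eta mulrC mulfVK ?gt_eqF ?expR_gt0// /m ge_min lexx.
Qed.

(** * Temperedness along orbits *)

Lemma sum_nat_shift (F : nat -> nat) k n :
  (\sum_(k <= i < k + n) F i = \sum_(i < n) F (i + k))%N.
Proof. by rewrite -{1}(add0n k) (addnC k n) big_addn addnK big_mkord. Qed.

Lemma sum_bool_le (b : nat -> bool) k N : (\sum_(k <= i < k + N) b i <= N)%N.
Proof.
rewrite -[leqRHS](addKn k) -[leqRHS]muln1 -sum_nat_const_nat.
by apply: leq_sum => i _; case: (b i).
Qed.

(* Greedy covering: a point [k] with [b k] starts a window of length at most
   [L] in which [a] has frequency at least [1 / q]. *)
Lemma window_count (a b : nat -> bool) (q L : nat) :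
  (forall k, b k -> exists n, [/\ (0 < n)%N, (n <= L)%N &
     (n <= q * \sum_(k <= i < k + n) a i)%N]) ->
  forall N k, (\sum_(k <= i < k + N) b i <= q * \sum_(k <= i < k + N + L) a i)%N.
Proof.
move=> hb N; elim/ltn_ind: N => N IHN k.
case: N IHN => [_|N IHN]; first by rewrite addn0 big_geq.
have [bk|bk] := boolP (b k); last first.
  rewrite big_ltn ?addnS ?ltnS ?leq_addr// (negbTE bk) add0n.
  have := IHN N (leqnn _) k.+1; rewrite addSn => /leq_trans; apply.
  rewrite leq_mul2l; apply/orP; right.
  by rewrite addSn [leqRHS]big_ltn ?leq_addl// ltnS -addnA leq_addr.
have [n [n0 nL hn]] := hb k bk.
(* A window that overshoots the remaining range is paid for by the extra [L] terms on the right. *)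
have [Nn|nN] := leqP N.+1 n.
  apply: (leq_trans (sum_bool_le _ _ _)); apply: leq_trans Nn _.
  apply: leq_trans hn _; rewrite leq_mul2l; apply/orP; right.
  rewrite [leqRHS](big_cat_nat (n := k + n))/= ?leq_addr//.
    by rewrite -addnA leq_add2l (leq_trans nL)// leq_addl.
rewrite (big_cat_nat (n := k + n))/= ?leq_addr// ?leq_add2l ?(ltnW nN)//.
rewrite [X in (_ <= q * X)%N](big_cat_nat (n := k + n))/= ?leq_addr//; last first.
  by rewrite -addnA leq_add2l (leq_trans nL)// leq_addl.
rewrite mulnDr; apply: leq_add; first exact: leq_trans (sum_bool_le _ _ _) hn.
have := IHN (N.+1 - n)%N _ (k + n)%N; rewrite -addnA subnKC ?(ltnW nN)//.
apply; lia.
Qed.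

Lemma measurable_iter d (T : measurableType d) (f : T -> T) n :
  measurable_fun setT f -> measurable_fun setT (iter n f).
Proof.
move=> mf; elim: n => [|n IHn]; first exact: measurable_id.
exact: measurableT_comp.
Qed.

Lemma measure_preim_iter d (T : measurableType d) (R : realType)
    (m : {measure set T -> \bar R}) (f : T -> T) n (A : set T) :
  measurable_fun setT f ->
  (forall A, measurable A -> m (f @^-1` A) = m A) ->
  measurable A -> m (iter n f @^-1` A) = m A.
Proof.
move=> mf fm mA; elim: n => [//|n IHn].
rewrite -[RHS]IHn -[RHS]fm; last first.
  by have := measurable_iter n mf measurableT mA; rewrite setTI.
by congr (m _); apply/seteqP; split => z /=; rewrite -iterSr.
Qed.

Lemma integral_visits d (T : measurableType d) (R : realType)
    (m : {measure set T -> \bar R}) (f : T -> T) (A : set T) (c : R) (N : nat) :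
  measurable_fun setT f -> m setT = 1%E ->
  (forall A, measurable A -> m (f @^-1` A) = m A) ->
  measurable A -> 0 <= c ->
  (\int[m]_z (c * \sum_(k < N) \1_A (iter k f z))%:E =
    (c * (N%:R * fine (m A)))%:E)%E.
Proof.
move=> mf m1 fm mA c0.
have fA : (m A < +oo)%E.
  by rewrite (le_lt_trans (y := 1%E)) ?ltry// -m1 le_measure ?inE.
have mi k : measurable_fun setT (fun z => (\1_A (iter k f z) : R)).
  by apply: measurableT_comp (measurable_iter k mf); exact: measurable_indic.
transitivity (c%:E * \int[m]_z (\sum_(k < N) (\1_A (iter k f z))%:E))%E.
  rewrite -ge0_integralZl//.
  - by apply: eq_integral => z _; rewrite EFinM sumEFin.
  - apply: emeasurable_sum => k; exact/measurable_EFinP/mi.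
  - by move=> z _; apply: sume_ge0 => k _; rewrite lee_fin.
rewrite ge0_integral_sum//; last by move=> k; exact/measurable_EFinP/mi.
have E k : (\int[m]_z (\1_A (iter k f z))%:E = (fine (m A))%:E)%E.
  rewrite fineK; last by rewrite ge0_fin_numE.
  rewrite -(measure_preim_iter k mf fm mA).
  rewrite -[X in _ = m X]setIT -integral_indic//.
  by have := measurable_iter k mf measurableT mA; rewrite setTI.
under eq_bigr do rewrite E.
by rewrite sumEFin sumr_const card_ord -EFinM mulr_natl.
Qed.

(** For windows of length at most L, [window_count] along an orbit is integrated against the
    invariant measure, which gives N m(BL) <= q (N + L) m(E). Letting N and then L tend to infinity
    proves the bound. *)
Lemma maximal_ergodic d (T : measurableType d) (R : realType)
    (m : {measure set T -> \bar R}) (f : T -> T) (E : set T) (q : nat) :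
  measurable_fun setT f -> m setT = 1%E ->
  (forall A, measurable A -> m (f @^-1` A) = m A) ->
  measurable E ->
  let B := [set z | exists n, (0 < n)%N /\
     (n%:R <= q%:R * \sum_(k < n) \1_E (iter k f z) :> R)] in
  measurable B /\ (m B <= q%:R%:E * m E)%E.
Proof.
move=> mf m1 fm mE B.
pose C n := [set z | (0 < n)%N /\
   (n%:R <= q%:R * \sum_(k < n) \1_E (iter k f z) :> R)].
pose BL L := \bigcup_(n < L.+1) C n.
have mC n : measurable (C n).
  rewrite /C; case: n => [|n]; first by rewrite (_ : mkset _ = set0)//; apply/seteqP; split => z // [].
  have mg : measurable_fun setT (fun z => q%:R * \sum_(k < n.+1) (\1_E (iter k f z) : R)).
    apply: measurable_funM => //; apply: measurable_sum => k.
    by apply: measurableT_comp (measurable_iter k mf); exact: measurable_indic.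
  have := mg measurableT `[n.+1%:R, +oo[%classic (measurable_itv _).
  rewrite setTI; congr (measurable _); apply/seteqP; split => z /=.
    by rewrite in_itv/= andbT.
  by rewrite in_itv/= andbT => -[].
have mBL L : measurable (BL L) by apply: bigcup_measurable.
have fin A : measurable A -> m A \is a fin_num.
  move=> mA; rewrite ge0_fin_numE// (le_lt_trans (y := 1%E)) ?ltry//.
  by rewrite -m1 le_measure ?inE.
have bound L : (m (BL L) <= q%:R%:E * m E)%E.
  rewrite -(fineK (fin _ (mBL L))) -(fineK (fin _ mE)) -EFinM lee_fin.
  set be := fine _; set al := fine _.
  have al0 : 0 <= al by rewrite fine_ge0.
  have key (N : nat) : N%:R * be <= q%:R * ((N + L)%:R * al).
    have := @integral_visits _ _ _ m f (BL L) 1 N mf m1 fm (mBL L) ler01.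
    have := @integral_visits _ _ _ m f E q%:R (N + L) mf m1 fm mE (ler0n _ _).
    rewrite mul1r -!lee_fin => <- <-.
    apply: ge0_le_integral => //.
    - by move=> z _; rewrite lee_fin mul1r sumr_ge0.
    - apply/measurable_EFinP; apply: measurable_funM => //.
      apply: measurable_sum => k.
      by apply: measurableT_comp (measurable_iter k mf); exact: measurable_indic.
    - apply/measurable_EFinP; apply: measurable_funM => //.
      apply: measurable_sum => k.
      by apply: measurableT_comp (measurable_iter k mf); exact: measurable_indic.
    move=> z _; rewrite lee_fin mul1r.
    pose a i := iter i f z \in E; pose b i := iter i f z \in BL L.
    have := @window_count a b q L _ N 0%N; rewrite !add0n !big_mkord => h.
    have -> : \sum_(k < N) \1_(BL L) (iter k f z) = (\sum_(i < N) b i)%:R :> R.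
      by rewrite natr_sum; apply: eq_bigr => i _; rewrite indicE.
    have -> : \sum_(k < N + L) \1_E (iter k f z) = (\sum_(i < N + L) a i)%:R :> R.
      by rewrite natr_sum; apply: eq_bigr => i _; rewrite indicE.
    rewrite -natrM ler_nat; apply: h => k.
    rewrite /b inE => -[n /= nL [n0]].
    have -> : \sum_(i < n) \1_E (iter i f (iter k f z)) =
        (\sum_(k <= i < k + n) a i)%:R :> R.
      rewrite sum_nat_shift natr_sum.
      by apply: eq_bigr => i _; rewrite indicE /a iterD.
    by rewrite -natrM ler_nat => h; exists n.
  rewrite leNgt; apply/negP => h.
  have d0 : 0 < be - q%:R * al by rewrite subr_gt0.
  (* If m(BL) exceeded q m(E), this N would make N times the gap larger than q L m(E), contradicting
     [key]. *)
  pose N := (Num.truncn (q%:R * (L%:R * al) / (be - q%:R * al))).+1.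
  have := key N; have : q%:R * (L%:R * al) < N%:R * (be - q%:R * al).
    by rewrite -ltr_pdivrMr// truncnS_gt.
  by rewrite natrD; nra.
have BE : B = \bigcup_L BL L.
  apply/seteqP; split => z.
    by move=> [n hn]; exists n => //; exists n => //=.
  by move=> [L _ [n _ hn]]; exists n.
split; first by rewrite BE; exact: bigcup_measurable.
rewrite BE.
have hc := @nondecreasing_cvg_mu _ _ _ m BL mBL (bigcup_measurable (fun k _ => mBL k)).
have {}hc := hc (_ : {homo BL : n m / (n <= m)%N >-> (n <= m)%O}).
rewrite -(cvg_lim _ (hc _))//; last first.
  move=> n1 n2 n12; apply/subsetPset => z [k /= kn hk]; exists k => //=.
  by rewrite (leq_trans kn).
apply: lime_le.
  apply/cvg_ex; exists (m (\bigcup_n BL n)); apply: hc.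
  move=> n1 n2 n12; apply/subsetPset => z [k /= kn hk]; exists k => //=.
  by rewrite (leq_trans kn).
by near=> n => /=.
Unshelve. all: by end_near. Qed.

(* One-sided control of the levels along an orbit makes a high level persist for
   a number of steps proportional to its height, which the maximal inequality
   forbids. *)
Lemma never_tempered_null d (T : measurableType d) (R : realType)
    (m : {measure set T -> \bar R}) (f : T -> T) (U : nat -> set T) (p : nat) :
  measurable_fun setT f -> m setT = 1%E ->
  (forall A, measurable A -> m (f @^-1` A) = m A) ->
  (forall M, measurable (U M)) -> (forall M, U M.+1 `<=` U M) ->
  m (\bigcap_M U M) = 0%E -> (0 < p)%N ->
  (forall M z, U M.+1 z -> U M (f z)) \/ (forall M z, U M.+1 (f z) -> U M z) ->
  measurable (\bigcap_j \bigcup_n (iter n f @^-1` U (j + n %/ p)%N)) /\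
  m (\bigcap_j \bigcup_n (iter n f @^-1` U (j + n %/ p)%N)) = 0%E.
Proof.
move=> mf m1 fm mU dU U0 p0 hU.
pose W j := \bigcup_n (iter n f @^-1` U (j + n %/ p)%N).
have mW j : measurable (W j).
  apply: bigcup_measurable => n _.
  by have := measurable_iter n mf measurableT (mU (j + n %/ p)%N); rewrite setTI.
have decr j k z : U (j + k)%N z -> U j z.
  by elim: k z => [|k IHk] z; [rewrite addn0|rewrite addnS => /dU; exact: IHk].
have Wle j : (m (W j) <= p.+1%:R%:E * m (U j))%E.
  have := @maximal_ergodic _ _ _ m f (U j) p.+1 mf m1 fm (mU j).
  set B := mkset _ => -[mB]; apply: le_trans.
  apply: le_measure; rewrite ?inE//.
  move=> z [n _ /= hn]; set q := (n %/ p)%N in hn.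
  have np : (n.+1 <= p * q.+1)%N.
    have := divn_eq n p; have := ltn_pmod n p0; rewrite -/q mulnS [(p * q)%N]mulnC; lia.
  have qn : (q <= n)%N by exact: leq_div.
  (* A run of q + 1 consecutive times in [U j]: it starts at n when levels drop by at most one per
     forward step, and it ends at n when they drop by at most one per backward step. As n < p (q +
     1), the run ends within (p + 1)(q + 1) steps, whence the frequency 1/(p + 1). *)
  have [s [hs sE]] : exists s, (s + q.+1 <= p.+1 * q.+1)%N /\
      forall i, (i < q.+1)%N -> U j (iter (s + i) f z).
    case: hU => h.
      exists n; split; first by rewrite mulSn; lia.
      have hi i : (i <= q)%N -> U (j + (q - i))%N (iter (n + i) f z).
        elim: i => [|i IHi] iq; first by rewrite subn0 addn0.
        rewrite addnS /=; apply: h; have := IHi (ltnW iq).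
        by congr (U _ _); lia.
      by move=> i; rewrite ltnS => /hi; exact: decr.
    exists (n - q)%N; split; first by rewrite mulSn; lia.
    have hi i : (i <= q)%N -> U (j + (q - i))%N (iter (n - i) f z).
      elim: i => [|i IHi] iq; first by rewrite !subn0.
      apply: h; rewrite -iterS.
      have := IHi (ltnW iq).
      rewrite (_ : (n - i.+1).+1 = (n - i)%N); last by lia.
      by congr (U _ _); lia.
    move=> i; rewrite ltnS => iq; have := hi (q - i)%N (leq_subr _ _).
    rewrite (_ : (n - (q - i))%N = (n - q + i)%N); last by lia.
    exact: decr.
  exists (s + q.+1)%N; split; first by rewrite addnS.
  pose a i := iter i f z \in U j.
  have -> : \sum_(k < s + q.+1) \1_(U j) (iter k f z) =
      (\sum_(i < s + q.+1) a i)%:R :> R.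
    by rewrite natr_sum; apply: eq_bigr => i _; rewrite indicE.
  rewrite -natrM ler_nat (leq_trans hs)// leq_mul2l /=.
  rewrite -(big_mkord xpredT (fun i => a i : nat)) (big_cat_nat (n := s))/= ?leq_addr//.
  apply: leq_trans (leq_addl _ _).
  rewrite sum_nat_shift.
  rewrite (eq_bigr (fun=> 1%N)) ?sum1_card ?card_ord// => i _.
  by rewrite /a addnC mem_set//; exact: sE.
have mI : measurable (\bigcap_j W j) by exact: bigcapT_measurable.
split=> //; apply/eqP; rewrite eq_le measure_ge0 andbT.
have Ile j : (m (\bigcap_j W j) <= p.+1%:R%:E * m (U j))%E.
  apply: le_trans (Wle j); apply: le_measure; rewrite ?inE//.
  by move=> z; apply.
have hc : (m \o U) n @[n --> \oo] --> 0%E.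
  rewrite -U0; apply: nonincreasing_cvg_mu => //.
  - rewrite (le_lt_trans (y := 1%E)) ?ltry// -m1 le_measure ?inE//.
  - exact: bigcapT_measurable.
  - apply/nonincreasing_seqP => n; exact/subsetPset/dU.
have hc2 : (p.+1%:R%:E * (m \o U) n)%E @[n --> \oo] --> (p.+1%:R%:E * 0)%E.
  by apply: cvgeZl.
rewrite mule0 in hc2; rewrite -(cvg_lim _ hc2)//.
apply: lime_ge; first by apply/cvg_ex; exists 0%E.
by near=> n; exact: Ile.
Unshelve. all: by end_near. Qed.

(** * The noise space *)

Definition hweight (R : realType) (H s t : R) : R :=
  Num.sqrt (1 + `|s| + `|t|) * `|s - t| `^ ((1 - H) / 2).

(** Real-valued form of a bound on [hnorm], which avoids suprema in the extended reals and includes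
    the diagonal s = t. *)
Definition hbound (R : realType) (d : nat) (H c : R) (w : R -> 'cV[R]_d) : Prop :=
  forall s t : R, s <= 0 -> t <= 0 -> enorm (w s - w t) <= c * hweight H s t.

Lemma hweight_ge0 (R : realType) (H s t : R) : 0 <= hweight H s t.
Proof. by rewrite mulr_ge0 ?sqrtr_ge0 ?powR_ge0. Qed.

Lemma hweight_gt0 (R : realType) (H s t : R) : s != t -> 0 < hweight H s t.
Proof.
move=> st; rewrite mulr_gt0 ?sqrtr_gt0 ?powR_gt0 ?normr_gt0 ?subr_eq0//.
Qed.

Lemma hweight_ge (R : realType) (H s t : R) :
  `|s - t| `^ ((1 - H) / 2) <= hweight H s t.
Proof.
rewrite ler_peMl ?powR_ge0// -[leLHS]sqrtr1 ler_wsqrtr//.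
by rewrite -addrA lerDl addr_ge0.
Qed.

Lemma hnorm_le (R : realType) (d : nat) (H c : R) (w : R -> 'cV[R]_d) :
  hbound H c w -> (hnorm H w <= c%:E)%E.
Proof.
move=> hw; apply: ge_ereal_sup => _ [[s t] /= [s0 t0 st] <-].
by rewrite lee_fin ler_pdivrMr ?hweight_gt0// hw.
Qed.

Lemma le_hnorm (R : realType) (d : nat) (H c : R) (w : R -> 'cV[R]_d) :
  (hnorm H w <= c%:E)%E -> hbound H c w.
Proof.
move=> hw s t s0 t0; have [<-|st] := eqVneq s t.
  rewrite subrr enorm0 /hweight subrr normr0.
  (* On the diagonal with exponent 0 the weight is positive, because zero to the power zero is one;
     the bound then needs c >= 0, which is read off from a single quotient. *)
  have [e0|e0] := eqVneq ((1 - H) / 2) 0; last by rewrite powR0// !mulr0.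
  rewrite e0 powRr0 mulr1 mulr_ge0 ?sqrtr_ge0//.
  rewrite -lee_fin; apply: le_trans hw; apply: ereal_sup_ge.
  exists ((enorm (w 0 - w (-1)) / hweight H 0 (-1)))%:E; last first.
    by rewrite lee_fin divr_ge0 ?enorm_ge0// hweight_ge0.
  by exists (0, -1) => //=; split=> //; rewrite ?lerN10// eq_sym oppr_eq0 oner_eq0.
rewrite -ler_pdivrMr ?hweight_gt0// -lee_fin.
by apply: le_trans hw; apply: ereal_sup_ubound; exists (s, t).
Qed.

Lemma hnorm_ge0 (R : realType) (d : nat) (H : R) (w : R -> 'cV[R]_d) :
  (0 <= hnorm H w)%E.
Proof.
apply: ereal_sup_ge.
exists ((enorm (w 0 - w (-1)) / hweight H 0 (-1)))%:E; last first.
  by rewrite lee_fin divr_ge0 ?enorm_ge0// hweight_ge0.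
by exists (0, -1) => //=; split=> //; rewrite ?lerN10// eq_sym oppr_eq0 oner_eq0.
Qed.

Lemma hnorm_lt (R : realType) (d : nat) (H e : R) (w : R -> 'cV[R]_d) :
  (hnorm H w < e%:E)%E -> exists2 c : R, 0 <= c < e & hbound H c w.
Proof.
have := hnorm_ge0 H w; case E : (hnorm H w) => [c| |] //.
rewrite lee_fin lte_fin => c0 ce; exists c; first by rewrite c0.
by apply: le_hnorm; rewrite E.
Qed.

Lemma lt_hnorm (R : realType) (d : nat) (H c e : R) (w : R -> 'cV[R]_d) :
  c < e -> hbound H c w -> (hnorm H w < e%:E)%E.
Proof. by move=> ce /hnorm_le h; apply: le_lt_trans h _; rewrite lte_fin. Qed.

Lemma eq_hbound (R : realType) (d : nat) (H c : R) (v w : R -> 'cV[R]_d) :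
  (forall t, t <= 0 -> v t = w t) -> hbound H c v -> hbound H c w.
Proof. by move=> vw hv s t s0 t0; rewrite -!vw// hv. Qed.

Lemma hboundD (R : realType) (d : nat) (H a b : R) (v w : R -> 'cV[R]_d) :
  hbound H a v -> hbound H b w -> hbound H (a + b) (v \+ w).
Proof.
move=> hv hw s t s0 t0 /=; rewrite opprD addrACA mulrDl.
by rewrite (le_trans (ler_enormD _ _))// lerD// ?hv ?hw.
Qed.

Lemma hboundZ (R : realType) (d : nat) (H a b : R) (v : R -> 'cV[R]_d) :
  hbound H a v -> hbound H (`|b| * a) (fun t => b *: v t).
Proof.
move=> hv s t s0 t0 /=; rewrite -scalerBr enormZ -mulrA ler_wpM2l//.
exact: hv.
Qed.

Lemma hboundB (R : realType) (d : nat) (H a b : R) (v w : R -> 'cV[R]_d) :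
  hbound H a v -> hbound H b w -> hbound H (a + b) (v \- w).
Proof.
move=> hv hw; have := hboundD hv (hboundZ (-1) hw).
rewrite normrN1 mul1r; apply: eq_hbound => t _ /=; by rewrite scaleN1r.
Qed.

Lemma hboundW (R : realType) (d : nat) (H a b : R) (v : R -> 'cV[R]_d) :
  a <= b -> hbound H a v -> hbound H b v.
Proof.
move=> ab hv s t s0 t0; apply: le_trans (hv s t s0 t0) _.
by rewrite ler_wpM2r// hweight_ge0.
Qed.

(** Interpolation: write an increment x as the product of its powers th and 1 - th with th = (1 -
    H)/2, and bound one factor by the Lipschitz constant and the other by the sup norm. Smallness of
    either constant, with the other bounded, makes the noise norm small. *)
Lemma hbound_lip (R : realType) (d : nat) (H L e : R) (w : R -> 'cV[R]_d) :
  0 < H < 1 -> 0 <= L -> 0 <= e ->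
  (forall s t : R, s <= 0 -> t <= 0 -> enorm (w s - w t) <= L * `|s - t|) ->
  (forall t : R, t <= 0 -> enorm (w t) <= e) ->
  hbound H (L `^ ((1 - H) / 2) * (2 * e) `^ (1 - (1 - H) / 2)) w.
Proof.
move=> /andP[H0 H1] L0 e0 wL we s t s0 t0.
set th := (1 - H) / 2; have th0 : 0 < th by rewrite /th; lra.
have th1 : 0 < 1 - th by rewrite /th; lra.
set x := enorm (w s - w t); have x0 : 0 <= x by exact: enorm_ge0.
have -> : x = x `^ th * x `^ (1 - th).
  have E1 : th + (1 - th) = 1 by rewrite addrC subrK.
  by rewrite -powRD E1 ?powRr1// oner_eq0.
have h1 : x `^ th <= L `^ th * `|s - t| `^ th.
  rewrite -powRM//; apply: ge0_ler_powR.
  - exact: ltW.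
  - by rewrite nnegrE.
  - by rewrite nnegrE mulr_ge0.
  - exact: wL.
have h2 : x `^ (1 - th) <= (2 * e) `^ (1 - th).
  apply: ge0_ler_powR; rewrite ?nnegrE ?mulr_ge0//; first exact: ltW.
  apply: le_trans (ler_enormD _ _) _; rewrite enormN.
  by have := we s s0; have := we t t0; lra.
apply: le_trans (ler_pM (powR_ge0 _ _) (powR_ge0 _ _) h1 h2) _.
rewrite mulrAC; apply: ler_wpM2l; first by rewrite mulr_ge0 ?powR_ge0.
exact: hweight_ge.
Qed.

(** * Smooth compactly supported paths and shifts of the noise *)

Definition smooth (R : realType) (h : R -> R) : Prop :=
  forall n (t : R), derivable (derive1n n h) t 1.

Lemma smoothB (R : realType) (f g : R -> R) :
  smooth f -> smooth g -> smooth (fun t => f t - g t).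
Proof.
move=> sf sg.
have E n : derive1n n (fun t => f t - g t) = (fun t => derive1n n f t - derive1n n g t).
  elim: n => [|n IHn]; first by rewrite !derive1n0.
  rewrite !derive1nS IHn; apply/funext => t; rewrite !derive1E.
  by rewrite deriveB.
by move=> n t; rewrite E; apply: derivableB.
Qed.

Lemma smooth_affine (R : realType) (f : R -> R) (a b : R) :
  smooth f -> smooth (fun t => f (a * t + b)).
Proof.
move=> sf.
have da (t : R) : is_derive t 1 (fun t : R => a * t + b) a.
  have -> : (fun t : R => a * t + b) = (a *: id) + cst b.
    by apply/funext => r; rewrite fctE.
  by apply: is_derive_eq; rewrite addr0 /GRing.scale/= mulr1.
have dc n (t : R) : is_derive t 1 (fun t : R => derive1n n f (a * t + b))
    (a * derive1n n.+1 f (a * t + b)).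
  have h1 : is_derive (a * t + b) 1 (derive1n n f) (derive1n n.+1 f (a * t + b)).
    by split; [exact: sf|rewrite derive1nS derive1E].
  have := @is_derive1_comp _ _ (fun t : R => a * t + b) t _ _ h1 (da t).
  by rewrite mulrC.
have E n : derive1n n (fun t => f (a * t + b)) =
    (fun t => a ^+ n * derive1n n f (a * t + b)).
  elim: n => [|n IHn].
    by rewrite !derive1n0; apply/funext => t; rewrite expr0 mul1r.
  rewrite derive1nS IHn; apply/funext => t; rewrite derive1E.
  have h := dc n t.
  have -> : (fun t : R => a ^+ n * derive1n n f (a * t + b)) =
    a ^+ n *: (fun t : R => derive1n n f (a * t + b)) by [].
  rewrite deriveZ; last by case: h.
  by rewrite derive_val /GRing.scale/= exprSr mulrA.
move=> n t; rewrite E.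
have -> : (fun t : R => a ^+ n * derive1n n f (a * t + b)) =
    a ^+ n *: (fun t : R => derive1n n f (a * t + b)) by [].
by apply: derivableZ; case: (dc n t).
Qed.

(** The path frozen at 0 may have a kink there, so the mean value theorem is applied to its smooth
    extension [g] on [A, 0]; outside this interval [f] vanishes. *)
Lemma C0infty_lip (R : realType) (d : nat) (f : R -> 'cV[R]_d) : C0infty f ->
  exists L : R, 0 <= L /\ forall s t : R, enorm (f s - f t) <= L * `|s - t|.
Proof.
move=> [f0 [g sg fg] [M fM]].
pose A : R := Num.min M (-1).
have A0 : A <= -1 by rewrite ge_min lexx orbT.
have fA t : t <= A -> f t = 0.
  by move=> tA; apply: fM; apply: le_trans tA _; rewrite ge_min lexx.
have h i : exists L : R, 0 <= L /\ forall t : R, A <= t <= 0 ->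
    `|derive1 (fun u => g u i 0) t| <= L.
  pose h := fun t : R => `|derive1 (fun u => g u i 0) t|.
  have ch : {within `[A, 0], continuous h}.
    apply: continuous_subspaceT => t; apply: continuous_comp; last exact: norm_continuous.
    apply: differentiable_continuous; apply/derivable1_diffP.
    by have := sg i 1%N t; rewrite derive1n1.
  have [c _ hc] := EVT_max (le_trans A0 (lerN10 R)) ch.
  exists (h c); split; first exact: normr_ge0.
  by move=> t tA; apply: hc; rewrite in_itv.
have /choice[L hL] := h.
have L0 : 0 <= \sum_i L i by apply: sumr_ge0 => i _; have [] := hL i.
exists (\sum_i L i); split=> // s t.
wlog st : s t / s <= t.
  move=> hw; have [st|/ltW st] := leP s t; first exact: hw.
  by rewrite enormB distrC; exact: hw.
have mid (a b : R) : A <= a -> a <= b -> b <= 0 ->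
    enorm (f a - f b) <= (\sum_i L i) * `|a - b|.
  move=> Aa ab b0; apply: le_trans (enorm_le_sum _) _.
  rewrite mulr_suml; apply: ler_sum => i _.
  rewrite !mxE (fg a (le_trans ab b0)) (fg b b0).
  have [|||c] := @MVT_segment R (fun u => g u i 0) (derive1 (fun u => g u i 0)) a b.
  - by [].
  - move=> x _; split; last by rewrite derive1E.
    by have := sg i 0%N x; rewrite derive1n0.
  - apply: derivable_within_continuous => x _.
    by have := sg i 0%N x; rewrite derive1n0.
  rewrite in_itv/= => /andP[c1 c2] E.
  rewrite distrC E normrM (distrC b) ler_wpM2r//.
  by have [_] := hL i; apply; rewrite (le_trans Aa c1) (le_trans c2 b0).
have [t0|t0] := leP t 0; last first.
  rewrite (f0 t (ltW t0)) subr0.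
  have [s0|s0] := leP s 0; last by rewrite f0 ?(ltW s0)// enorm0 mulr_ge0.
  have : enorm (f s) <= (\sum_i L i) * `|s - 0|.
    have [As|/ltW sA] := leP A s; last by rewrite fA// enorm0 mulr_ge0.
    by have := mid s 0 As s0 (lexx 0); rewrite (f0 0)// subr0.
  move=> /le_trans; apply; rewrite ler_wpM2l// subr0 !ler0_norm//; lra.
have [As|/ltW sA] := leP A s; first exact: mid.
rewrite (fA s sA) sub0r enormN.
have [tA|/ltW At] := leP t A; first by rewrite fA// enorm0 mulr_ge0.
have := mid A t (lexx _) At t0; rewrite fA// sub0r enormN => /le_trans; apply.
by rewrite ler_wpM2l// !ler0_norm; lra.
Qed.

Lemma C0infty_bounded (R : realType) (d : nat) (f : R -> 'cV[R]_d) : C0infty f ->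
  exists e : R, 0 <= e /\ forall t : R, enorm (f t) <= e.
Proof.
move=> cf; have [L [L0 hL]] := C0infty_lip cf.
have [f0 _ [M fM]] := cf.
exists (L * `|M|); split; first by rewrite mulr_ge0.
move=> t; have [t0|t0] := leP 0 t; first by rewrite f0// enorm0 mulr_ge0.
have [tM|Mt] := leP t M; first by rewrite fM// enorm0 mulr_ge0.
have := hL t 0; rewrite (f0 0)// !subr0 => /le_trans; apply.
by rewrite ler_wpM2l// !ler0_norm; lra.
Qed.

Lemma C0infty_hbound (R : realType) (d : nat) (H : R) (f : R -> 'cV[R]_d) :
  0 < H < 1 -> C0infty f -> exists2 c : R, 0 <= c & hbound H c f.
Proof.
move=> H01 cf; have [L [L0 hL]] := C0infty_lip cf.
have [e [e0 he]] := C0infty_bounded cf.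
exists (L `^ ((1 - H) / 2) * (2 * e) `^ (1 - (1 - H) / 2)).
  by rewrite mulr_ge0 ?powR_ge0.
by apply: hbound_lip => // s t _ _; exact: hL.
Qed.

Lemma noise_paths_hbound (R : realType) (d : nat) (H : R) (w : R -> 'cV[R]_d) :
  0 < H < 1 -> noise_paths d H w -> exists2 c : R, 0 <= c & hbound H c w.
Proof.
move=> H01 [_ hw]; have [f cf /hnorm_lt[c /andP[c0 _] hc]] := hw 1 ltr01.
have [b b0 hb] := C0infty_hbound H01 cf.
exists (c + b); first exact: addr_ge0.
by apply: eq_hbound (hboundD hc hb) => t _ /=; rewrite subrK.
Qed.

Lemma powR_small (R : realType) (c th e : R) : 0 <= c -> 0 < th -> 0 < e ->
  exists N : nat, forall n : nat, (N <= n)%N -> c * (n.+1%:R^-1) `^ th < e.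
Proof.
move=> c0 th0 e0; pose a := e / (c + 1).
have c1 : 0 < c + 1 by rewrite ltr_wpDl.
have a0 : 0 < a by rewrite divr_gt0.
have b0 : 0 < a `^ th^-1 by rewrite powR_gt0.
exists (Num.truncn (a `^ th^-1)^-1) => n hn.
have h : n.+1%:R^-1 <= a `^ th^-1.
  rewrite -[leRHS]invrK lef_pV2 ?posrE ?invr_gt0//.
  by apply/ltW; apply: lt_le_trans (truncnS_gt _) _; rewrite ler_nat.
have : (n.+1%:R^-1) `^ th <= (a `^ th^-1) `^ th.
  by apply: ge0_ler_powR; rewrite ?nnegrE ?powR_ge0//; exact: ltW.
rewrite -powRrM mulVf ?gt_eqF// powRr1 ?(ltW a0)// => /(ler_wpM2l c0) h2.
apply: le_lt_trans h2 _; rewrite /a mulrCA gtr_pMr// ltr_pdivrMr// mul1r.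
by rewrite ltrDl.
Qed.

(** [Num.min s 0] makes the result vanish on [0, +oo[, as the encoding of paths requires. *)
Definition shiftp (R : realType) (d : nat) (tau : R) (w : R -> 'cV[R]_d) :
    R -> 'cV[R]_d :=
  fun s => w (Num.min s 0 - tau) - w (- tau).

(** For s, t <= 0 the shift turns 1 + |s| + |t| into 1 + 2 tau + |s| + |t|, which is at most 1 + 2
    tau times the former. *)
Lemma hbound_shift (R : realType) (d : nat) (H tau c : R) (w : R -> 'cV[R]_d) :
  0 <= tau -> 0 <= c -> hbound H c w ->
  hbound H (c * Num.sqrt (1 + 2 * tau)) (shiftp tau w).
Proof.
move=> tau0 c0 hw s t s0 t0; rewrite /shiftp !min_l//.
have -> : w (s - tau) - w (- tau) - (w (t - tau) - w (- tau)) =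
    w (s - tau) - w (t - tau) by rewrite opprB addrA subrK.
apply: le_trans (hw _ _ _ _) _; [lra|lra|].
rewrite -mulrA ler_wpM2l// /hweight.
have -> : s - tau - (t - tau) = s - t by ring.
rewrite mulrA ler_wpM2r ?powR_ge0//.
rewrite -sqrtrM; last by lra.
apply: ler_wsqrtr; rewrite !ler0_norm; [|lra|lra|lra|lra].
nra.
Qed.

(* The shift of a path with compact support ends at a nonzero constant; sending
   it back to zero at a slow rate costs arbitrarily little in the norm. *)
Definition shift_cutoff (R : realType) (d : nat) (tau M : R)
    (f : R -> 'cV[R]_d) : R -> 'cV[R]_d :=
  fun s => f (Num.min s 0 - tau) - f (M^-1 * Num.min s 0 - tau).

Lemma shift_cutoff_C0infty (R : realType) (d : nat) (tau M : R)
    (f : R -> 'cV[R]_d) :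
  0 <= tau -> 1 <= M -> C0infty f -> C0infty (shift_cutoff tau M f).
Proof.
move=> tau0 M1 [f0 [g sg fg] [A fA]].
have M0 : 0 < M by apply: lt_le_trans M1.
have Mi0 : 0 < M^-1 by rewrite invr_gt0.
split.
- by move=> t t0; rewrite /shift_cutoff min_r// mulr0 subrr.
- exists (fun s => g (1 * s + - tau) - g (M^-1 * s + - tau)).
    move=> i.
    have -> : (fun u => (g (1 * u + - tau) - g (M^-1 * u + - tau)) i 0) =
        (fun u => (fun t => g t i 0) (1 * u + - tau) -
                  (fun t => g t i 0) (M^-1 * u + - tau)).
      by apply/funext => u; rewrite !mxE.
    by apply: smoothB; apply: (@smooth_affine _ (fun t => g t i 0)); exact: sg.
  move=> t t0; rewrite /shift_cutoff min_l// mul1r !fg//; last by lra.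
  have : M^-1 * t <= 0 by rewrite pmulr_rle0.
  lra.
- exists (Num.min A (M * A)) => t; rewrite le_min => /andP[tA tMA].
  rewrite /shift_cutoff; have [t0|t0] := leP t 0.
    rewrite !fA ?subrr//; last by lra.
    have : M^-1 * t <= A by rewrite ler_pdivrMl.
    lra.
  by rewrite mulr0 subrr.
Qed.

Lemma shift_cutoff_hbound (R : realType) (d : nat) (H tau : R)
    (f : R -> 'cV[R]_d) : 0 < H < 1 -> 0 <= tau -> C0infty f ->
  exists2 c : R, 0 <= c & forall n : nat,
    hbound H (c * (n.+1%:R^-1) `^ ((1 - H) / 2))
      (shiftp tau f \- shift_cutoff tau n.+1%:R f).
Proof.
move=> H01 tau0 cf.
have [L [L0 hL]] := C0infty_lip cf; have [e [e0 he]] := C0infty_bounded cf.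
exists (L `^ ((1 - H) / 2) * (2 * (2 * e)) `^ (1 - (1 - H) / 2)).
  by rewrite mulr_ge0 ?powR_ge0.
move=> n.
(* The difference is a slowed-down copy of [f]: its Lipschitz constant is divided by n + 1 while its
   sup norm stays bounded, as [hbound_lip] wants. *)
have E s : s <= 0 -> (shiftp tau f \- shift_cutoff tau n.+1%:R f) s =
    f (n.+1%:R^-1 * s - tau) - f (- tau).
  move=> s0; rewrite /= /shiftp /shift_cutoff min_l//.
  by apply/matrixP => i j; rewrite !mxE; ring.
have := @hbound_lip R d H (L * n.+1%:R^-1) (2 * e)
  (shiftp tau f \- shift_cutoff tau n.+1%:R f) H01.
have n0 : 0 <= n.+1%:R^-1 :> R by rewrite invr_ge0.
rewrite !mulr_ge0// => /(_ isT isT).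
rewrite powRM// mulrAC; apply.
- move=> s t s0 t0; rewrite !E// opprB addrA subrK.
  apply: le_trans (hL _ _) _; rewrite -mulrA ler_wpM2l//.
  have -> : n.+1%:R^-1 * s - tau - (n.+1%:R^-1 * t - tau) = n.+1%:R^-1 * (s - t) by ring.
  by rewrite normrM ger0_norm.
- move=> s s0; rewrite E//; apply: le_trans (ler_enormD _ _) _; rewrite enormN.
  by have := he (n.+1%:R^-1 * s - tau); have := he (- tau); lra.
Qed.

(** Half of [e] pays for replacing the path by a smooth one before shifting, the other half for the
    cutoff of the shifted smooth path. *)
Lemma shift_noise_paths (R : realType) (d : nat) (H tau : R) (w : R -> 'cV[R]_d) :
  0 < H < 1 -> 0 <= tau -> noise_paths d H w -> noise_paths d H (shiftp tau w).
Proof.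
move=> H01 tau0 [w0 hw]; split.
  by move=> t t0; rewrite /shiftp min_r// sub0r subrr.
move=> e e0; pose k := Num.sqrt (1 + 2 * tau).
have k0 : 0 < k by rewrite sqrtr_gt0; lra.
have ek : 0 < e / (2 * k) by rewrite divr_gt0// mulr_gt0.
have [f cf /hnorm_lt[c /andP[c0 ce] hc]] := hw _ ek.
have [a a0 ha] := shift_cutoff_hbound H01 tau0 cf.
have th0 : 0 < (1 - H) / 2 by case/andP: H01 => *; lra.
have e20 : 0 < e / 2 by rewrite divr_gt0.
have [N /(_ N (leqnn _)) hN] := powR_small a0 th0 e20.
exists (shift_cutoff tau N.+1%:R f).
  by apply: shift_cutoff_C0infty => //; rewrite ler1n.
have h1 := hbound_shift tau0 c0 hc.
apply: (@lt_hnorm _ _ _ (c * k + a * (N.+1%:R^-1) `^ ((1 - H) / 2))).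
  rewrite [e]splitr; apply: ltrD => //.
  by move: ce; rewrite ltr_pdivlMr ?mulr_gt0//; lra.
apply: eq_hbound (hboundD h1 (ha N)) => t t0 /=; rewrite /shiftp min_l//=.
by apply/matrixP => i j; rewrite !mxE; ring.
Qed.

Definition to_noise (R : realType) (d : nat) (H : R) (w : R -> 'cV[R]_d)
  (hw : noise_paths d H w) : noise d H := exist _ w (mem_set hw).

Lemma noise_pathsP (R : realType) (d : nat) (H : R) (w : noise d H) :
  noise_paths d H (val w).
Proof. exact: set_mem (valP w). Qed.

Lemma noise_ge0 (R : realType) (d : nat) (H : R) (w : noise d H) t :
  0 <= t -> val w t = 0.
Proof. by have [h _] := noise_pathsP w; exact: h. Qed.

Lemma C0infty_noise_paths (R : realType) (d : nat) (H : R) (f : R -> 'cV[R]_d) :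
  C0infty f -> noise_paths d H f.
Proof.
move=> cf; split; first by case: cf.
move=> e e0; exists f => //; apply: (@lt_hnorm _ _ _ 0) => //.
by move=> s t _ _ /=; rewrite !subrr enorm0 mul0r.
Qed.

Definition hn (R : realType) (d : nat) (H : R) (w : noise d H) : R :=
  fine (hnorm H (val w)).

Lemma hn_ge0 (R : realType) (d : nat) (H : R) (w : noise d H) : 0 <= hn w.
Proof. by rewrite fine_ge0// hnorm_ge0. Qed.

Lemma hnE (R : realType) (d : nat) (H : R) (w : noise d H) : 0 < H < 1 ->
  hnorm H (val w) = (hn w)%:E.
Proof.
move=> H01; rewrite fineK// ge0_fin_numE ?hnorm_ge0//.
have [c _ /hnorm_le] := noise_paths_hbound H01 (noise_pathsP w).
by move=> /le_lt_trans; apply; rewrite ltry.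
Qed.

Lemma hn_bound (R : realType) (d : nat) (H : R) (w : noise d H) : 0 < H < 1 ->
  hbound H (hn w) (val w).
Proof. by move=> H01; apply: le_hnorm; rewrite hnE. Qed.

Lemma hn_le (R : realType) (d : nat) (H c : R) (w : noise d H) : 0 < H < 1 ->
  hbound H c (val w) -> hn w <= c.
Proof. by move=> H01 /hnorm_le; rewrite hnE// lee_fin. Qed.

Definition shift_noise (R : realType) (d : nat) (H : R) (H01 : 0 < H < 1)
    (w : noise d H) : noise d H :=
  to_noise (shift_noise_paths H01 ler01 (noise_pathsP w)).

(** * Separability of the noise space and measurability of maps into it *)

Definition lip_class (R : realType) (d : nat) (H : R) (n : nat) (v : noise d H) :=
  (forall t : R, t <= - n%:R -> val v t = 0) /\
  forall s t : R, enorm (val v s - val v t) <= n%:R * `|s - t|.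

(** Values rounded to mesh 1/(m+1) at the points of the grid of the same mesh covering [-n, 0].
    Codes are countable, and paths of one class with equal codes are uniformly close. *)
Definition grid_code (R : realType) (d : nat) (H : R) (n m : nat)
    (v : noise d H) : seq {ffun 'I_d -> int} :=
  [seq [ffun i : 'I_d => Num.floor (m.+1%:R * val v (- (k%:R / m.+1%:R)) i 0)]
    | k <- iota 0 (n * m.+1).+1].

Lemma grid_code_near (R : realType) (d : nat) (H : R) (n m : nat)
    (v w : noise d H) :
  lip_class n v -> lip_class n w -> grid_code n m v = grid_code n m w ->
  forall t, enorm (val v t - val w t) <= d%:R * (2 * n%:R + 1) * m.+1%:R^-1.
Proof.
move=> [v0 vL] [w0 wL] vw t.
have m0 : 0 < m.+1%:R :> R by [].
have r0 : 0 <= d%:R * (2 * n%:R + 1) * m.+1%:R^-1 :> R.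
  by rewrite !mulr_ge0// addr_ge0// mulr_ge0.
have [t0|t0] := leP 0 t; first by rewrite !noise_ge0// subrr enorm0.
have [tn|tn] := leP t (- n%:R); first by rewrite v0// w0// subrr enorm0.
pose k := Num.truncn (- t * m.+1%:R).
have tm0 : 0 <= - t * m.+1%:R by rewrite mulr_ge0// oppr_ge0 ltW.
have /andP[k1 k2] := truncn_itv tm0.
have kn : (k <= n * m.+1)%N.
  rewrite -(ler_nat R) natrM; apply: le_trans k1 _.
  by rewrite ler_wpM2r//; lra.
have tk : `|t - - (k%:R / m.+1%:R)| <= m.+1%:R^-1.
  have q1 : k%:R / m.+1%:R <= - t by rewrite ler_pdivrMr.
  have q2 : - t <= k%:R / m.+1%:R + m.+1%:R^-1.
    by rewrite -[X in _ + X]mul1r -mulrDl natr1 ler_pdivlMr// ltW.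
  rewrite opprK ler0_norm.
    by rewrite opprD lerBlDr addrC.
  by rewrite -lerBrDl sub0r.
have co i : `|(val v (- (k%:R / m.+1%:R)) - val w (- (k%:R / m.+1%:R))) i 0| <= m.+1%:R^-1.
  rewrite !mxE.
  have := congr1 (fun s => nth [ffun=> 0] s k i) vw.
  rewrite /grid_code !(nth_map 0%N) ?size_iota ?ltnS// nth_iota ?ltnS// add0n.
  rewrite !ffunE.
  set a := val v _ i 0; set b := val w _ i 0 => E.
  have /andP[a1 a2] := floor_itv (m.+1%:R * a).
  have /andP[b1 b2] := floor_itv (m.+1%:R * b).
  rewrite E in a1 a2; rewrite intrD in a2 b2.
  have : `|m.+1%:R * (a - b)| <= 1 by rewrite ler_norml; apply/andP; split; lra.
  by rewrite normrM gtr0_norm// -ler_pdivlMl// mulr1.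
have -> : val v t - val w t = (val v t - val v (- (k%:R / m.+1%:R))) +
   ((val v (- (k%:R / m.+1%:R)) - val w (- (k%:R / m.+1%:R))) -
    (val w t - val w (- (k%:R / m.+1%:R)))).
  by apply/matrixP => i j; rewrite !mxE; ring.
apply: le_trans (enorm_le_sum _) _.
have -> : d%:R * (2 * n%:R + 1) / m.+1%:R =
    \sum_(i < d) ((2 * n%:R + 1) / m.+1%:R) :> R.
  by rewrite sumr_const card_ord -mulrA mulr_natl.
apply: ler_sum => i _; rewrite mxE [X in _ + X]mxE.
apply: le_trans (ler_normD _ _) _.
have h1 : `|(val v t - val v (- (k%:R / m.+1%:R))) i 0| <= n%:R * m.+1%:R^-1.
  apply: le_trans (coord_le_enorm _ _) _; apply: le_trans (vL _ _) _.
  by rewrite ler_wpM2l.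
have h2 : `|(val w t - val w (- (k%:R / m.+1%:R))) i 0| <= n%:R * m.+1%:R^-1.
  apply: le_trans (coord_le_enorm _ _) _; apply: le_trans (wL _ _) _.
  by rewrite ler_wpM2l.
have -> : (- (val w t - val w (- (k%:R / m.+1%:R)))) i 0 =
    - (val w t - val w (- (k%:R / m.+1%:R))) i 0 by rewrite mxE.
have -> : (2 * n%:R + 1) / m.+1%:R =
    n%:R * m.+1%:R^-1 + (m.+1%:R^-1 + n%:R * m.+1%:R^-1) :> R by ring.
apply: lerD => //; apply: le_trans (ler_normB _ _) _.
by apply: lerD => //; exact: co.
Qed.

(** Smooth paths are dense and lie in some [lip_class]. For each code one path carrying it is
    chosen; the bounded Lipschitz constant turns uniform closeness into closeness in the noise
    norm. *)
Lemma noise_separable (R : realType) (d : nat) (H : R) : 0 < H < 1 ->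
  exists D : nat -> noise d H, forall (w : noise d H) (e : R), 0 < e ->
    exists n, (hdist w (D n) < e%:E)%E.
Proof.
move=> H01.
pose Q (c : nat * nat * seq {ffun 'I_d -> int}) : set (noise d H) :=
  [set v | lip_class c.1.1 v /\ grid_code c.1.1 c.1.2 v = c.2].
exists (fun j => if unpickle j is Some c then xget point (Q c) else point).
move=> w e e0.
have e20 : 0 < e / 2 by rewrite divr_gt0.
have [_ hw] := noise_pathsP w.
have [f cf /hnorm_lt[c /andP[c0 ce] hc]] := hw _ e20.
pose v := to_noise (C0infty_noise_paths H cf).
have [n vn] : exists n, lip_class n v.
  have [L [L0 hL]] := C0infty_lip cf; have [_ _ [A fA]] := cf.
  exists (maxn (Num.truncn L).+1 (Num.truncn `|A|).+1); split.
    move=> t tn; apply: fA; apply: le_trans tn _.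
    rewrite lerNl; apply: (@le_trans _ _ `|A|); first by rewrite -normrN ler_norm.
    apply: (@le_trans _ _ (Num.truncn `|A|).+1%:R); first exact/ltW/truncnS_gt.
    by rewrite ler_nat leq_maxr.
  move=> s t; apply: le_trans (hL s t) _; rewrite ler_wpM2r//.
  apply: (@le_trans _ _ (Num.truncn L).+1%:R); first exact/ltW/truncnS_gt.
  by rewrite ler_nat leq_maxl.
pose th := (1 - H) / 2.
have th1 : 0 < 1 - th by case/andP: H01 => *; rewrite /th; lra.
(* From [hbound_lip]: the difference of two paths of the class is 2n-Lipschitz and of sup norm at
   most d (2n + 1)/(m + 1). *)
pose a := (2 * n%:R : R) `^ th * (2 * (d%:R * (2 * n%:R + 1))) `^ (1 - th).
have a0 : 0 <= a by rewrite mulr_ge0 ?powR_ge0.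
have [m /(_ m (leqnn _)) hm] := powR_small a0 th1 e20.
exists (pickle (n, m, grid_code n m v)); rewrite pickleK.
have [vn' vc'] : Q (n, m, grid_code n m v) (xget point (Q (n, m, grid_code n m v))).
  by apply: (@xgetPex _ point); exists v.
set v' := xget _ _ in vn' vc' *.
have nn : 0 <= d%:R * (2 * n%:R + 1) :> R by rewrite mulr_ge0// addr_ge0// mulr_ge0.
have hb : hbound H (a * (m.+1%:R^-1) `^ (1 - th)) (val v \- val v').
  rewrite /a -mulrA -powRM ?invr_ge0 ?mulr_ge0// -mulrA.
  apply: hbound_lip => //.
  - move=> s t _ _ /=.
    have -> : val v s - val v' s - (val v t - val v' t) =
       (val v s - val v t) - (val v' s - val v' t).
      by apply/matrixP => i j; rewrite !mxE; ring.
    apply: le_trans (ler_enormD _ _) _; rewrite enormN.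
    have [_ h1] := vn; have [_ h2] := vn'.
    have := h1 s t; have := h2 s t; lra.
  - by move=> t _ /=; exact: (grid_code_near vn vn' (esym vc')).
apply: (@lt_hnorm _ _ _ (c + a * (m.+1%:R^-1) `^ (1 - th))).
  by rewrite [e]splitr; apply: ltrD.
apply: eq_hbound (hboundD hc hb) => t _ /=.
by rewrite addrA subrK.
Qed.

Lemma measurable_gt_fun d (T : measurableType d) (R : realType) (f : T -> R) :
  (forall a, measurable [set z | a < f z]) -> measurable_fun setT f.
Proof.
move=> mf; apply: (measurability _ (RGenOInfty.measurableE R)).
move=> _ [_ [a ->] <-]; rewrite setTI.
have -> : f @^-1` `]a, +oo[%classic = [set z | a < f z].
  by apply/seteqP; split => z /=; rewrite in_itv/= andbT.
exact: mf.
Qed.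

Lemma measurable_gt d (T : measurableType d) (R : realType) (f : T -> R) a :
  measurable_fun setT f -> measurable [set z | a < f z].
Proof.
move=> mf; have := mf measurableT _ (measurable_itv `]a, +oo[).
rewrite setTI; congr (measurable _).
by apply/seteqP; split => z /=; rewrite in_itv/= andbT.
Qed.

Lemma measurable_le d (T : measurableType d) (R : realType) (f : T -> R) a :
  measurable_fun setT f -> measurable [set z | f z <= a].
Proof.
move=> mf; rewrite (_ : mkset _ = ~` [set z | a < f z]).
  by apply: measurableC; exact: measurable_gt.
by apply/seteqP; split => z /=; rewrite leNgt => /negP.
Qed.

Lemma measurable_inner d' (T : measurableType d') (R : realType) (d : nat)
    (f g : T -> 'cV[R]_d) :
  (forall i, measurable_fun setT (fun z => f z i 0)) ->
  (forall i, measurable_fun setT (fun z => g z i 0)) ->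
  measurable_fun setT (fun z => inner (f z) (g z)).
Proof.
by move=> mf mg; apply: measurable_sum => i; exact: measurable_funM.
Qed.

Lemma measurable_enorm d' (T : measurableType d') (R : realType) (d : nat)
    (f : T -> 'cV[R]_d) :
  (forall i, measurable_fun setT (fun z => f z i 0)) ->
  measurable_fun setT (fun z => enorm (f z)).
Proof.
move=> mf; have ms : measurable_fun setT (Num.sqrt : R -> R).
  by apply: continuous_measurable_fun; exact: sqrt_continuous.
exact: measurableT_comp ms (measurable_inner mf mf).
Qed.

Lemma hopen_measurable (R : realType) (d : nat) (H : R) (U : set (noise d H)) :
  hopen d H U -> measurable U.
Proof. exact: sub_gen_smallest. Qed.

Lemma measurable_noise_cont (R : realType) (d : nat) (H : R)
    (g : noise d H -> R) :
  (forall w (e : R), 0 < e -> exists2 del : R, 0 < del &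
     forall v, (hdist v w < del%:E)%E -> `|g v - g w| < e) ->
  measurable_fun setT g.
Proof.
move=> cg; apply: measurable_gt_fun => a; apply: hopen_measurable => w /= aw.
have e0 : 0 < g w - a by rewrite subr_gt0.
have [del del0 h] := cg w _ e0; exists del => // v /h /=.
by rewrite ltr_distlC => /andP[]; lra.
Qed.

Lemma hdist_eval (R : realType) (d : nat) (H e : R) (v w : noise d H) (t : R) :
  (hdist v w < e%:E)%E -> t <= 0 ->
  enorm (val v t - val w t) <= e * hweight H t 0.
Proof.
move=> /hnorm_lt[c /andP[c0 ce] h] t0; have := h t 0 t0 (lexx 0).
rewrite /= (noise_ge0 v (lexx 0)) (noise_ge0 w (lexx 0)) !subr0 => /le_trans; apply.
by rewrite ler_wpM2r ?hweight_ge0// ltW.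
Qed.

Lemma measurable_noise_eval (R : realType) (d : nat) (H : R) (t : R) i :
  measurable_fun setT (fun w : noise d H => val w t i 0).
Proof.
have [t0|t0] := leP 0 t.
  rewrite (_ : (fun _ => _) = cst 0)//.
  by apply/funext => w; rewrite noise_ge0// mxE.
apply: measurable_noise_cont => w e e0.
have k0 : 0 < hweight H t 0 + 1 by rewrite ltr_wpDl// hweight_ge0.
exists (e / (hweight H t 0 + 1)); first by rewrite divr_gt0.
move=> v /hdist_eval/(_ (ltW t0)) h.
have -> : val v t i 0 - val w t i 0 = (val v t - val w t) i 0 by rewrite !mxE.
apply: le_lt_trans (coord_le_enorm _ _) _; apply: le_lt_trans h _.
by rewrite mulrAC ltr_pdivrMr// ltr_pM2l// ltrDl.
Qed.

Lemma measurable_hn (R : realType) (d : nat) (H : R) : 0 < H < 1 ->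
  measurable_fun setT (@hn R d H).
Proof.
move=> H01; apply: measurable_noise_cont => w e e0; exists e => // v.
move=> /hnorm_lt[c /andP[c0 ce] h]; apply: le_lt_trans ce.
rewrite ler_distlC; apply/andP; split.
  rewrite lerBlDr; apply: hn_le => //.
  apply: eq_hbound (hboundD (hn_bound w H01) h) => t _ /=.
  by rewrite addrC subrK.
apply: hn_le => //; apply: eq_hbound (hboundB (hn_bound v H01) h) => t _ /=.
by rewrite opprB addrC subrK.
Qed.

Lemma hbound_continuous (R : realType) (d : nat) (H c : R) (w : R -> 'cV[R]_d)
    (t : R) : 0 < H < 1 -> 0 <= c -> hbound H c w -> t <= 0 ->
  forall e : R, 0 < e -> exists2 del : R, 0 < del &
    forall s, s <= 0 -> `|s - t| <= del -> enorm (w s - w t) < e.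
Proof.
move=> H01 c0 hw t0 e e0.
pose S := Num.sqrt (2 + 2 * `|t|); have S0 : 0 <= S by exact: sqrtr_ge0.
have th0 : 0 < (1 - H) / 2 by case/andP: H01 => *; lra.
have [N /(_ N (leqnn _)) hN] := powR_small (mulr_ge0 c0 S0) th0 e0.
exists N.+1%:R^-1; first by rewrite invr_gt0.
move=> s s0 st; apply: le_lt_trans (hw _ _ s0 t0) _; apply: le_lt_trans _ hN.
rewrite -mulrA ler_wpM2l//; apply: ler_pM.
- exact: sqrtr_ge0.
- exact: powR_ge0.
- apply: ler_wsqrtr.
  have {}st : `|s - t| <= 1 by apply: le_trans st _; rewrite invf_le1// ler1n.
  have := ler_normD (s - t) t; rewrite subrK; lra.
- by apply: ge0_ler_powR; rewrite ?nnegrE ?invr_ge0//; exact: ltW.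
Qed.

Lemma hweight_le (R : realType) (H s t s' t' : R) : 0 < H < 1 ->
  `|s| <= `|s'| -> `|t| <= `|t'| -> `|s - t| <= `|s' - t'| ->
  hweight H s t <= hweight H s' t'.
Proof.
move=> /andP[H0 H1] hs ht hst; apply: ler_pM.
- exact: sqrtr_ge0.
- exact: powR_ge0.
- by apply: ler_wsqrtr; lra.
- by apply: ge0_ler_powR; rewrite ?nnegrE//; lra.
Qed.

(** Reduces a noise ball to countably many conditions. The bound [hC] serves only to make the path
    continuous; its constant does not enter the conclusion. *)
Lemma hbound_rat (R : realType) (d : nat) (H C c : R) (w : R -> 'cV[R]_d) :
  0 < H < 1 -> 0 <= C -> 0 <= c -> w 0 = 0 -> hbound H C w ->
  (forall a b : rat, ratr a <= 0 :> R -> ratr b <= 0 :> R ->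
    enorm (w (ratr a) - w (ratr b)) <= c * hweight H (ratr a) (ratr b)) ->
  hbound H c w.
Proof.
move=> H01 C0 c0 w0 hC hq.
suff main s t : s < t -> t <= 0 -> enorm (w s - w t) <= c * hweight H s t.
  move=> s t s0 t0; have [st|st|<-] := ltgtP s t.
  - exact: main.
  - rewrite enormB; have := main _ _ st s0.
    by rewrite /hweight (distrC s) -!(addrA 1) (addrC `|t|).
  - by rewrite subrr enorm0 mulr_ge0// hweight_ge0.
move=> st t0; apply/ler_addgt0Pr => e e0.
have e20 : 0 < e / 2 by rewrite divr_gt0.
have s0 : s <= 0 by lra.
have [d1 d10 h1] := hbound_continuous H01 C0 hC s0 e20.
have [d2 d20 h2] := hbound_continuous H01 C0 hC t0 e20.
pose de := Num.min (Num.min d1 d2) (t - s).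
have de0 : 0 < de by rewrite !lt_min d10 d20/= subr_gt0.
have ded1 : de <= d1 by rewrite !ge_min lexx.
have ded2 : de <= d2 by rewrite !ge_min lexx orbT.
have dets : de <= t - s by rewrite !ge_min lexx orbT.
(* Both rationals lie to the right of the points they approximate, and [a] is moved at least as far
   as [b]; hence |a| <= |s|, |b| <= |t| and |a - b| <= |s - t|, so the weight does not increase. *)
have [b [bt bt0 btd]] : exists b : rat, [/\ t <= ratr b :> R, ratr b <= 0 :> R &
    ratr b - t <= de / 2].
  move: t0; rewrite le_eqVlt => /predU1P[->|t0].
    exists 0; rewrite rmorph0; split => //; rewrite subrr; lra.
  have : t < Num.min 0 (t + de / 2) by rewrite lt_min t0; lra.
  move=> /rat_in_itvoo[b]; rewrite in_itv/= lt_min => /and3P[b1 b2 b3].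
  exists b; split; lra.
have : s + de / 2 < s + de by lra.
move=> /rat_in_itvoo[a]; rewrite in_itv/= => /andP[a1 a2].
have a0 : ratr a <= 0 :> R by lra.
have -> : w s - w t = (w (ratr a) - w (ratr b)) -
    ((w (ratr a) - w s) - (w (ratr b) - w t)).
  by apply/matrixP => i j; rewrite !mxE; ring.
apply: le_trans (ler_enormD _ _) _; rewrite enormN; apply: lerD.
  apply: le_trans (hq a b a0 bt0) _; rewrite ler_wpM2l// hweight_le//.
  - by rewrite !ler0_norm; lra.
  - by rewrite !ler0_norm; lra.
  - by rewrite !ler0_norm; lra.
apply: le_trans (ler_enormD _ _) _; rewrite enormN [e]splitr; apply: lerD.
  by apply/ltW/h1 => //; rewrite ger0_norm; lra.
by apply/ltW/h2 => //; rewrite ger0_norm; lra.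
Qed.

(** By separability an open set is a countable union of balls, and by [hbound_rat] a ball is
    described by countably many evaluations. This makes the evaluations generate the sigma-algebra
    of open sets. *)
Lemma noise_measurable_fun d' (T : measurableType d') (R : realType) (d : nat)
    (H : R) (f : T -> noise d H) : 0 < H < 1 ->
  (forall (t : R) i, t <= 0 -> measurable_fun setT (fun z => val (f z) t i 0)) ->
  measurable_fun setT f.
Proof.
move=> H01 mf.
have hm : @measurable _ (noise d H) = <<s hopen d H >> by [].
apply: (measurability _ hm).
move=> _ [U hU <-]; rewrite setTI.
have [D hD] := @noise_separable R d H H01.
pose B (q : noise d H) (e : R) : set (noise d H) :=
  [set w | (hdist w q < e%:E)%E].
have mB q e : measurable (f @^-1` B q e).
  (* The margin 1/(k+1) expresses the strict inequality of an open ball as a countable union of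
     non-strict ones. *)
  pose S k (a b : rat) := [set z : T | 0 <= e - k.+1%:R^-1 /\
    (ratr a <= 0 :> R -> ratr b <= 0 :> R ->
     enorm ((val (f z) \- val q) (ratr a) - (val (f z) \- val q) (ratr b)) <=
     (e - k.+1%:R^-1) * hweight H (ratr a) (ratr b))].
  have -> : f @^-1` B q e = \bigcup_k \bigcap_a \bigcap_b S k a b.
    apply/seteqP; split => z /=.
      move=> /hnorm_lt[c /andP[c0 ce] hc].
      have ec0 : 0 < e - c by rewrite subr_gt0.
      pose k := Num.truncn (e - c)^-1; exists k => // a _ b _.
      have hk : k.+1%:R^-1 <= e - c.
        rewrite -[leRHS]invrK lef_pV2 ?posrE ?invr_gt0//.
        exact/ltW/truncnS_gt.
      split; first by rewrite subr_ge0 (le_trans hk)// lerBlDr lerDl.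
      move=> a0 b0; apply: le_trans (hc _ _ a0 b0) _.
      by rewrite ler_wpM2r ?hweight_ge0// lerBrDr addrC -lerBrDr.
    move=> [k _ hk].
    have k0 : 0 <= e - k.+1%:R^-1 by have [] := hk 0 I 0 I.
    have hb := hboundB (hn_bound (f z) H01) (hn_bound q H01).
    apply: (@lt_hnorm _ _ _ (e - k.+1%:R^-1)); first by rewrite ltrBlDr ltrDl invr_gt0.
    apply: (hbound_rat H01 _ k0 _ hb).
    - by rewrite addr_ge0 ?hn_ge0.
    - by rewrite /= !noise_ge0// subr0.
    - by move=> a b a0 b0; have [_] := hk a I b I; exact.
  apply: bigcup_measurable => k _.
  have mrat (F : rat -> set T) : (forall a, measurable (F a)) ->
      measurable (\bigcap_a F a).
    move=> mF; rewrite -[X in measurable X]setCK setC_bigcap.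
    apply: measurableC; apply: bigcupT_measurable_rat => a.
    exact: measurableC.
  apply: (mrat (fun a => \bigcap_b S k a b)) => a; apply: mrat => b.
  rewrite /S; have [k0|k0] := leP 0 (e - k.+1%:R^-1); last first.
    by rewrite (_ : mkset _ = set0)//; apply/seteqP; split => z //= [].
  have [a0|a0] := leP (ratr a : R) 0; last first.
    by rewrite (_ : mkset _ = setT)//; apply/seteqP; split => z //=.
  have [b0|b0] := leP (ratr b : R) 0; last first.
    by rewrite (_ : mkset _ = setT)//; apply/seteqP; split => z //=.
  rewrite (_ : mkset _ = [set z | enorm ((val (f z) \- val q) (ratr a) - (val (f z) \- val q) (ratr b)) <=
     (e - k.+1%:R^-1) * hweight H (ratr a) (ratr b)]); last first.
    by apply/seteqP; split => z /=; [move=> [_ h]; exact: h|move=> h; split].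
  apply: measurable_le; apply: measurable_enorm => i.
  rewrite (_ : (fun z => _) = (fun z => (val (f z) (ratr a) i 0 - val q (ratr a) i 0) -
    (val (f z) (ratr b) i 0 - val q (ratr b) i 0))); last first.
    by apply/funext => z; rewrite !mxE.
  by apply: measurable_funB; apply: measurable_funB => //; exact: mf.
(* Preimages of the balls with dense centres and radii 1/(m+1) that fit inside [U]. *)
pose G (c : nat * nat) : set T :=
  if `[< B (D c.1) c.2.+1%:R^-1 `<=` U >] then f @^-1` B (D c.1) c.2.+1%:R^-1
  else set0.
have -> : f @^-1` U = \bigcup_c G c.
  apply/seteqP; split => z.
    move=> /= Uz; have [e e0 he] := hU _ Uz.
    have e20 : 0 < e / 2 by rewrite divr_gt0.
    pose m := Num.truncn (e / 2)^-1.
    have hm2 : m.+1%:R^-1 <= e / 2.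
      rewrite -[leRHS]invrK lef_pV2 ?posrE ?invr_gt0//.
      exact/ltW/truncnS_gt.
    have m0 : 0 < m.+1%:R^-1 :> R by rewrite invr_gt0.
    have [n hn] := hD (f z) _ m0.
    exists (n, m) => //; rewrite /G/=; case: asboolP => //=; case.
    move=> w hw; apply: he.
    have [c1 /andP[_ c1e] hc1] := hnorm_lt hw.
    have [c2 /andP[_ c2e] hc2] := hnorm_lt hn.
    apply: (@lt_hnorm _ _ _ (c1 + c2)).
      by rewrite [e]splitr; apply: ltrD; exact: lt_le_trans hm2.
    apply: eq_hbound (hboundB hc1 hc2) => t _ /=.
    by rewrite opprB addrA subrK.
  by move=> [c _]; rewrite /G; case: asboolP => // h; exact: h.
apply: countable_bigcupT_measurable; first exact: countableP.
by move=> c; rewrite /G; case: asboolP.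
Qed.

(** * Law of the noise *)

Definition dyadic_inc (R : realType) (d : nat) (H : R) (j k : nat) (i : 'I_d)
    (w : noise d H) : R :=
  (val w (- (k.+1%:R / 2 ^+ j)) - val w (- (k%:R / 2 ^+ j))) i 0.

(* Only cylinders reaching at least up to time 1 are used, so that they can be
   split at time 1 later on. *)
Definition inc_rect (R : realType) (d : nat) (H : R) (j n : nat)
    (A : nat -> 'I_d -> set R) : set (noise d H) :=
  [set w | forall (k : 'I_(2 ^ j + n)) (i : 'I_d), A k i (dyadic_inc j k i w)].
Arguments inc_rect {R d} H j n A.

Definition inc_rects (R : realType) (d : nat) (H : R) (j : nat) :
    set (set (noise d H)) :=
  [set B | exists n A, (forall k i, measurable (A k i)) /\ B = inc_rect H j n A].
Arguments inc_rects {R} d H j.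

Lemma measurable_forall d (T : measurableType d) (I : countType) (Q : I -> set T) :
  (forall i, measurable (Q i)) -> measurable [set z | forall i, Q i z].
Proof.
move=> mQ; rewrite (_ : mkset _ = ~` (\bigcup_i ~` Q i)).
  apply: measurableC; apply: countable_bigcupT_measurable; first exact: countableP.
  by move=> i; exact: measurableC.
apply/seteqP; split => z /=; first by move=> h [i _]; apply; exact: h.
by move=> h i; apply: contrapT => hi; apply: h; exists i.
Qed.

Lemma measurable_fun_g_sigma (R : realType) (T : pointedType) (G : set (set T))
    (f : T -> R) :
  (forall B, measurable B -> <<s G >> (f @^-1` B)) ->
  measurable_fun (setT : set (g_sigma_algebraType G)) f.
Proof. by move=> h _ B mB; rewrite setTI; exact: h. Qed.

Lemma dyadic_inc_measurable (R : realType) (d : nat) (H : R) (j k : nat) i :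
  measurable_fun (setT : set (g_sigma_algebraType (inc_rects d H j)))
    (@dyadic_inc R d H j k i).
Proof.
apply: measurable_fun_g_sigma => B mB; apply: sub_gen_smallest.
exists k.+1, (fun k' i' => if (k' == k) && (i' == i) then B else setT); split.
  by move=> k' i'; case: ifP.
apply/seteqP; split => w /=.
  by move=> hB k' i'; case: ifP => // /andP[/eqP -> /eqP ->].
have kn : (k < 2 ^ j + k.+1)%N by rewrite addnS ltnS leq_addl.
by move=> /(_ (Ordinal kn) i)/=; rewrite !eqxx.
Qed.

Lemma dyadic_incS (R : realType) (d : nat) (H : R) (j k : nat) i (w : noise d H) :
  dyadic_inc j k i w =
  dyadic_inc j.+1 (2 * k) i w + dyadic_inc j.+1 (2 * k).+1 i w.
Proof.
have E (m : nat) : m%:R / 2 ^+ j = (2 * m)%:R / 2 ^+ j.+1 :> R.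
  by rewrite natrM exprS -mulf_div divff// mul1r.
rewrite /dyadic_inc (_ : (2 * k).+2 = (2 * k.+1)%N); last by lia.
by rewrite -!E !mxE; ring.
Qed.

(** An increment of mesh 2^-j is the sum of two of half the mesh; a rectangle becomes an event
    generated by finer rectangles without being one itself. *)
Lemma inc_rects_sub (R : realType) (d : nat) (H : R) (j : nat) :
  <<s inc_rects d H j >> `<=` <<s inc_rects d H j.+1 >>.
Proof.
apply: smallest_sub; first exact: smallest_sigma_algebra.
move=> _ [n [A [mA ->]]].
have : @measurable _ (g_sigma_algebraType (inc_rects d H j.+1)) (inc_rect H j n A).
  apply: (measurable_forall (Q := fun (k : 'I_(2 ^ j + n)) => [set w : g_sigma_algebraType (inc_rects d H j.+1) | forall i, A k i (dyadic_inc j k i w)])) => k.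
  apply: (measurable_forall (Q := fun i => [set w : g_sigma_algebraType (inc_rects d H j.+1) | A k i (dyadic_inc j k i w)])) => i.
  have mf : measurable_fun (setT : set (g_sigma_algebraType (inc_rects d H j.+1)))
      (fun w => dyadic_inc j.+1 (2 * k) i w + dyadic_inc j.+1 (2 * k).+1 i w).
    by apply: measurable_funD; exact: dyadic_inc_measurable.
  have := mf measurableT _ (mA k i); rewrite setTI; congr (measurable _).
  by apply/seteqP; split => w /=; rewrite -dyadic_incS.
by [].
Qed.

Lemma inc_rects_sub_le (R : realType) (d : nat) (H : R) (j l : nat) :
  (j <= l)%N -> <<s inc_rects d H j >> `<=` <<s inc_rects d H l >>.
Proof.
move=> /subnKC <-; elim: (l - j)%N => [|n IHn]; first by rewrite addn0.
by rewrite addnS; apply: subset_trans IHn (@inc_rects_sub _ _ _ _).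
Qed.

Lemma inc_rect_measurable (R : realType) (d : nat) (H : R) (j n : nat) A :
  (forall k i, measurable (A k i)) -> measurable (@inc_rect R d H j n A).
Proof.
move=> mA.
apply: (measurable_forall (Q := fun (k : 'I_(2 ^ j + n)) => [set w : noise d H | forall i, A k i (dyadic_inc j k i w)])) => k.
apply: (measurable_forall (Q := fun i => [set w : noise d H | A k i (dyadic_inc j k i w)])) => i.
have mf : measurable_fun setT (@dyadic_inc R d H j k i).
  rewrite (_ : dyadic_inc j k i = (fun w : noise d H =>
    val w (- (k.+1%:R / 2 ^+ j)) i 0 - val w (- (k%:R / 2 ^+ j)) i 0)).
    by apply: measurable_funB; exact: measurable_noise_eval.
  by apply/funext => w; rewrite /dyadic_inc !mxE.
by have := mf measurableT _ (mA k i); rewrite setTI.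
Qed.

Lemma inc_rects_measurable (R : realType) (d : nat) (H : R) (j : nat) :
  <<s inc_rects d H j >> `<=` @measurable _ (noise d H).
Proof.
apply: smallest_sub; first exact: sigma_algebra_measurable.
by move=> _ [n [A [mA ->]]]; exact: inc_rect_measurable.
Qed.

Lemma inc_rects_setI (R : realType) (d : nat) (H : R) (j : nat) :
  setI_closed (inc_rects d H j).
Proof.
move=> _ _ [n [A [mA ->]]] [m [B [mB ->]]].
exists (maxn n m), (fun k i => (if (k < 2 ^ j + n)%N then A k i else setT) `&`
  (if (k < 2 ^ j + m)%N then B k i else setT)); split.
  by move=> k i; apply: measurableI; case: ifP.
apply/seteqP; split => w /=.
  move=> [wA wB] k i; split; case: ifP => // kn.
    exact: (wA (Ordinal kn) i).
  exact: (wB (Ordinal kn) i).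
move=> h; split=> k i.
  have kn : (k < 2 ^ j + maxn n m)%N.
    by rewrite (leq_trans (ltn_ord k))// leq_add2l leq_maxl.
  by have [+ _] := h (Ordinal kn) i; rewrite /= ltn_ord.
have kn : (k < 2 ^ j + maxn n m)%N.
  by rewrite (leq_trans (ltn_ord k))// leq_add2l leq_maxr.
by have [_] := h (Ordinal kn) i; rewrite /= ltn_ord.
Qed.

Lemma inc_rects_setT (R : realType) (d : nat) (H : R) (j : nat) :
  inc_rects d H j setT.
Proof.
exists 0%N, (fun _ _ => setT); split => //.
by apply/seteqP; split.
Qed.

(** An increasing union of sigma-algebras: closed under intersection, which is what uniqueness of
    measures requires. *)
Definition dyadic_sets (R : realType) (d : nat) (H : R) : set (set (noise d H)) :=
  \bigcup_j <<s inc_rects d H j >>.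
Arguments dyadic_sets {R} d H.

Lemma dyadic_sets_setI (R : realType) (d : nat) (H : R) :
  setI_closed (dyadic_sets d H).
Proof.
move=> A B [j _ jA] [l _ lB]; exists (maxn j l) => //.
have mA := inc_rects_sub_le (leq_maxl j l) jA.
have mB := inc_rects_sub_le (leq_maxr j l) lB.
exact: (@measurableI _ (g_sigma_algebraType (inc_rects d H (maxn j l)))).
Qed.

(** Values at dyadic times are sums of increments, and continuity of paths reaches every time as a
    limit. By [noise_measurable_fun] the identity is then measurable out of the dyadic
    sigma-algebra. *)
Lemma noise_measurable_dyadic (R : realType) (d : nat) (H : R) : 0 < H < 1 ->
  @measurable _ (noise d H) `<=` <<s dyadic_sets d H >>.
Proof.
move=> H01 B mB.
suff mid : measurable_fun (setT : set (g_sigma_algebraType (dyadic_sets d H)))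
    (fun w => w : noise d H).
  by have := mid measurableT _ mB; rewrite setTI.
apply: noise_measurable_fun => // t i t0.
have dy j (k : nat) : measurable_fun
    (setT : set (g_sigma_algebraType (dyadic_sets d H)))
    (fun w : noise d H => val w (- (k%:R / 2 ^+ j)) i 0).
  apply: measurable_fun_g_sigma => C mC; apply: sub_gen_smallest.
  exists j => //.
  have mf : measurable_fun (setT : set (g_sigma_algebraType (inc_rects d H j)))
      (fun w : noise d H => \sum_(l < k) dyadic_inc j l i w).
    by apply: measurable_sum => l; exact: dyadic_inc_measurable.
  have := mf measurableT _ mC; rewrite setTI.
  rewrite (_ : (fun w : noise d H => \sum_(l < k) dyadic_inc j l i w) =
     (fun w : noise d H => val w (- (k%:R / 2 ^+ j)) i 0))//.
  apply/funext => w; elim: k {mf} => [|k IHk].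
    by rewrite big_ord0 mul0r oppr0 noise_ge0// mxE.
  by rewrite big_ord_recr/= IHk /dyadic_inc !mxE addrC subrK.
pose k j := Num.truncn (- t * 2 ^+ j).
apply: (@measurable_fun_cvg _ (g_sigma_algebraType (dyadic_sets d H)) R setT
  (fun j (w : noise d H) => val w (- ((k j)%:R / 2 ^+ j)) i 0)
  (fun w : noise d H => val w t i 0)).
  by move=> j; exact: dy.
move=> w _; apply/cvgrPdist_lt => e e0.
have [del del0 hdel] := hbound_continuous H01 (hn_ge0 w) (hn_bound w H01) t0 e0.
have [N hN] : exists N : nat, forall j : nat, (N <= j)%N -> (2 ^+ j)^-1 <= del :> R.
  exists (Num.truncn del^-1) => j hj.
  rewrite -[leRHS]invrK lef_pV2 ?posrE ?invr_gt0 ?exprn_gt0//.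
  apply/ltW; apply: lt_le_trans (truncnS_gt _) _.
  rewrite -natrX ler_nat; apply: leq_ltn_trans hj _; exact: ltn_expl.
exists N => // j /= /hN hj.
have p0 : 0 < 2 ^+ j :> R by rewrite exprn_gt0.
have tj0 : 0 <= - t * 2 ^+ j by rewrite mulr_ge0 ?exprn_ge0// oppr_ge0.
have /andP[k1 k2] := truncn_itv tj0.
have q1 : (k j)%:R / 2 ^+ j <= - t by rewrite ler_pdivrMr.
have q2 : - t <= (k j)%:R / 2 ^+ j + (2 ^+ j)^-1.
  by rewrite -[X in _ + X]mul1r -mulrDl natr1 ler_pdivlMr// ltW.
have q0 : 0 <= (k j)%:R / 2 ^+ j :> R by rewrite divr_ge0// exprn_ge0.
rewrite distrC.
have -> : val w (- ((k j)%:R / 2 ^+ j)) i 0 - val w t i 0 =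
  (val w (- ((k j)%:R / 2 ^+ j)) - val w t) i 0 by rewrite !mxE.
apply: le_lt_trans (coord_le_enorm _ _) _; apply: hdel.
  by rewrite oppr_le0.
rewrite ger0_norm; last by rewrite subr_ge0 lerNr.
apply: le_trans hj; rewrite lerBlDr.
by rewrite -(lerD2l ((k j)%:R / 2 ^+ j)) subrr addrA -lerBlDr sub0r.
Qed.

(** Uniqueness of measures on an intersection-stable generator is used twice: on the rectangles of a
    fixed mesh, then on the union of the resulting sigma-algebras. *)
Lemma noise_law_unique (R : realType) (d : nat) (H : R)
    (P Q : {measure set (noise d H) -> \bar R}) : 0 < H < 1 ->
  (P setT < +oo)%E ->
  (forall j n A, (forall k i, measurable (A k i)) ->
     P (inc_rect H j n A) = Q (inc_rect H j n A)) ->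
  forall B, measurable B -> P B = Q B.
Proof.
move=> H01 Pfin PQ B /(noise_measurable_dyadic H01) mB.
have Pj j C : <<s inc_rects d H j >> C -> P C = Q C.
  move=> mC; apply: (@g_sigma_algebra_measure_unique _ _ _ (inc_rects d H j) _
    (fun=> setT)) mC.
  - by apply: subset_trans (@inc_rects_measurable _ _ _ _); exact: sub_gen_smallest.
  - by move=> _; exact: inc_rects_setT.
  - by rewrite bigcup_const.
  - exact: inc_rects_setI.
  - by move=> _ [n [A [mA ->]]]; exact: PQ.
  - by [].
apply: (@g_sigma_algebra_measure_unique _ _ _ (dyadic_sets d H) _
    (fun=> setT)) mB.
- by move=> C [j _]; exact: inc_rects_measurable.
- by move=> _; exists 0%N => //; apply: sub_gen_smallest; exact: inc_rects_setT.
- by rewrite bigcup_const.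
- exact: dyadic_sets_setI.
- by move=> C [j _]; exact: Pj.
- by [].
Qed.

Lemma pushforward_measure d d' (T1 : measurableType d) (T2 : measurableType d')
    (R : realType) (m : {measure set T1 -> \bar R}) (f : T1 -> T2) :
  measurable_fun setT f ->
  exists Q : {measure set T2 -> \bar R}, forall A, Q A = m (f @^-1` A).
Proof.
by move=> mf; exists (measure_function_pushforward__canonical__measure_function_Measure m mf).
Qed.

(** * Noise updates and concatenation of paths *)

Lemma noise_ext (R : realType) (d : nat) (H : R) (v w : noise d H) :
  (forall s, s <= 0 -> val v s = val w s) -> v = w.
Proof.
move=> vw; apply: val_inj; apply/funext => s.
by have [s0|/ltW s0] := leP s 0; [exact: vw|rewrite !noise_ge0].
Qed.

Lemma measurable_noise_update (R : realType) (d : nat) (H : R)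
    (Pt : R -> noise d H * noise d H -> noise d H) t :
  0 < H < 1 -> is_noise_update Pt -> 0 <= t -> measurable_fun setT (Pt t).
Proof.
move=> H01 hPt t0; apply: noise_measurable_fun => // s i s0.
have [ts|st] := leP (- t) s.
  rewrite (_ : (fun z => _) = (fun z : noise d H * noise d H =>
    val z.2 (- s - t) i 0 - val z.2 (- t) i 0)).
    by apply: measurable_funB;
      apply: measurableT_comp (@measurable_noise_eval _ _ _ _ i) measurable_snd.
  by apply/funext => z; have [+ _] := hPt t z t0; move=> ->; rewrite ?mxE ?ts.
rewrite (_ : (fun z => _) = (fun z : noise d H * noise d H =>
    val z.1 (s + t) i 0 - val z.2 (- t) i 0)).
  apply: measurable_funB.
    exact: measurableT_comp (@measurable_noise_eval _ _ _ _ i) measurable_fst.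
  exact: measurableT_comp (@measurable_noise_eval _ _ _ _ i) measurable_snd.
by apply/funext => z; have [_] := hPt t z t0; move=> ->; rewrite ?mxE ?(ltW st).
Qed.

(* The path that follows [w] up to time [1] and then [w']; updating twice undoes
   the time reversal. *)
Definition concat (R : realType) (d : nat) (H : R)
    (Pt : R -> noise d H * noise d H -> noise d H) (w w' : noise d H) : noise d H :=
  Pt 1 (w', Pt 1 (point, w)).

Lemma concat_near (R : realType) (d : nat) (H : R)
    (Pt : R -> noise d H * noise d H -> noise d H) (w w' : noise d H) s :
  is_noise_update Pt -> -1 <= s <= 0 -> val (concat Pt w w') s = val w s.
Proof.
move=> hPt /andP[s1 s0].
have [h1 _] := hPt 1 (w', Pt 1 (point, w)) ler01.
rewrite /concat h1; last by rewrite s1.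
have [h _] := hPt 1 (point, w) ler01.
rewrite /= !h; [|by rewrite lexx lerN10|by apply/andP; split; lra].
have -> : - (- s - 1) - 1 = s by ring.
have -> : - -1 - 1 = 0 :> R by ring.
by rewrite (noise_ge0 w (lexx 0)) sub0r opprK subrK.
Qed.

Lemma concat_far (R : realType) (d : nat) (H : R)
    (Pt : R -> noise d H * noise d H -> noise d H) (w w' : noise d H) s :
  is_noise_update Pt -> s <= -1 ->
  val (concat Pt w w') s = val w' (s + 1) + val w (-1).
Proof.
move=> hPt s1.
have [_ h1] := hPt 1 (w', Pt 1 (point, w)) ler01.
rewrite /concat h1//.
have [h _] := hPt 1 (point, w) ler01.
rewrite /= h; last by rewrite lexx lerN10.
have -> : - -1 - 1 = 0 :> R by ring.
by rewrite (noise_ge0 w (lexx 0)) sub0r opprK.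
Qed.

Lemma shift_concat (R : realType) (d : nat) (H : R) (H01 : 0 < H < 1)
    (Pt : R -> noise d H * noise d H -> noise d H) (w w' : noise d H) :
  is_noise_update Pt -> shift_noise H01 (concat Pt w w') = w'.
Proof.
move=> hPt; apply: noise_ext => s s0.
have -> : val (shift_noise H01 (concat Pt w w')) s =
    val (concat Pt w w') (s - 1) - val (concat Pt w w') (- 1).
  by rewrite [LHS]/= /shiftp min_l.
rewrite concat_far//; last by lra.
by rewrite concat_near ?lexx ?lerN10// subrK addrK.
Qed.

(** As a composition of two noise updates, [concat] inherits their measurability, and its values lie
    in the noise space without further argument. *)
Lemma measurable_concat (R : realType) (d : nat) (H : R)
    (Pt : R -> noise d H * noise d H -> noise d H) :
  0 < H < 1 -> is_noise_update Pt ->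
  measurable_fun setT (fun q : noise d H * noise d H => concat Pt q.1 q.2).
Proof.
move=> H01 hPt; have m1 := measurable_noise_update H01 hPt ler01.
apply: (measurableT_comp m1); apply: measurable_fun_pair; first exact: measurable_snd.
apply: (measurableT_comp m1); apply: measurable_fun_pair => //.
Qed.

Lemma reversed_brownian_rect (R : realType) (d : nat) (H : R)
    (P : probability (noise d H) R) (j n : nat) (A : nat -> 'I_d -> set R) :
  reversed_brownian P -> (forall k i, measurable (A k i)) ->
  P [set w : noise d H | forall (k : 'I_n) i, A k i (dyadic_inc j k i w)] =
  (\prod_(k < n) \prod_(i < d) normal_prob 0 (Num.sqrt ((2 ^+ j)^-1)) (A k i))%E.
Proof.
move=> hP mA; have p0 : 0 < 2 ^+ j :> R by rewrite exprn_gt0.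
have h0 : 0 <= 0%:R / 2 ^+ j :> R by rewrite mul0r.
have hi k : k%:R / 2 ^+ j < k.+1%:R / 2 ^+ j :> R.
  by rewrite ltr_pM2r ?invr_gt0// ltr_nat.
have E := hP n (fun k => k%:R / 2 ^+ j) A h0 hi mA.
etransitivity; first exact: E.
apply: eq_bigr => k _; apply: eq_bigr => i _.
by rewrite -mulrBl -natr1 addrAC subrr add0r mul1r.
Qed.

(** Markov property of Brownian motion at time 1: two independent paths glued there form a Brownian
    path again. On a rectangle the first 2^j increments see only the first path and the others only
    the second, so both sides are the same product of Gaussian factors. *)
Lemma concat_law (R : realType) (d : nat) (H : R)
    (P : probability (noise d H) R)
    (Pt : R -> noise d H * noise d H -> noise d H) (B : set (noise d H)) :
  0 < H < 1 -> is_noise_update Pt -> reversed_brownian P -> measurable B ->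
  (P \x P)%E ((fun q => concat Pt q.1 q.2) @^-1` B) = P B.
Proof.
move=> H01 hPt hP mB; have mc := measurable_concat H01 hPt.
have [Q hQ] := pushforward_measure (P \x P)%E mc.
rewrite -hQ; apply/esym; apply: noise_law_unique mB => //.
  by apply: le_lt_trans (probability_le1 P measurableT) _; rewrite ltry.
move=> j n A mA; rewrite hQ.
have p0 : 0 < 2 ^+ j :> R by rewrite exprn_gt0.
pose X := [set w : noise d H | forall (k : 'I_(2 ^ j)) i, A k i (dyadic_inc j k i w)].
pose Y := [set w : noise d H | forall (k : 'I_n) i, A (2 ^ j + k)%N i (dyadic_inc j k i w)].
have near (k : nat) i w w' : (k < 2 ^ j)%N ->
    dyadic_inc j k i (concat Pt w w') = dyadic_inc j k i w.
  move=> kj; have k1 : k.+1%:R / 2 ^+ j <= 1 :> R.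
    by rewrite ler_pdivrMr// mul1r -natrX ler_nat.
  have k2 : k%:R / 2 ^+ j <= 1 :> R.
    by rewrite ler_pdivrMr// mul1r -natrX ler_nat ltnW.
  rewrite /dyadic_inc !concat_near// lerN2 oppr_le0 ?k1 ?k2 divr_ge0//; exact: ltW.
have far (k : nat) i w w' :
    dyadic_inc j (2 ^ j + k) i (concat Pt w w') = dyadic_inc j k i w'.
  have E (m : nat) : (2 ^ j + m)%:R / 2 ^+ j = 1 + m%:R / 2 ^+ j :> R.
    by rewrite natrD natrX mulrDl divff ?gt_eqF.
  have pos (m : nat) : 0 <= m%:R / 2 ^+ j :> R by rewrite divr_ge0// ltW.
  rewrite /dyadic_inc -addnS !E !concat_far//; last first.
  - by rewrite lerN2 lerDl.
  - by rewrite lerN2 lerDl.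
  have E2 (a : R) : - (1 + a) + 1 = - a by ring.
  by rewrite !E2 opprD addrACA subrr addr0.
have mX : measurable X.
  have := @inc_rect_measurable R d H j 0 A mA; rewrite /inc_rect.
  by rewrite addn0.
have mY : measurable Y.
  apply: (measurable_forall (Q := fun (k : 'I_n) => [set w : noise d H | forall i, A (2 ^ j + k)%N i (dyadic_inc j k i w)])) => k.
  apply: (measurable_forall (Q := fun i => [set w : noise d H | A (2 ^ j + k)%N i (dyadic_inc j k i w)])) => i.
  have mf : measurable_fun setT (@dyadic_inc R d H j k i).
    rewrite (_ : dyadic_inc j k i = (fun w : noise d H =>
      val w (- (k.+1%:R / 2 ^+ j)) i 0 - val w (- (k%:R / 2 ^+ j)) i 0)).
      by apply: measurable_funB; exact: measurable_noise_eval.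
    by apply/funext => w; rewrite /dyadic_inc !mxE.
  by have := mf measurableT _ (mA (2 ^ j + k)%N i); rewrite setTI.
have -> : (fun q => concat Pt q.1 q.2) @^-1` inc_rect H j n A = X `*` Y.
  apply/seteqP; split => -[w w'] /=.
    move=> h; split => k i.
      have := h (widen_ord (leq_addr n (2 ^ j)) k) i; rewrite /= near//.
    by have := h (rshift (2 ^ j) k) i; rewrite /= far.
  move=> [hX hY] k i; case: (split_ordP k) => l ->/=.
    by rewrite near//; exact: hX.
  by rewrite far; exact: hY.
transitivity (P X * P Y)%E; last by apply/esym; exact: product_measure1E.
have E1 := @reversed_brownian_rect R d H P j (2 ^ j + n) A hP mA.
have E2 := @reversed_brownian_rect R d H P j (2 ^ j) A hP mA.
have E3 := @reversed_brownian_rect R d H P j n (fun k => A (2 ^ j + k)%N) hP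
  (fun k i => mA (2 ^ j + k)%N i).
rewrite big_split_ord/= in E1.
apply: (etrans E1); congr (_ * _)%E; apply/esym; [exact: E2|exact: E3].
Qed.

(** * Measurability of the flow *)

Lemma measurable_euclid_coord (R : realType) (d : nat) (i : 'I_d) :
  measurable_fun setT (fun x : euclid R d => (x : 'cV[R]_d) i 0).
Proof.
apply: measurable_gt_fun => a; apply: sub_gen_smallest.
have -> : [set z : 'cV[R]_d | a < z i 0] = (fun z : 'cV[R]_d => z i 0) @^-1` `]a, +oo[%classic.
  by apply/seteqP; split => z /=; rewrite in_itv/= andbT.
apply: open_comp => [z _|]; first exact: coord_continuous.
exact: rray_open.
Qed.

(** An open set is a countable union of cubes with rational centres, and a cube is a condition on
    coordinates. *)
Lemma euclid_measurable_fun d' (T : measurableType d') (R : realType) (d : nat)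
    (f : T -> euclid R d) :
  (forall i, measurable_fun setT (fun z => (f z : 'cV[R]_d) i 0)) ->
  measurable_fun setT f.
Proof.
move=> mf; have hm : @measurable _ (euclid R d) = <<s @open 'cV[R]_d >> by [].
apply: (measurability _ hm) => _ [U oU <-]; rewrite setTI.
pose B (c : {ffun 'I_d -> rat} * nat) : set 'cV[R]_d :=
  [set x | forall i, `|x i 0 - ratr (c.1 i)| < c.2.+1%:R^-1].
have mB c : measurable (f @^-1` B c).
  apply: (measurable_forall (Q := fun i => [set z | `|(f z : 'cV[R]_d) i 0 - ratr (c.1 i)| < c.2.+1%:R^-1])) => i.
  rewrite (_ : mkset _ = [set z | - c.2.+1%:R^-1 < - `|(f z : 'cV[R]_d) i 0 - ratr (c.1 i)|]).
    apply: measurable_gt; apply: measurableT_comp => //.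
    by apply: measurableT_comp => //; exact: measurable_funB.
  by apply/seteqP; split => z /=; rewrite ltrN2.
pose G c : set T := if `[< B c `<=` U >] then f @^-1` B c else set0.
have -> : f @^-1` U = \bigcup_c G c.
  apply/seteqP; split => z; last first.
    by move=> [c _]; rewrite /G; case: asboolP => // h; exact: h.
  move=> /= Uz.
  have /nbhs_ballP[e /= e0 he] : nbhs (f z : 'cV[R]_d) U by exact: open_nbhs_nbhs.
  pose m := Num.truncn (e / 2)^-1.
  have m0 : 0 < m.+1%:R^-1 :> R by rewrite invr_gt0.
  have hm2 : m.+1%:R^-1 <= e / 2.
    by rewrite -[leRHS]invrK lef_pV2 ?posrE ?invr_gt0 ?divr_gt0//; exact/ltW/truncnS_gt.
  have h i : exists q : rat, `|(f z : 'cV[R]_d) i 0 - ratr q| < m.+1%:R^-1.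
    have /rat_in_itvoo[q] : (f z : 'cV[R]_d) i 0 < (f z : 'cV[R]_d) i 0 + m.+1%:R^-1.
      by rewrite ltrDl.
    rewrite in_itv/= => /andP[q1 q2]; exists q.
    by rewrite ltr0_norm ?subr_lt0// opprB ltrBlDl.
  have /choice[q hq] := h.
  exists ([ffun i => q i], m) => //; rewrite /G; case: asboolP => [_|[]].
    by move=> i /=; rewrite ffunE.
  move=> x hx; apply: he; rewrite -ball_normE /=.
  apply: (@le_lt_trans _ _ (\big[Num.max/0]_ij `|((f z : 'cV[R]_d) - x) ij.1 ij.2|)).
    by have -> : `|(f z : 'cV[R]_d) - x| = mx_norm ((f z : 'cV[R]_d) - x) by [];
       rewrite mx_normrE.
  apply/bigmax_ltP; split => // -[i j] _ /=; rewrite (ord1 j) !mxE.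
  have := hx i; rewrite /= ffunE => h1.
  apply: le_lt_trans (ler_distD (ratr (q i)) _ _) _.
  rewrite [e]splitr; apply: ltrD; apply: lt_le_trans hm2; first exact: hq.
  by rewrite distrC.
apply: countable_bigcupT_measurable; first exact: countableP.
by move=> c; rewrite /G; case: asboolP.
Qed.

Lemma measurable_continuous_cV d' (T : measurableType d') (R : realType) (d : nat)
    (F : 'cV[R]_d -> 'cV[R]_d) (f : T -> 'cV[R]_d) : continuous F ->
  (forall i, measurable_fun setT (fun z => f z i 0)) ->
  forall i, measurable_fun setT (fun z => F (f z) i 0).
Proof.
move=> cF mf i; have mf' := @euclid_measurable_fun _ T R d f mf.
have mF : measurable_fun setT (fun x : euclid R d => F x i 0).
  apply: measurable_gt_fun => a; apply: sub_gen_smallest.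
  have -> : [set z : 'cV[R]_d | a < F z i 0] =
      (fun z : 'cV[R]_d => F z i 0) @^-1` `]a, +oo[%classic.
    by apply/seteqP; split => z /=; rewrite in_itv/= andbT.
  apply: open_comp => [z _|]; last exact: rray_open.
  apply: (@continuous_comp _ _ _ F (fun z : 'cV[R]_d => z i 0)); first exact: cF.
  exact: coord_continuous.
exact: measurableT_comp mF mf'.
Qed.

Lemma measurable_DH (R : realType) (d : nat) (H : R)
    (DH : noise d H -> noise d (1 - H)) : is_DH DH -> measurable_fun setT DH.
Proof.
move=> [cDH _].
have hm : @measurable _ (noise d (1 - H)) = <<s hopen d (1 - H) >> by [].
apply: (measurability _ hm) => _ [U hU <-]; rewrite setTI.
apply: hopen_measurable => w Uw; have [e e0 he] := hU _ Uw.
have [del del0 h] := cDH w e e0; exists del; [exact: del0|move=> v hv].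
exact: he (h v hv).
Qed.

Lemma measurable_fbm (R : realType) (d : nat) (H : R)
    (Pt : R -> noise d H * noise d H -> noise d H)
    (DH : noise d H -> noise d (1 - H)) (sigma : 'M[R]_d) t i :
  0 < H < 1 -> is_noise_update Pt -> is_DH DH -> 0 <= t ->
  measurable_fun setT (fun w => (sigma *m fbm Pt DH t w) i 0).
Proof.
move=> H01 hPt hDH t0.
have mw j : measurable_fun setT (fun w => (fbm Pt DH t w) j 0).
  rewrite (_ : (fun w => _) = (fun w => - (val (DH (Pt t w)) (- t) j 0))).
    apply: measurableT_comp => //.
    apply: (measurableT_comp (@measurable_noise_eval R d (1 - H) (- t) j)).
    apply: (measurableT_comp (measurable_DH hDH)).
    exact: measurable_noise_update.
  by apply/funext => w; rewrite /fbm mxE.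
rewrite (_ : (fun w => _) = (fun w => \sum_j sigma i j * fbm Pt DH t w j 0)).
  by apply: measurable_sum => j; exact: measurable_funM.
by apply/funext => w; rewrite mxE.
Qed.

(** Pointwise limit of Euler schemes. The constants [G] and [L] may depend on the orbit, since only
    pointwise convergence is needed. *)
Lemma measurable_flow (R : realType) (d : nat) (H : R)
    (F : 'cV[R]_d -> 'cV[R]_d) (sigma : 'M[R]_d)
    (Pt : R -> noise d H * noise d H -> noise d H)
    (DH : noise d H -> noise d (1 - H))
    (Phi : R -> noise d H * noise d H -> 'cV[R]_d -> 'cV[R]_d) :
  0 < H < 1 -> assumption_D H F -> holder_derivative F ->
  is_noise_update Pt -> is_DH DH -> is_flow F sigma (fbm Pt DH) Phi ->
  measurable_fun setT (fun z : euclid R d * (noise d H * noise d H) =>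
    Phi 1 z.2 z.1 : euclid R d).
Proof.
move=> H01 hD hF hPt hDH hPhi.
have [C [K [n [C0 hC dF K0 hK]]]] := assumption_D_bounds hD.
have [r [C' [p [r01 C'0 hexp]]]] := first_order_expansion dF hF.
pose b (w : noise d H * noise d H) t := sigma *m fbm Pt DH t w.
have cF : continuous F by move=> x; exact/differentiable_continuous/dF.
apply: euclid_measurable_fun => i.
have mb t j : 0 <= t -> measurable_fun setT
    (fun z : euclid R d * (noise d H * noise d H) => b z.2 t j 0).
  move=> t0; have := measurable_fbm sigma j H01 hPt hDH t0.
  by move=> h; exact: measurableT_comp h measurable_snd.
have meu (m : nat) (h : R) k j : 0 <= h -> measurable_fun setT
    (fun z : euclid R d * (noise d H * noise d H) => euler F (b z.2) h z.1 k j 0).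
  move=> h0; elim: k j => [|k IHk] j.
    exact: measurableT_comp (@measurable_euclid_coord R d j) measurable_fst.
  rewrite (_ : (fun z => _) = (fun z : euclid R d * (noise d H * noise d H) =>
    euler F (b z.2) h z.1 k j 0 +
    h * F (euler F (b z.2) h z.1 k + b z.2 (k%:R * h)) j 0)); last first.
    by apply/funext => z; rewrite /= !mxE.
  apply: measurable_funD => //; apply: measurable_funM => //.
  apply: measurable_continuous_cV => // l.
  rewrite (_ : (fun z => _) = (fun z : euclid R d * (noise d H * noise d H) =>
    euler F (b z.2) h z.1 k l 0 + b z.2 (k%:R * h) l 0)); last first.
    by apply/funext => z; rewrite !mxE.
  by apply: measurable_funD => //; apply: mb; rewrite mulr_ge0.
apply: (@measurable_fun_cvg _ _ R setT
  (fun m (z : euclid R d * (noise d H * noise d H)) =>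
     euler F (b z.2) m.+1%:R^-1 z.1 m.+1 i 0 + b z.2 1 i 0)
  (fun z => Phi 1 z.2 z.1 i 0)).
  move=> m; apply: measurable_funD; last exact: mb.
  by apply: (meu m); rewrite invr_ge0.
move=> [x w] _; apply/cvgrPdist_le => e e0.
pose X t := Phi (Num.max 0 t) w x.
have sX : is_solution F (b w) 1 x X by exact: flow_solution.
have cX : continuous X by exact: (@flow_continuous _ _ _ _ _ _ _ hPhi w x).
have [G XG] : exists G : R, forall t, 0 <= t <= 1 -> enorm (X t) <= G.
  have cn : {within `[0, 1], continuous (fun t : R => `|X t|)}.
    apply: continuous_subspaceT => t.
    by apply: (@continuous_comp _ _ _ X (fun v : 'cV[R]_d => `|v|) t (cX t)); exact: norm_continuous.
  have [c _ hc] := EVT_max ler01 cn.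
  exists (d%:R * `|X c|) => t t01; apply: le_trans (enorm_le_norm _) _.
  by rewrite ler_wpM2l//; apply: hc; rewrite in_itv.
have G0 : 0 <= G by apply: le_trans (XG 0 _); rewrite ?enorm_ge0 ?lexx ?ler01.
(* The first term bounds DF on the ball of radius [G], the second the remainder of the first-order
   expansion for displacements of length at most 1. *)
pose L := K * (1 + G) ^+ n + C' * (2 + 2 * G) ^+ p.
have L0 : 0 <= L.
  by rewrite addr_ge0// mulr_ge0 ?(ltW K0) ?(ltW C'0)// exprn_ge0//; lra.
have hL y h : enorm y <= G -> enorm h <= 1 ->
    enorm (F (y + h) - F y) <= L * enorm h.
  move=> yG h1; have y0 := enorm_ge0 y; have h0 := enorm_ge0 h.
  have -> : F (y + h) - F y = 'd F y h + (F (y + h) - F y - 'd F y h).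
    by rewrite addrCA subrr addr0.
  apply: le_trans (ler_enormD _ _) _; rewrite /L mulrDl; apply: lerD.
    have [_ /(_ h) hh] := hK y; apply: le_trans hh _.
    rewrite ler_wpM2r// ler_wpM2l ?(ltW K0)//.
    by apply: lerXn2r; rewrite ?nnegrE; lra.
  apply: le_trans (hexp y h) _; rewrite -mulrA -mulrA ler_wpM2l ?(ltW C'0)//.
  apply: ler_pM.
  - by rewrite exprn_ge0//; lra.
  - exact: powR_ge0.
  - by apply: lerXn2r; rewrite ?nnegrE; lra.
  - case/andP: r01 => r0 _.
    rewrite powRD; last by rewrite gt_eqF//=; lra.
    rewrite powRr1// ler_piMr//.
    have : enorm h `^ r <= 1 `^ r by apply: ge0_ler_powR; rewrite ?nnegrE//; lra.
    by rewrite powR1.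
have [N hN] := euler_cvg sX XG L0 hL e0.
exists N => // m /= /hN; rewrite /X max_r// => hm.
apply: le_trans hm.
have -> : Phi 1 w x i 0 - (euler F (b w) m.+1%:R^-1 x m.+1 i 0 + b w 1 i 0) =
  (Phi 1 w x - (euler F (b w) m.+1%:R^-1 x m.+1 + b w 1)) i 0 by rewrite !mxE.
exact: coord_le_enorm.
Qed.

(** * The skew product *)

Lemma flow_contract (R : realType) (d : nat) (H : R)
    (F : 'cV[R]_d -> 'cV[R]_d) (sigma : 'M[R]_d) (C : R)
    (B : R -> noise d H * noise d H -> 'cV[R]_d)
    (Phi : R -> noise d H * noise d H -> 'cV[R]_d -> 'cV[R]_d) :
  0 <= C -> (forall x, differentiable F x) ->
  (forall x y, inner (F y - F x) (y - x) <= C * enorm (y - x) ^+ 2) ->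
  is_flow F sigma B Phi ->
  forall t w x y, 0 <= t ->
    enorm (Phi t w x - Phi t w y) <= expR (C * t) * enorm (x - y).
Proof.
move=> C0 dF hC hPhi t w x y t0.
have h1 := flow_solution dF hPhi w x t; have h2 := flow_solution dF hPhi w y t.
have := solution_contract C0 hC h1 h2 (t := t).
by rewrite t0 lexx !max_r// => /(_ isT).
Qed.

(** Both flows solve the same equation on [0, T], and [solution_contract] with equal initial values
    identifies them. *)
Lemma flow_noise_eq (R : realType) (d : nat) (H : R)
    (F : 'cV[R]_d -> 'cV[R]_d) (sigma : 'M[R]_d) (C : R)
    (B : R -> noise d H * noise d H -> 'cV[R]_d)
    (Phi : R -> noise d H * noise d H -> 'cV[R]_d -> 'cV[R]_d) :
  0 <= C -> (forall x, differentiable F x) ->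
  (forall x y, inner (F y - F x) (y - x) <= C * enorm (y - x) ^+ 2) ->
  is_flow F sigma B Phi ->
  forall T w w' x, 0 <= T -> (forall t, 0 <= t <= T -> B t w = B t w') ->
    Phi T w x = Phi T w' x.
Proof.
move=> C0 dF hC hPhi T w w' x T0 BB.
have h1 := flow_solution dF hPhi w x T; have h2 := flow_solution dF hPhi w' x T.
have {}h1 : is_solution F (fun t => sigma *m B t w') T x
    (fun t => Phi (Num.max 0 t) w x).
  by apply: is_solution_eq h1 => t tT; rewrite BB.
have := solution_contract C0 hC h1 h2 (t := T).
rewrite T0 lexx !max_r// => /(_ isT).
rewrite subrr enorm0 mulr0 => h; apply/subr0_eq/enorm0_eq0.
by apply/eqP; rewrite eq_le h enorm_ge0.
Qed.

Lemma update_concat (R : realType) (d : nat) (H : R)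
    (Pt : R -> noise d H * noise d H -> noise d H) (v w w' : noise d H) t :
  is_noise_update Pt -> 0 <= t <= 1 -> Pt t (v, concat Pt w w') = Pt t (v, w).
Proof.
move=> hPt /andP[t0 t1]; apply: noise_ext => s s0.
have [h1 h2] := hPt t (v, concat Pt w w') t0.
have [h3 h4] := hPt t (v, w) t0.
have tt : -1 <= - t <= 0 by apply/andP; split; lra.
have [ts|st] := leP (- t) s.
  have aa : -1 <= - s - t <= 0 by apply/andP; split; lra.
  rewrite h1 ?ts ?s0// h3 ?ts ?s0//.
  by congr (_ - _); exact: concat_near.
rewrite h2 ?(ltW st)// h4 ?(ltW st)//.
by congr (_ - _); exact: concat_near.
Qed.

Definition skew_step (R : realType) (d : nat) (H : R) (H01 : 0 < H < 1)
    (Pt : R -> noise d H * noise d H -> noise d H)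
    (Phi : R -> noise d H * noise d H -> 'cV[R]_d -> 'cV[R]_d)
    (z : (euclid R d * noise d H) * noise d H) :
    (euclid R d * noise d H) * noise d H :=
  ((Phi 1 (omega z) z.1.1, Pt 1 (omega z)), shift_noise H01 z.2).

Lemma measurable_shift_noise (R : realType) (d : nat) (H : R) (H01 : 0 < H < 1) :
  measurable_fun setT (@shift_noise R d H H01).
Proof.
apply: noise_measurable_fun => // t i t0.
rewrite (_ : (fun z => _) = (fun w : noise d H =>
   val w (t - 1) i 0 - val w (- 1) i 0)).
  by apply: measurable_funB; exact: measurable_noise_eval.
by apply/funext => w; rewrite [LHS]/= /shiftp min_l// !mxE.
Qed.

Lemma skew_measurable (R : realType) (d : nat) (H : R) (H01 : 0 < H < 1)
    (F : 'cV[R]_d -> 'cV[R]_d) (sigma : 'M[R]_d)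
    (Pt : R -> noise d H * noise d H -> noise d H)
    (DH : noise d H -> noise d (1 - H))
    (Phi : R -> noise d H * noise d H -> 'cV[R]_d -> 'cV[R]_d) :
  assumption_D H F -> holder_derivative F ->
  is_noise_update Pt -> is_DH DH -> is_flow F sigma (fbm Pt DH) Phi ->
  measurable_fun setT (skew_step H01 Pt Phi).
Proof.
move=> hD hF hPt hDH hPhi.
have mo : measurable_fun setT (@omega R d H).
  apply: measurable_fun_pair; last exact: measurable_snd.
  exact: measurableT_comp measurable_snd measurable_fst.
apply: measurable_fun_pair; last first.
  exact: measurableT_comp (measurable_shift_noise H01) measurable_snd.
apply: measurable_fun_pair; last first.
  exact: measurableT_comp (measurable_noise_update H01 hPt ler01) mo.
have mf := measurable_flow H01 hD hF hPt hDH hPhi.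
have mg : measurable_fun setT (fun z : (euclid R d * noise d H) * noise d H =>
    (z.1.1, omega z)).
  apply: measurable_fun_pair => //.
  exact: measurableT_comp measurable_fst measurable_fst.
exact: measurableT_comp mf mg.
Qed.

(** The new state depends on the future noise up to time 1 only, and the shifted future is
    independent of it with law [P]. Hence [mu \x P] is preserved on rectangles as soon as [mu] is
    invariant for the time-one kernel, and rectangles determine the measure. *)
Lemma skew_preserves (R : realType) (d : nat) (H : R) (H01 : 0 < H < 1)
    (F : 'cV[R]_d -> 'cV[R]_d) (sigma : 'M[R]_d)
    (P : probability (noise d H) R)
    (Pt : R -> noise d H * noise d H -> noise d H)
    (DH : noise d H -> noise d (1 - H))
    (Phi : R -> noise d H * noise d H -> 'cV[R]_d -> 'cV[R]_d)
    (mu : probability (euclid R d * noise d H)%type R) :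
  assumption_D H F -> holder_derivative F -> reversed_brownian P ->
  is_noise_update Pt -> is_DH DH -> is_flow F sigma (fbm Pt DH) Phi ->
  stationary P Pt Phi mu ->
  forall U, measurable U ->
    (mu \x P)%E (skew_step H01 Pt Phi @^-1` U) = (mu \x P)%E U.
Proof.
move=> hD hF hP hPt hDH hPhi [_ hmu] U mU.
have [C [K [n [C0 hC dF _ _]]]] := assumption_D_bounds hD.
have mT := skew_measurable H01 hD hF hPt hDH hPhi.
have [Q hQ] := pushforward_measure (mu \x P)%E mT.
rewrite -hQ; apply/esym.
apply: (@product_measure_unique _ _ _ _ _ mu P Q) mU => A B mA mB.
rewrite hQ.
pose g (z : euclid R d * noise d H) (w : noise d H) : euclid R d * noise d H :=
  (Phi 1 (z.2, w) z.1, Pt 1 (z.2, w)).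
have mg : measurable_fun setT (fun q : (euclid R d * noise d H) * noise d H => g q.1 q.2).
  have := measurableT_comp measurable_fst mT; exact.
have gc z w w' : g z (concat Pt w w') = g z w.
  rewrite /g update_concat ?ler01 ?lexx//; congr (_, _).
  apply: (flow_noise_eq (ltW C0) dF hC hPhi) => //.
  by move=> t t01; rewrite /fbm update_concat.
pose X z := [set w | A (g z w)].
have mXX : measurable [set q : (euclid R d * noise d H) * noise d H | A (g q.1 q.2)].
  by have := mg measurableT _ mA; rewrite setTI.
have XE z : X z = xsection [set q : (euclid R d * noise d H) * noise d H | A (g q.1 q.2)] z.
  by apply/seteqP; split => w; rewrite /xsection/= inE.
have mX z : measurable (X z) by rewrite XE; exact: measurable_xsection.
(* By [concat_law] the future may be drawn as the concatenation of independent [w] and [w']; the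
   state condition then involves [w] alone and the shifted future is [w']. *)
have key z : P (xsection (skew_step H01 Pt Phi @^-1` (A `*` B)) z) = (P (X z) * P B)%E.
  have mS : measurable (xsection (skew_step H01 Pt Phi @^-1` (A `*` B)) z).
    apply: measurable_xsection; rewrite -[X in measurable X]setTI.
    by apply: mT => //; exact: measurableX.
  rewrite -(concat_law H01 hPt hP mS).
  transitivity ((P \x P)%E (X z `*` B)); last exact: product_measure1E.
  congr ((P \x P)%E _); apply/seteqP; split => -[w w'] /=.
    rewrite /xsection/= inE /skew_step/= shift_concat// /omega/= => -[h1 h2].
    by split => //; rewrite /X/= -(gc z w w').
  rewrite /xsection/= inE /skew_step/= shift_concat// /omega/= => -[h1 h2].
  by split => //; have := h1; rewrite /X/= -(gc z w w').
transitivity (\int[mu]_z (Qkernel P Pt Phi 1 z A * P B))%E.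
  rewrite /product_measure1; apply: eq_integral => z _ /=.
  rewrite key; congr (_ * _)%E.
  rewrite /Qkernel.
  transitivity (\int[P]_w (\1_(X z) w)%:E)%E.
    by rewrite integral_indic// setIT.
  by apply: eq_integral => w _; rewrite !indicE; congr (_%:R%:E);
    apply/idP/idP; rewrite !inE.
have QE z : Qkernel P Pt Phi 1 z A = P (xsection [set q : (euclid R d * noise d H) * noise d H | A (g q.1 q.2)] z).
  rewrite -XE /Qkernel; apply/esym.
  transitivity (\int[P]_w (\1_(X z) w)%:E)%E.
    by rewrite integral_indic// setIT.
  by apply: eq_integral => w _; rewrite !indicE; congr (_%:R%:E);
    apply/idP/idP; rewrite !inE.
have PB : P B \is a fin_num by exact: fin_num_measure.
rewrite -(fineK PB) ge0_integralZr//.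
- by rewrite (fineK PB) hmu.
- under eq_fun do rewrite QE.
  exact: measurable_fun_xsection.
- by move=> z _; rewrite QE.
- by rewrite lee_fin fine_ge0.
Qed.

(** * The fractional operator *)

Lemma is_derive_opp_powR (R : realType) (a r : R) : r < 0 ->
  is_derive r 1 (fun r : R => (- r) `^ a) (- (a * (- r) `^ (a - 1))).
Proof.
move=> r0.
have h1 : is_derive (- r) 1 ((@powR R)^~ a) (a * (- r) `^ (a - 1)).
  by apply: is_derive1_powR; rewrite oppr_gt0.
have h2 : is_derive r 1 (fun r : R => - r) (- 1).
  by apply: is_deriveN.
have := @is_derive1_comp _ _ (fun r : R => - r) r _ _ h1 h2.
by rewrite mulrN1.
Qed.

Lemma opp_powR_continuous (R : realType) (a r : R) : r < 0 ->
  {for r, continuous (fun r : R => (- r) `^ a)}.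
Proof.
move=> r0; have [h _] := @is_derive_opp_powR R a r r0.
by apply: differentiable_continuous; apply/derivable1_diffP.
Qed.

Lemma measurable_kernel (R : realType) (a : R) (D : set R) :
  measurable_fun D (fun r : R => (- r) `^ a).
Proof.
apply: (@measurable_funS _ _ _ _ setT) => //.
apply: (measurableT_comp (measurable_powR a)).
by apply: oppr_measurable.
Qed.

Lemma kernel_integral_segment (R : realType) (a b c : R) : -1 < a -> 0 < c < b ->
  (\int[lebesgue_measure]_(r in `[(- b)%R, (- c)%R]) (((- r) `^ a)%:E) <=
    (b `^ (a + 1) / (a + 1))%:E)%E.
Proof.
move=> a1 /andP[c0 cb]; have a10 : 0 < a + 1 by lra.
pose G (r : R) : R := - (a + 1)^-1 * (- r) `^ (a + 1).
have dG (r : R) : r < 0 -> is_derive r 1 G ((- r) `^ a).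
  move=> r0; have h := is_derive_opp_powR (a + 1) r0.
  have -> : G = (- (a + 1)^-1) *: (fun r : R => (- r) `^ (a + 1)) by [].
  apply: is_derive_eq; rewrite /GRing.scale/= addrK.
  by rewrite mulrNN mulrA mulVf ?mul1r// gt_eqF.
have cG (r : R) : r < 0 -> G x @[x --> r] --> G r.
  move=> r0; have [h _] := dG r r0.
  by apply: differentiable_continuous; apply/derivable1_diffP.
rewrite (@continuous_FTC2 _ _ G).
- rewrite -EFinB lee_fin /G !opprK.
  rewrite [leRHS]mulrC [X in _ - X]mulNr opprK gerDr mulNr oppr_le0.
  by rewrite mulr_ge0 ?powR_ge0// invr_ge0 ltW.
- by rewrite ltrN2.
- apply: continuous_in_subspaceT => r; rewrite inE/= in_itv/= => /andP[_ r1].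
  by apply: opp_powR_continuous; apply: le_lt_trans r1 _; rewrite oppr_lt0.
- split.
  + move=> r; rewrite in_itv/= => /andP[_ r1].
    have r0 : r < 0 by apply: lt_trans r1 _; rewrite oppr_lt0.
    by have [] := dG r r0.
  + by apply: cvg_at_right_filter; apply: cG; lra.
  + by apply: cvg_at_left_filter; apply: cG; lra.
- move=> r; rewrite in_itv/= => /andP[_ r1].
  have r0 : r < 0 by apply: lt_trans r1 _; rewrite oppr_lt0.
  by rewrite derive1E; have [_] := dG r r0.
Qed.

(** For a < 0 the kernel is singular at 0, so the fundamental theorem is applied on segments
    stopping short of 0 and monotone convergence exhausts the interval. *)
Lemma kernel_integral (R : realType) (a B : R) : -1 < a -> 0 < B ->
  (\int[lebesgue_measure]_(r in `[(- B)%R, 0%R[) (((- r) `^ a)%:E) <=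
    (B `^ (a + 1) / (a + 1))%:E)%E.
Proof.
move=> a1 B0.
pose S (n : nat) : set R := `[- B, - (B / n.+2%:R)]%classic.
have Sb n : 0 < B / n.+2%:R :> R by rewrite divr_gt0.
have S1 n : B / n.+2%:R < B :> R.
  by rewrite ltr_pdivrMr// ltr_pMr// ltr1n.
have US : \bigcup_n S n = `[- B, 0[%classic.
  apply/seteqP; split=> [r [n _]|r]; rewrite /S/= !in_itv/= => /andP[r1 r2].
    by rewrite r1/=; apply: le_lt_trans r2 _; rewrite oppr_lt0.
  exists (Num.truncn (B / - r)) => //; rewrite /= in_itv/= r1/= lerNr.
  have r0 : 0 < - r by rewrite oppr_gt0.
  rewrite ler_pdivrMr// mulrC -ler_pdivrMr//.
  apply/ltW; apply: lt_le_trans (truncnS_gt _) _; by rewrite ler_nat.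
have mS : {homo S : n m / (n <= m)%N >-> (n <= m)%O}.
  move=> n m nm; apply/subsetPset => r; rewrite /S/= !in_itv/= => /andP[-> r2]/=.
  apply: le_trans r2 _; rewrite lerN2 ler_wpM2l ?(ltW B0)//.
  by rewrite lef_pV2 ?posrE// ler_nat.
have h : (\int[lebesgue_measure]_(x in S i) ((- x) `^ a)%:E)%E @[i --> \oo] -->
    (\int[lebesgue_measure]_(x in `[(- B)%R, 0%R[%classic) ((- x) `^ a)%:E)%E.
  rewrite -US; apply: ge0_nondecreasing_set_cvg_integral => //.
  - by move=> i; exact: measurable_itv.
  - by move=> i; apply/measurable_EFinP; exact: measurable_kernel.
  - by move=> i x _; rewrite lee_fin powR_ge0.
rewrite -(cvg_lim _ h)//; apply: lime_le; first by apply/cvg_ex; eexists; exact: h.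
by near=> n; apply: kernel_integral_segment; rewrite ?Sb ?S1.
Unshelve. all: end_near. Qed.

Lemma kernel_integrable (R : realType) (a B D : R) (q : R -> R) :
  -1 < a -> 0 < B -> measurable_fun (`]-oo, 0[%classic : set R) q ->
  (forall r : R, r < 0 -> `|q r| <= D) -> (forall r : R, r < - B -> q r = 0) ->
  (lebesgue_measure.-integrable `]-oo, 0[
     (EFin \o (fun r : R => (- r) `^ a * q r))) /\
  `|\int[lebesgue_measure]_(r in `]-oo, 0[) ((- r) `^ a * q r)| <=
     D * (B `^ (a + 1) / (a + 1)).
Proof.
move=> a1 B0 mq qD q0; set f := fun r : R => (- r) `^ a * q r.
have D0 : 0 <= D by apply: le_trans (qD (-1) (ltrN10 R)).
have mf : measurable_fun (`]-oo, 0[%classic : set R) f.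
  by apply: measurable_funM => //; exact: measurable_kernel.
have hI : (\int[lebesgue_measure]_(r in `]-oo, 0%R[) (`|f r|%:E) <=
    (D * (B `^ (a + 1) / (a + 1)))%:E)%E.
  have -> : (\int[lebesgue_measure]_(r in `]-oo, 0%R[) (`|f r|%:E) =
      \int[lebesgue_measure]_(r in `[(- B)%R, 0%R[) (`|f r|%:E))%E.
    rewrite integral_mkcond [RHS]integral_mkcond; apply: eq_integral => r _.
    rewrite !patchE; case: ifPn; case: ifPn => //; rewrite !inE/= !notin_setE/= !in_itv/=.
      move=> /negP; rewrite negb_and -leNgt -ltNge => /orP[rB r0|/le_lt_trans h /h].
        by rewrite /f q0// mulr0 normr0.
      by rewrite ltxx.
    by move=> /andP[_ ->].
  apply: (@le_trans _ _ (\int[lebesgue_measure]_(r in `[(- B)%R, 0%R[) (D%:E * ((- r) `^ a)%:E))%E).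
    apply: ge0_le_integral => //.
    - apply/measurable_EFinP; apply: measurableT_comp => //.
      by apply: measurable_funS mf => // r /=; rewrite !in_itv/= => /andP[].
    - by apply/measurable_EFinP; apply: measurable_funM => //; exact: measurable_kernel.
    - move=> r /=; rewrite in_itv/= => /andP[_ r0].
      rewrite -EFinM lee_fin normrM ger0_norm ?powR_ge0// mulrC ler_wpM2r ?powR_ge0//.
      exact: qD.
  rewrite ge0_integralZl_EFin//.
  - by rewrite EFinM lee_wpmul2l ?lee_fin// kernel_integral.
  - by move=> r _; rewrite lee_fin powR_ge0.
  - by apply/measurable_EFinP; exact: measurable_kernel.
have If : lebesgue_measure.-integrable `]-oo, 0[ (EFin \o f).
  apply/integrableP; split; first exact/measurable_EFinP.
  by apply: le_lt_trans hI _; rewrite ltry.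
split=> //; apply: le_trans (le_normr_Rintegral _ If) _ => //.
rewrite /Rintegral -lee_fin fineK//.
rewrite ge0_fin_numE; first by apply: le_lt_trans hI _; rewrite ltry.
exact: integral_ge0.
Qed.

(** Models the derivative of a coordinate of a smooth path. The differences p(t + r) - p(r) are then
    bounded near the singularity r = 0 and vanish for r < -A, so the fractional integral
    converges. *)
Definition profile (R : realType) (A L : R) (p : R -> R) : Prop :=
  [/\ 0 < A, 0 <= L, continuous p, forall r : R, r <= - A -> p r = 0 &
      forall r s : R, r <= 0 -> s <= 0 -> `|p r - p s| <= L * `|r - s|].

Lemma C0infty_profile (R : realType) (d : nat) (f : R -> 'cV[R]_d) (i : 'I_d) :
  C0infty f -> exists A L p, profile A L p /\
    forall r : R, r < 0 -> is_derive r 1 (fun u => f u i 0) (p r).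
Proof.
move=> [f0 [g sg fg] [M fM]].
pose p : R -> R := derive1 (fun u => g u i 0).
pose A : R := `|M| + 1.
have A0 : 0 < A by rewrite ltr_wpDl.
have dp (r : R) : derivable p r 1 by have := sg i 1%N r; rewrite derive1n1.
have ddp (t : R) : derivable (derive1 p) t 1.
  by have := sg i 2%N t; rewrite derive1nS derive1n1.
have cp (r : R) : {for r, continuous p}.
  by apply: differentiable_continuous; apply/derivable1_diffP.
have fp (r : R) : r < 0 -> is_derive r 1 (fun u => f u i 0) (p r).
  move=> r0; rewrite /p derive1E.
  have E : \forall u \near r, (fun u => g u i 0) u = (fun u => f u i 0) u.
    by near=> u; rewrite /= fg//; apply/ltW; near: u; exact: lt_nbhsl.
  apply: (@near_eq_is_derive _ _ _ _ _ _ _ _ E).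
  split=> //.
    by have := sg i 0%N r; rewrite derive1n0.
have pA (r : R) : r <= - A -> p r = 0.
  move=> rA; have r0 : r < 0 by lra.
  have [_ <-] := fp r r0.
  have rM : r < M.
    have : - M <= `|M| by rewrite -normrN ler_norm.
    by move: rA; rewrite /A; lra.
  rewrite (@near_eq_derive _ _ _ _ (cst 0)) ?derive_cst//.
  by near=> u; rewrite /= fM ?mxE//; apply/ltW; near: u; exact: lt_nbhsl.
clearbody p.
have [c _ hc] : exists2 c : R, c \in `[- A, 0] & forall t : R, t \in `[- A, 0] ->
    `|derive1 p t| <= `|derive1 p c|.
  apply: (@EVT_max _ (fun t => `|derive1 p t|)); first by lra.
  apply: continuous_subspaceT => t; apply: continuous_comp; last exact: norm_continuous.
  by apply: differentiable_continuous; apply/derivable1_diffP.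
exists A, `|derive1 p c|, p; split=> //; split=> // r s.
wlog rs : r s / r <= s.
  move=> hw r0 s0; have [rs|/ltW rs] := leP r s; first exact: hw.
  by rewrite distrC (distrC r); exact: hw.
move=> r0 s0.
have mid (a b : R) : - A <= a -> a <= b -> b <= 0 ->
    `|p a - p b| <= `|derive1 p c| * `|a - b|.
  move=> Aa ab b0.
  have [|||x] := @MVT_segment R p (derive1 p) a b.
  - by [].
  - by move=> x _; split; rewrite ?derive1E.
  - by apply: derivable_within_continuous.
  rewrite in_itv/= => /andP[c1 c2] E.
  rewrite distrC E normrM (distrC b) ler_wpM2r//.
  by apply: hc; rewrite in_itv/= (le_trans Aa c1) (le_trans c2 b0).
have [Ar|/ltW rA] := leP (- A) r; first exact: mid.
have [sA|/ltW As] := leP s (- A).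
  by rewrite !pA// subrr normr0 mulr_ge0.
rewrite pA//.
have := mid (- A) s (lexx _) As s0; rewrite pA// => /le_trans; apply.
by rewrite ler_wpM2l// !ler0_norm; lra.
Unshelve. all: end_near. Qed.

(* Up to the factor [alphaH], this is the operator D_H applied to a path with
   derivative [p]. *)
Definition fracJ (R : realType) (a : R) (p : R -> R) (t : R) : R :=
  \int[lebesgue_measure]_(r in `]-oo, 0[) ((- r) `^ a * (p (t + r) - p r)).

Lemma profile_measurable (R : realType) (A L : R) (p : R -> R) (b c : R)
  (D : set R) :
  profile A L p -> measurable_fun D (fun r => p (b * r + c)).
Proof.
move=> [_ _ cp _ _]; apply: (@measurable_funS _ _ _ _ setT) => //.
apply: continuous_measurable_fun => r.
apply: continuous_comp; last exact: cp.
by apply: cvgD; [apply: cvgM; [exact: cvg_cst|exact: cvg_id]|exact: cvg_cst].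
Qed.

Lemma fracJ_integrable (R : realType) (a A L : R) (p : R -> R) (t : R) :
  -1 < a -> profile A L p -> t <= 0 ->
  lebesgue_measure.-integrable `]-oo, 0[
     (EFin \o (fun r : R => (- r) `^ a * (p (t + r) - p r))).
Proof.
move=> a1 hp t0; have [A0 L0 _ pA pL] := hp.
apply: (proj1 (@kernel_integrable _ a A (L * `|t|) (fun r => p (t + r) - p r)
  a1 A0 _ _ _)).
- apply: measurable_funB.
  + have := @profile_measurable _ _ _ _ 1 t `]-oo, 0[ hp.
    by under [X in measurable_fun _ X -> _]eq_fun do rewrite mul1r addrC.
  + have := @profile_measurable _ _ _ _ 1 0 `]-oo, 0[ hp.
    by under [X in measurable_fun _ X -> _]eq_fun do rewrite mul1r addr0.
- move=> r r0; apply: le_trans (pL _ _ _ _) _; [lra|lra|].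
  by rewrite addrK.
- by move=> r rA; rewrite !pA ?subrr//; lra.
Qed.

Lemma DH_frac (R : realType) (d : nat) (H A L : R)
    (DH : noise d H -> noise d (1 - H))
    (w : noise d H) (i : 'I_d) (p : R -> R) (t : R) :
  0 < H -> is_DH DH -> C0infty (val w) -> profile A L p ->
  (forall r : R, r < 0 -> is_derive r 1 (fun u => val w u i 0) (p r)) ->
  t <= 0 ->
  val (DH w) t i 0 = (alphaH H)^-1 * fracJ (H - 2^-1) p t.
Proof.
move=> H0 [_ hDH] cw hp wp t0; rewrite hDH//; congr (_ * _).
have a1 : -1 < H - 2^-1 by lra.
have If := fracJ_integrable a1 hp t0.
have E : {in (`]-oo, 0[%classic : set R), (fun r : R => (- r) `^ (H - 2^-1) *
            (derive1 (fun u : R => val w u i 0) (t + r)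
             - derive1 (fun u : R => val w u i 0) r)) =1
    (fun r : R => (- r) `^ (H - 2^-1) * (p (t + r) - p r))}.
  move=> r; rewrite inE/= in_itv/= => r0; congr (_ * (_ - _)).
    by rewrite derive1E; have [|_ ->] := wp (t + r); first lra.
  by rewrite derive1E; have [_ ->] := wp r r0.
rewrite -Rintegral_itv_bndo_bndc; first exact: eq_Rintegral.
apply: eq_integrable If => // r r0; rewrite /=; congr (_%:E).
exact/esym/E.
Qed.

Lemma alphaH_ge0 (R : realType) (H : R) : 0 <= (alphaH H)^-1.
Proof. by rewrite invr_ge0 sqrtr_ge0. Qed.

Definition cutoff_profile (R : realType) (tau M : R) (p : R -> R) : R -> R :=
  fun r => p (r - tau) - M^-1 * p (M^-1 * r - tau).

Lemma cutoff_profileP (R : realType) (A L tau M : R) (p : R -> R) :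
  0 <= tau -> 1 <= M -> profile A L p ->
  profile (M * A) (L + L) (cutoff_profile tau M p).
Proof.
move=> tau0 M1 [A0 L0 cp pA pL].
have M0 : 0 < M by apply: lt_le_trans M1.
have Mi0 : 0 < M^-1 by rewrite invr_gt0.
have Mi1 : M^-1 <= 1 by rewrite invf_le1.
split.
- exact: mulr_gt0.
- exact: addr_ge0.
- move=> r; apply: cvgB.
    apply: continuous_comp; last exact: cp.
    by apply: cvgB; [exact: cvg_id|exact: cvg_cst].
  apply: cvgM; first exact: cvg_cst.
  apply: continuous_comp; last exact: cp.
  by apply: cvgB; [apply: cvgM; [exact: cvg_cst|exact: cvg_id]|exact: cvg_cst].
- move=> r rA; rewrite /cutoff_profile !pA ?mulr0 ?subrr//.
    have : M^-1 * r <= - A by rewrite ler_pdivrMl// mulrN.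
    lra.
  have : A <= M * A by rewrite ler_peMl// ltW.
  by move: rA tau0; lra.
- move=> r s r0 s0; rewrite /cutoff_profile.
  have -> : p (r - tau) - M^-1 * p (M^-1 * r - tau) -
     (p (s - tau) - M^-1 * p (M^-1 * s - tau)) =
     (p (r - tau) - p (s - tau)) - M^-1 * (p (M^-1 * r - tau) - p (M^-1 * s - tau)) by ring.
  apply: le_trans (ler_normB _ _) _; rewrite mulrDl lerD//.
    apply: le_trans (pL _ _ _ _) _; [lra|lra|].
    by rewrite opprB addrA subrK.
  have h1 : M^-1 * r <= 0 by rewrite pmulr_rle0.
  have h2 : M^-1 * s <= 0 by rewrite pmulr_rle0.
  rewrite normrM gtr0_norm//.
  apply: (@le_trans _ _ (1 * `|p (M^-1 * r - tau) - p (M^-1 * s - tau)|)).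
    by rewrite ler_wpM2r.
  rewrite mul1r; apply: le_trans (pL _ _ _ _) _; [lra|lra|].
  rewrite opprB addrA subrK -mulrBr normrM gtr0_norm// ler_wpM2l//.
  by rewrite ler_piMl.
Qed.

Lemma shift_cutoff_derive (R : realType) (d : nat) (tau M : R)
    (f : R -> 'cV[R]_d) (i : 'I_d) (p : R -> R) :
  0 <= tau -> 0 < M ->
  (forall r : R, r < 0 -> is_derive r 1 (fun u => f u i 0) (p r)) ->
  forall r : R, r < 0 ->
    is_derive r 1 (fun u => shift_cutoff tau M f u i 0) (cutoff_profile tau M p r).
Proof.
move=> tau0 M0 fp r r0.
have E : \forall u \near r, (fun u => f (u - tau) i 0 - f (M^-1 * u - tau) i 0) u =
    (fun u => shift_cutoff tau M f u i 0) u.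
  near=> u; have u0 : u <= 0 by apply/ltW; near: u; exact: lt_nbhsl.
  by rewrite /= /shift_cutoff min_l// !mxE.
apply: (@near_eq_is_derive _ _ _ _ _ _ _ _ E).
have aff (b c : R) : is_derive r 1 (fun u : R => b * u + c) b.
  have -> : (fun u : R => b * u + c) = (b *: id) + cst c.
    by apply/funext => u; rewrite fctE.
  by apply: is_derive_eq; rewrite addr0 /GRing.scale/= mulr1.
have comp (b : R) : b * r - tau < 0 ->
    is_derive r 1 (fun u => f (b * u - tau) i 0) (b * p (b * r - tau)).
  move=> br; have := @is_derive1_comp _ (fun u => f u i 0) (fun u : R => b * u - tau)
    r _ _ (fp _ br) (aff b (- tau)).
  by rewrite mulrC.
have h1 : is_derive r 1 (fun u => f (u - tau) i 0) (p (r - tau)).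
  have := comp 1; rewrite !mul1r.
  have -> : (fun u => f (1 * u - tau) i 0) = (fun u => f (u - tau) i 0).
    by apply/funext => u; rewrite mul1r.
  by apply; lra.
have h2 : is_derive r 1 (fun u => f (M^-1 * u - tau) i 0) (M^-1 * p (M^-1 * r - tau)).
  apply: comp; have : M^-1 * r < 0 by rewrite pmulr_rlt0 ?invr_gt0.
  lra.
exact: is_deriveB.
Unshelve. all: end_near. Qed.

(** The part p(r - tau) of the cutoff profile reproduces the increment of [fracJ] exactly; the slow
    return to zero is an error that vanishes as n grows whenever a < 1. *)
Lemma fracJ_cutoff (R : realType) (a A L tau t : R) (p : R -> R) :
  -1 < a -> 0 <= tau -> t <= 0 -> profile A L p ->
  exists2 C : R, 0 <= C & forall n : nat,
    `|fracJ a (cutoff_profile tau n.+1%:R p) t -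
      (fracJ a p (t - tau) - fracJ a p (- tau))| <=
    C * (n.+1%:R^-1) `^ (1 - a).
Proof.
move=> a1 tau0 t0 hp; have [A0 L0 cp pA pL] := hp.
have a10 : 0 < a + 1 by lra.
exists (L * `|t| * (A `^ (a + 1) / (a + 1))).
  by rewrite !mulr_ge0// ?powR_ge0// invr_ge0 ltW.
move=> n; set m : R := n.+1%:R^-1.
have m0 : 0 < m by rewrite invr_gt0.
have m1 : m <= 1 by rewrite invf_le1// ler1n.
(* Contribution of the slow return, to be multiplied by m: at most L m |t| on a window of length
   A/m. Against the kernel this gives order m^(2 - (a + 1)) = m^(1 - a). *)
pose q r := p (m * (t + r) - tau) - p (m * r - tau).
have [||||Iq Bq] := @kernel_integrable _ a (n.+1%:R * A) (L * (m * `|t|)) q a1.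
- by rewrite mulr_gt0.
- apply: measurable_funB.
  + have := @profile_measurable _ _ _ _ m (m * t - tau) `]-oo, 0[ hp.
    have -> : (fun r => p (m * r + (m * t - tau))) = (fun r => p (m * (t + r) - tau)).
      by apply/funext => r; congr p; ring.
    by [].
  + exact: profile_measurable hp.
- move=> r r0; have h1 : m * r <= 0 by rewrite pmulr_rle0// ltW.
  have h2 : m * t <= 0 by rewrite pmulr_rle0.
  apply: le_trans (pL _ _ _ _) _; [rewrite mulrDr; lra|lra|].
  have -> : m * (t + r) - tau - (m * r - tau) = m * t by ring.
  by rewrite normrM gtr0_norm.
- move=> r rA; have h1 : m * r <= - A.
    by rewrite ler_pdivrMl// mulrN ltW.
  have h2 : m * t <= 0 by rewrite pmulr_rle0.
  by rewrite /q !pA ?subrr// ?mulrDr; lra.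
pose kq r := (- r) `^ a * q r.
pose k1 r := (- r) `^ a * (p (t - tau + r) - p r).
pose k2 r := (- r) `^ a * (p (- tau + r) - p r).
have I1 : lebesgue_measure.-integrable `]-oo, 0[ (EFin \o k1).
  by apply: fracJ_integrable hp _ => //; lra.
have I2 : lebesgue_measure.-integrable `]-oo, 0[ (EFin \o k2).
  by apply: fracJ_integrable hp _ => //; lra.
have I12 : lebesgue_measure.-integrable `]-oo, 0[ (EFin \o (fun r => k1 r - k2 r)).
  have -> : EFin \o (fun r => k1 r - k2 r) = ((EFin \o k1) \- (EFin \o k2))%E.
    by apply/funext => r; rewrite /= EFinB.
  exact: integrableB.
have I3 : lebesgue_measure.-integrable `]-oo, 0[ (EFin \o (fun r => m * kq r)).
  have -> : EFin \o (fun r => m * kq r) = (fun r => m%:E * (kq r)%:E)%E.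
    by apply/funext => r; rewrite /= EFinM.
  exact: integrableZl Iq.
have -> : fracJ a (cutoff_profile tau n.+1%:R p) t =
    \int[lebesgue_measure]_(r in `]-oo, 0[) (k1 r - k2 r - m * kq r).
  apply: eq_Rintegral => r _; rewrite /k1 /k2 /kq /q /cutoff_profile -/m.
  have -> : t - tau + r = t + r - tau by ring.
  rewrite (addrC (- tau)); ring.
rewrite RintegralB// RintegralB// RintegralZl//.
have -> : \int[lebesgue_measure]_(x in `]-oo, 0[) k1 x = fracJ a p (t - tau) by [].
have -> : \int[lebesgue_measure]_(x in `]-oo, 0[) k2 x = fracJ a p (- tau) by [].
rewrite addrAC subrr add0r normrN normrM gtr0_norm//.
apply: le_trans (ler_wpM2l (ltW m0) Bq) _.
rewrite powRM ?(ltW A0)//.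
have -> : n.+1%:R `^ (a + 1) = m `^ (- (a + 1)) :> R.
  have mx0 : m `^ (a + 1) != 0 by rewrite powR_eq0 gt_eqF.
  apply: (mulfI mx0); rewrite powRN mulfV// -powRM ?(ltW m0)//.
  by rewrite mulVf ?pnatr_eq0// powR1.
rewrite le_eqVlt; apply/orP; left; apply/eqP.
have -> : 1 - a = 1 + (1 + - (a + 1)) by ring.
have m00 : m != 0 by rewrite gt_eqF.
have hd (x y : R) : m `^ (x + y) = m `^ x * m `^ y.
  by rewrite powRD//; apply/implyP => _.
rewrite !hd powRr1 ?(ltW m0)//; ring.
Qed.

(** A shifted smooth path need not vanish near minus infinity, so the integral formula is applied to
    [shift_cutoff] instead; continuity of [DH] at [u] removes the cutoff in the limit. *)
Lemma DH_shift_C0infty (R : realType) (d : nat) (H : R)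
    (DH : noise d H -> noise d (1 - H)) (tau : R) (u v : noise d H) :
  0 < H < 1 -> is_DH DH -> 0 <= tau -> C0infty (val v) ->
  val u = shiftp tau (val v) ->
  forall t : R, t <= 0 ->
    val (DH u) t = val (DH v) (t - tau) - val (DH v) (- tau).
Proof.
move=> H01 hDH tau0 cv uv t t0; have /andP[H0 H1] := H01.
apply/matrixP => i j; rewrite ord1 {j}.
have [A [L [p [hp vp]]]] := C0infty_profile i cv.
have a1 : -1 < H - 2^-1 by lra.
apply/eqP; rewrite -subr_eq0 -normr_le0; apply/ler_addgt0Pl => e e0; rewrite addr0.
have [C C0 hC] := fracJ_cutoff a1 tau0 t0 hp.
have th0 : 0 < 1 - (H - 2^-1) by lra.
have th0' : 0 < (1 - H) / 2 by lra.
have e20 : 0 < e / 2 by rewrite divr_gt0.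
have aC : 0 <= (alphaH H)^-1 * C by rewrite mulr_ge0 ?alphaH_ge0.
have [N1 hN1] := powR_small aC th0 e20.
have w0 : 0 < hweight (1 - H) t 0 + 1 by rewrite ltr_wpDl// hweight_ge0.
have ew : 0 < e / 2 / (hweight (1 - H) t 0 + 1) by rewrite divr_gt0.
have [delta delta0 hdelta] := hDH.1 u _ ew.
have [c c0 hc] := shift_cutoff_hbound H01 tau0 cv.
have [N2 hN2] := powR_small c0 th0' delta0.
pose n := maxn N1 N2.
have M1 : 1 <= n.+1%:R :> R by rewrite ler1n.
have cn : C0infty (shift_cutoff tau n.+1%:R (val v)) by exact: shift_cutoff_C0infty.
pose un := to_noise (C0infty_noise_paths H cn).
have : (hdist un u < delta%:E)%E.
  apply: lt_hnorm (hN2 n (leq_maxr _ _)) _.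
  have := hboundZ (-1) (hc n); rewrite normrN1 mul1r.
  apply: eq_hbound => s _; rewrite /= uv scaleN1r; by rewrite opprB.
move=> /hdelta /hdist_eval /(_ t0); set x := val (DH un) t; set y := val (DH u) t => hxy.
have hxy' : `|y i 0 - x i 0| <= e / 2.
  have := le_trans (coord_le_enorm (x - y) i) hxy; rewrite !mxE distrC => /le_trans; apply.
  rewrite mulrAC ler_pdivrMr// ler_wpM2l ?(ltW e20)//.
  by rewrite lerDl.
have Ex : x i 0 = (alphaH H)^-1 * fracJ (H - 2^-1) (cutoff_profile tau n.+1%:R p) t.
  have cn' : C0infty (val un) by exact: cn.
  apply: (DH_frac H0 hDH cn' (cutoff_profileP tau0 M1 hp)) => //.
  by apply: shift_cutoff_derive => //; apply: lt_le_trans M1.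
have tt : t - tau <= 0 by clear -t0 tau0; lra.
rewrite !mxE (DH_frac H0 hDH cv hp vp tt) (DH_frac H0 hDH cv hp vp) ?oppr_le0//.
have hx : `|x i 0 - ((alphaH H)^-1 * fracJ (H - 2^-1) p (t - tau) -
    (alphaH H)^-1 * fracJ (H - 2^-1) p (- tau))| <= e / 2.
  rewrite Ex -!mulrBr normrM (ger0_norm (alphaH_ge0 H)).
  apply: le_trans (ler_wpM2l (alphaH_ge0 H) (hC n)) _.
  by rewrite mulrA ltW// hN1// leq_maxl.
rewrite [e]splitr; apply: le_trans (lerD hxy' hx).
by apply: le_trans (ler_normD _ _); rewrite addrA subrK.
Qed.

Lemma noise_approx (R : realType) (d : nat) (H e : R) (w : noise d H) : 0 < e ->
  exists2 v : noise d H, C0infty (val v) &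
    exists2 c : R, 0 <= c < e & hbound H c (val v \- val w).
Proof.
move=> e0; have [_ /(_ e e0)[f cf /hnorm_lt[c ce hc]]] := noise_pathsP w.
exists (to_noise (C0infty_noise_paths H cf)) => //; exists c => //.
have := hboundZ (-1) hc; rewrite normrN1 mul1r.
by apply: eq_hbound => s _ /=; rewrite scaleN1r opprB.
Qed.

(** Density of smooth paths and continuity of [DH] at both [u] and [v] extend the smooth case. This
    translation rule gives fractional Brownian motion the increment relation [fbm_step]. *)
Lemma DH_shift (R : realType) (d : nat) (H : R)
    (DH : noise d H -> noise d (1 - H)) (tau : R) (u v : noise d H) :
  0 < H < 1 -> is_DH DH -> 0 <= tau ->
  (forall s : R, s <= 0 -> val u s = val v (s - tau) - val v (- tau)) ->
  forall t : R, t <= 0 ->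
    val (DH u) t = val (DH v) (t - tau) - val (DH v) (- tau).
Proof.
move=> H01 hDH tau0 uv t t0.
have uv' : val u = shiftp tau (val v).
  apply/funext => s; rewrite /shiftp; have [s0|/ltW s0] := leP s 0.
    by rewrite uv.
  by rewrite noise_ge0// sub0r subrr.
apply/eqP; rewrite -subr_eq0; apply/eqP/enorm0_eq0/eqP.
rewrite eq_le enorm_ge0 andbT; apply/ler_addgt0Pl => e e0; rewrite addr0.
pose W s := hweight (1 - H) s 0.
have W0 s : 0 <= W s by exact: hweight_ge0.
pose S := W t + W (t - tau) + W (- tau) + 1.
have S0 : 0 < S by rewrite ltr_wpDl// !addr_ge0.
have eS : 0 < e / S by rewrite divr_gt0.
have [du du0 hdu] := hDH.1 u _ eS.
have [dv dv0 hdv] := hDH.1 v _ eS.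
pose k := Num.sqrt (1 + 2 * tau).
have k0 : 0 < k by rewrite sqrtr_gt0; lra.
have [v' cv' [c /andP[c0 ce] hc]] : exists2 v' : noise d H, C0infty (val v') &
    exists2 c : R, 0 <= c < Num.min dv (du / k) & hbound H c (val v' \- val v).
  by apply: noise_approx; rewrite lt_min dv0 divr_gt0.
move: ce; rewrite lt_min => /andP[cdv cdu].
pose u' := to_noise (shift_noise_paths H01 tau0 (noise_pathsP v')).
have hv' : (hdist (DH v') (DH v) < (e / S)%:E)%E by apply: hdv; apply: lt_hnorm hc.
have hu' : (hdist (DH u') (DH u) < (e / S)%:E)%E.
  apply: hdu; apply: (@lt_hnorm _ _ _ (c * k)); first by rewrite -ltr_pdivlMr.
  apply: eq_hbound (hbound_shift tau0 c0 hc) => s s0 /=.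
  by rewrite uv' /shiftp/=; apply/matrixP => i j; rewrite !mxE; ring.
have E := DH_shift_C0infty H01 hDH tau0 cv' (erefl (val u')) t0.
have h1 := hdist_eval hu' t0.
have tt : t - tau <= 0 by clear -t0 tau0; lra.
have h2 := hdist_eval hv' tt.
have tau0' : - tau <= 0 by rewrite oppr_le0.
have h3 := hdist_eval hv' tau0'.
have -> : val (DH u) t - (val (DH v) (t - tau) - val (DH v) (- tau)) =
  - (val (DH u') t - val (DH u) t) + ((val (DH v') (t - tau) - val (DH v) (t - tau))
   - (val (DH v') (- tau) - val (DH v) (- tau))).
  by rewrite E; apply/matrixP => i j; rewrite !mxE; ring.
apply: le_trans (ler_enormD _ _) _; rewrite enormN.
apply: le_trans (lerD h1 (le_trans (ler_enormD _ _) _)) _.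
  by rewrite enormN; exact: lerD h2 h3.
rewrite -!mulrDr -[leRHS](divfK (lt0r_neq0 S0)) ler_wpM2l ?(ltW eS)//.
by rewrite /S addrA lerDl.
Qed.

(** * Homogeneity and growth of the fractional operator *)

Lemma smoothZ (R : realType) (f : R -> R) (b : R) :
  smooth f -> smooth (fun t => b * f t).
Proof.
move=> sf.
have E n : derive1n n (fun t => b * f t) = b *: derive1n n f.
  elim: n => [|n IHn]; first by rewrite !derive1n0.
  rewrite !derive1nS IHn; apply/funext => t; rewrite !derive1E.
  by rewrite (deriveZ _ (sf n t)) -derive1E.
by move=> n t; rewrite E; apply: derivableZ.
Qed.

Lemma C0inftyZ (R : realType) (d : nat) (f : R -> 'cV[R]_d) (b : R) :
  C0infty f -> C0infty (fun t => b *: f t).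
Proof.
move=> [f0 [g sg fg] [M fM]]; split.
- by move=> t t0; rewrite f0// scaler0.
- exists (fun t => b *: g t); last by move=> t t0; rewrite fg.
  move=> i; have -> : (fun u => (b *: g u) i 0) = (fun u => b * g u i 0).
    by apply/funext => u; rewrite mxE.
  by apply: (@smoothZ _ (fun u => g u i 0)); exact: sg.
- by exists M => t tM; rewrite fM// scaler0.
Qed.

Lemma DH_scale (R : realType) (d : nat) (H b : R)
    (DH : noise d H -> noise d (1 - H)) (v w : noise d H) :
  0 < H -> is_DH DH -> C0infty (val v) -> val w = (fun t => b *: val v t) ->
  forall t : R, t <= 0 -> val (DH w) t = b *: val (DH v) t.
Proof.
move=> H0 hDH cv wv t t0; apply/matrixP => i j; rewrite ord1 mxE {j}.
have [A [L [p [hp vp]]]] := C0infty_profile i cv.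
have cw : C0infty (val w) by rewrite wv; exact: C0inftyZ.
have a1 : -1 < H - 2^-1 by lra.
rewrite (DH_frac H0 hDH cv hp vp)//.
have hbp : profile A (`|b| * L) (fun r => b * p r).
  have [A0 L0 cp pA pL] := hp; split=> //; first exact: mulr_ge0.
  - by move=> r; apply: cvgM; [exact: cvg_cst|exact: cp].
  - by move=> r rA; rewrite pA// mulr0.
  - by move=> r s r0 s0; rewrite -mulrBr normrM -mulrA ler_wpM2l// pL.
have wp (r : R) : r < 0 -> is_derive r 1 (fun u => val w u i 0) (b * p r).
  move=> r0; rewrite wv.
  have -> : (fun u => (b *: val v u) i 0) = b *: (fun u => val v u i 0).
    by apply/funext => u; rewrite mxE.
  have [h1 h2] := vp r r0; split; first exact: derivableZ.
  by rewrite deriveZ// h2.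
rewrite (DH_frac H0 hDH cw hbp wp)//.
rewrite mulrCA; congr (_ * _).
rewrite /fracJ -RintegralZl//; last exact: fracJ_integrable hp t0.
by apply: eq_Rintegral => r _; ring.
Qed.

(* Linearity on smooth paths turns the continuity at the origin into a global
   bound, which extends by density. *)
Lemma DH_growth (R : realType) (d : nat) (H : R)
    (DH : noise d H -> noise d (1 - H)) :
  0 < H < 1 -> is_DH DH ->
  exists2 C : R, 0 <= C & forall w : noise d H, hn (DH w) <= C * (1 + hn w).
Proof.
move=> H01 hDH; have /andP[H0 H1] := H01.
have H01' : 0 < 1 - H < 1 by apply/andP; split; lra.
have [v0 cv0 _] := @noise_approx R d H 1 point ltr01.
(* The zero path, written as 0 times a smooth path so that [DH_scale] shows that its image is 0. *)
pose z := to_noise (C0infty_noise_paths H (C0inftyZ 0 cv0)).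
have z0 t : val z t = 0 by rewrite /= scale0r.
have D0 t : t <= 0 -> val (DH z) t = 0.
  by move=> t0; rewrite (DH_scale H0 hDH cv0 (erefl (val z)) t0) scale0r.
have [delta delta0 hdelta] := hDH.1 z 1 ltr01.
have small (v : noise d H) (c : R) : c < delta -> hbound H c (val v) ->
    hbound (1 - H) 1 (val (DH v)).
  move=> cd hv; have : (hdist (DH v) (DH z) < 1%:E)%E.
    apply: hdelta; apply: lt_hnorm cd _; apply: eq_hbound hv => t _.
    by rewrite /= scale0r subr0.
  move=> /hnorm_lt[b /andP[_ b1] hb]; apply: (hboundW (ltW b1)).
  by apply: eq_hbound hb => t t0 /=; rewrite D0// subr0.
have smooth_growth (v : noise d H) : C0infty (val v) ->
    hn (DH v) <= 2 / delta * (1 + hn v).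
  move=> cv; have v1 : 0 < 1 + hn v by rewrite ltr_wpDr// hn_ge0.
  (* Dividing [v] by this b brings its norm below delta, where [small] applies; homogeneity then
     returns the factor b. *)
  have [b bE] : {b | b = 2 / delta * (1 + hn v)} by eexists.
  have b0 : 0 < b by rewrite bE mulr_gt0 ?divr_gt0.
  rewrite -bE.
  have bi0 : 0 < b^-1 by rewrite invr_gt0.
  pose v' := to_noise (C0infty_noise_paths H (C0inftyZ b^-1 cv)).
  have hv' : hbound (1 - H) 1 (val (DH v')).
    apply: (@small _ (`|b^-1| * hn v)); last exact: hboundZ (hn_bound v H01).
    rewrite gtr0_norm// ltr_pdivrMl// bE.
    have -> : 2 / delta * (1 + hn v) * delta = 2 * (1 + hn v).
      by field; rewrite gt_eqF.
    by have := hn_ge0 v; lra.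
  apply: hn_le => //; have := hboundZ b hv'; rewrite gtr0_norm// mulr1.
  apply: eq_hbound => t t0; rewrite (DH_scale H0 hDH cv (erefl (val v')) t0).
  rewrite scalerA mulfV; last by rewrite gt_eqF.
  exact: scale1r.
exists (1 + 2 / delta * 2); first by rewrite addr_ge0// mulr_ge0// divr_ge0// ltW.
move=> w; have w0 := hn_ge0 w.
have [dw dw0 hdw] := hDH.1 w 1 ltr01.
have [v cv [c /andP[c0]]] : exists2 v : noise d H, C0infty (val v) &
    exists2 c : R, 0 <= c < Num.min dw 1 & hbound H c (val v \- val w).
  by apply: noise_approx; rewrite lt_min dw0 ltr01.
rewrite lt_min => /andP[cdw c1] hc.
have hv : hn v <= 1 + hn w.
  apply: hn_le => //; apply: (@hboundW _ _ _ (c + hn w)); first by lra.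
  by apply: eq_hbound (hboundD hc (hn_bound w H01)) => t _ /=; rewrite subrK.
have : (hdist (DH v) (DH w) < 1%:E)%E by apply: hdw; apply: lt_hnorm hc.
move=> /hnorm_lt[b /andP[b0 b1] hb].
have hw : hn (DH w) <= hn (DH v) + b.
  apply: hn_le => //; apply: eq_hbound (hboundB (hn_bound (DH v) H01') hb) => t _ /=.
  by rewrite opprB addrC subrK.
have := smooth_growth v cv; set K := 2 / delta => h.
have K0 : 0 <= K by rewrite divr_ge0 ?(ltW delta0).
have h' : K * (1 + hn v) <= K * (2 * (1 + hn w)).
  by rewrite ler_wpM2l//; move: (hn v) (hn w) w0 hv; clear => a b; lra.
have -> : (1 + K * 2) * (1 + hn w) = 1 + hn w + K * (2 * (1 + hn w)) by ring.
move: h h' hw b1 w0; move: (hn w) (hn (DH v)) (hn (DH w)) (K * (1 + _)) (K * (2 * _)).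
by clear => x y a1 a2 a3; lra.
Qed.

(** * Cocycle property *)

Definition noise_step (R : realType) (d : nat) (H : R) (H01 : 0 < H < 1)
    (Pt : R -> noise d H * noise d H -> noise d H)
    (w : noise d H * noise d H) : noise d H * noise d H :=
  (Pt 1 w, shift_noise H01 w.2).

Lemma update_step (R : realType) (d : nat) (H : R) (H01 : 0 < H < 1)
    (Pt : R -> noise d H * noise d H -> noise d H) (t : R) w :
  is_noise_update Pt -> 0 <= t -> Pt t (noise_step H01 Pt w) = Pt (t + 1) w.
Proof.
move=> hPt t0; apply: noise_ext => s s0.
have [h1 h2] := hPt t (noise_step H01 Pt w) t0.
have [h3 h4] := hPt (t + 1) w ltac:(lra).
have [h5 h6] := hPt 1 w ltac:(lra).
have hs (u : R) : u <= 0 -> val (shift_noise H01 w.2) u = val w.2 (u - 1) - val w.2 (- 1).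
  by move=> u0; rewrite /= /shiftp min_l.
have [ts|st] := leP (- t) s.
  have tt : - t <= s <= 0 by rewrite ts.
  have tt' : - (t + 1) <= s <= 0 by apply/andP; split; lra.
  rewrite h1// h3// [noise_step _ _ _]lock -lock /noise_step hs; last by lra.
  rewrite hs; last by lra.
  have -> : - s - t - 1 = - s - (t + 1) by ring.
  have -> : - t - 1 = - (t + 1) by ring.
  by rewrite opprB addrA subrK.
rewrite h2 ?(ltW st)// hs; last by lra.
have Et : - t - 1 = - (t + 1) by ring.
have [s1|s1] := leP (- (t + 1)) s.
  have tt : -1 <= s + t <= 0 by apply/andP; split; lra.
  have tt' : - (t + 1) <= s <= 0 by apply/andP; split.
  rewrite h3// [val _ (s + t)](h5 (s + t) tt) Et opprB addrA subrK.
  by congr (val w.2 _ - _); ring.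
rewrite h4 ?(ltW s1)// [val _ (s + t)](h6 (s + t)); last by lra.
by rewrite Et opprB addrA subrK addrA.
Qed.

(** The noise updated by 1 is the noise updated by t + 1, shifted back by t; [DH_shift] with tau = t
    carries this over to the fractional noise. *)
Lemma fbm_step (R : realType) (d : nat) (H : R) (H01 : 0 < H < 1)
    (Pt : R -> noise d H * noise d H -> noise d H)
    (DH : noise d H -> noise d (1 - H)) (t : R) w :
  is_noise_update Pt -> is_DH DH -> 0 <= t ->
  fbm Pt DH (t + 1) w = fbm Pt DH 1 w + fbm Pt DH t (noise_step H01 Pt w).
Proof.
move=> hPt hDH t0; rewrite /fbm update_step//.
have [h3 h4] := hPt (t + 1) w ltac:(lra).
have [h5 h6] := hPt 1 w ltac:(lra).
rewrite (@DH_shift _ _ _ DH t (Pt 1 w) (Pt (t + 1) w) H01 hDH t0) ?lerN10//.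
  have -> : - (t + 1) = -1 - t by ring.
  by apply/matrixP => i j; rewrite !mxE; ring.
move=> s s0; rewrite [X in _ - X]h3; last by apply/andP; split; lra.
have -> : - - t - (t + 1) = -1 by ring.
have [s1|s1] := leP (-1) s.
  rewrite h5 ?s1// h3; last by apply/andP; split; lra.
  have -> : - (s - t) - (t + 1) = - s - 1 by ring.
  by rewrite opprB addrA subrK.
rewrite h6 ?(ltW s1)// h4; last by lra.
have -> : s - t + (t + 1) = s + 1 by ring.
by rewrite opprB addrA subrK.
Qed.

(** Compares primitives instead of changing variables: s -> G(s + 1) - G1(s) has zero derivative and
    is therefore constant on [0, t]. *)
Lemma Rintegral_shift (R : realType) (f : R -> R) (t : R) :
  continuous f -> 0 <= t ->
  \int[lebesgue_measure]_(s in `[0, t + 1]) f s =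
  \int[lebesgue_measure]_(s in `[0, 1]) f s +
  \int[lebesgue_measure]_(s in `[0, t]) f (s + 1).
Proof.
move=> cf t0; have [G [dG hG]] := antiderivative cf.
have cf1 : continuous (fun s : R => f (s + 1)).
  move=> s; apply: continuous_comp; last exact: cf.
  by apply: cvgD; [exact: cvg_id|exact: cvg_cst].
have [G1 [dG1 hG1]] := antiderivative cf1.
rewrite hG; last by lra.
rewrite hG// hG1//.
have [<-|tn0] := eqVneq 0 t; first by rewrite add0r; ring.
have tp : 0 < t by rewrite lt_neqAle tn0.
pose D (s : R) : R := G (s + 1) - G1 s.
have dD (s : R) : -1 < s -> is_derive s 1 D 0.
  move=> s1.
  have h1 : is_derive (s + 1) 1 G (f (s + 1)) by apply: dG; lra.
  have h2 : is_derive s 1 (fun s : R => s + 1) 1.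
    have -> : (fun s : R => s + 1) = id + cst 1 by apply/funext => u; rewrite fctE.
    by apply: is_derive_eq; rewrite addr0.
  have h3 := @is_derive1_comp _ _ (fun s : R => s + 1) s _ _ h1 h2.
  have h4 := dG1 s s1.
  have := @is_deriveB _ _ _ _ _ _ _ _ _ h3 h4.
  by rewrite mulr1 subrr.
have [|||c _] := @MVT_segment R D (fun=> 0) 0 t.
- exact: ltW.
- by move=> s; rewrite in_itv/= => /andP[s0 _]; apply: dD; lra.
- apply: derivable_within_continuous => s; rewrite in_itv/= => /andP[s0 _].
  by have [] := dD s ltac:(lra).
rewrite mul0r /D add0r => E.
have -> : G (t + 1) = G1 t + (G 1 - G1 0) + (G (t + 1) - G1 t - (G 1 - G1 0)) by ring.
by rewrite E; ring.
Qed.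

Definition dissipative_flow (R : realType) (d : nat) (H : R)
    (F : 'cV[R]_d -> 'cV[R]_d) (sigma : 'M[R]_d)
    (Pt : R -> noise d H * noise d H -> noise d H)
    (DH : noise d H -> noise d (1 - H))
    (Phi : R -> noise d H * noise d H -> 'cV[R]_d -> 'cV[R]_d) : Prop :=
  [/\ assumption_D H F, holder_derivative F, is_noise_update Pt, is_DH DH &
      is_flow F sigma (fbm Pt DH) Phi].

(** The orbit seen from time 1 solves the equation driven by the shifted noise, by [fbm_step] and
    [Rintegral_shift]; uniqueness concludes. *)
Lemma flow_step (R : realType) (d : nat) (H : R) (H01 : 0 < H < 1)
    (F : 'cV[R]_d -> 'cV[R]_d) (sigma : 'M[R]_d)
    (Pt : R -> noise d H * noise d H -> noise d H)
    (DH : noise d H -> noise d (1 - H))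
    (Phi : R -> noise d H * noise d H -> 'cV[R]_d -> 'cV[R]_d) :
  dissipative_flow F sigma Pt DH Phi ->
  forall (t : R) w x, 0 <= t ->
    Phi (t + 1) w x = Phi t (noise_step H01 Pt w) (Phi 1 w x).
Proof.
move=> [hD hF hPt hDH hPhi] t w x t0.
have [C [K [n [C0 hC dF _ _]]]] := assumption_D_bounds hD.
pose X s := Phi (Num.max 0 s + 1) w x.
have hX : is_solution F (fun s => sigma *m fbm Pt DH s (noise_step H01 Pt w)) t (Phi 1 w x) X.
  have [cX _] := flow_solution dF hPhi w x t.
  split.
    move=> i s; rewrite /X.
    have -> : (fun s : R => F (Phi (Num.max 0 s + 1) w x) i 0) =
        (fun s : R => F (Phi (Num.max 0 s) w x) i 0) \o (fun s : R => Num.max 0 s + 1).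
      apply/funext => u /=; congr (F (Phi _ w x) i 0).
      by rewrite [RHS]max_r// addr_ge0// le_max lexx.
    apply: continuous_comp; last exact: cX.
    apply: cvgD; last exact: cvg_cst.
    apply/cvgrPdist_lt => e e0; near=> u.
    apply: (@le_lt_trans _ _ `|s - u|); last by near: u; exact: cvgr_dist_lt.
    have h1 := ler_norm (s - u); have h2 := ler_norm (u - s).
    rewrite distrC in h2; have h3 := normr_ge0 (s - u).
    move: `|s - u| h1 h2 h3 => a h1 h2 h3; rewrite ler_norml.
    by case: (leP 0 s) => s0; case: (leP 0 u) => u0; apply/andP; split; lra.
  move=> s i /andP[s0 st].
  have [_ eP] := hPhi w x.
  have e1 := eP (s + 1) ltac:(lra); have e2 := eP 1 ler01.
  rewrite /X (max_r s0) e1 e2 (fbm_step H01 w hPt hDH s0) mulmxDr !mxE.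
  have EF (u : R) : 0 <= u -> \int[lebesgue_measure]_(s in `[0, u]) (F (Phi s w x) i 0)
     = \int[lebesgue_measure]_(s in `[0, u]) F (Phi (Num.max 0 s) w x) i 0.
    move=> u0; apply: eq_Rintegral => r; rewrite inE/= in_itv/= => /andP[r0 _].
    by rewrite max_r.
  rewrite !EF//; last by lra.
  rewrite (Rintegral_shift (cX i) s0).
  have -> : \int[lebesgue_measure]_(r in `[0, s]) F (Phi (Num.max 0 (r + 1)) w x) i 0 =
      \int[lebesgue_measure]_(r in `[0, s]) F (Phi (Num.max 0 r + 1) w x) i 0.
    apply: eq_Rintegral => r; rewrite inE/= in_itv/= => /andP[r0 _].
    by rewrite (max_r r0) max_r// addr_ge0.
  by ring.
have h2 := flow_solution dF hPhi (noise_step H01 Pt w) (Phi 1 w x) t.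
have := solution_contract (ltW C0) hC hX h2 (t := t).
rewrite t0 lexx => /(_ isT).
rewrite /X !max_r// subrr enorm0 mulr0 => h; apply/subr0_eq/enorm0_eq0.
by apply/eqP; rewrite eq_le h enorm_ge0.
Unshelve. all: end_near. Qed.

Lemma flow0 (R : realType) (d : nat) (H : R)
    (F : 'cV[R]_d -> 'cV[R]_d) (sigma : 'M[R]_d)
    (Pt : R -> noise d H * noise d H -> noise d H)
    (DH : noise d H -> noise d (1 - H))
    (Phi : R -> noise d H * noise d H -> 'cV[R]_d -> 'cV[R]_d) w x :
  is_flow F sigma (fbm Pt DH) Phi -> Phi 0 w x = x.
Proof.
move=> hPhi; have [_ /(_ 0 (lexx 0)) ->] := hPhi w x.
rewrite /fbm oppr0 noise_ge0// oppr0 mulmx0 addr0.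
apply/matrixP => i j; rewrite !mxE ord1.
by rewrite set_itv1 Rintegral_set1 addr0.
Qed.

Lemma flow_cocycle (R : realType) (d : nat) (H : R) (H01 : 0 < H < 1)
    (F : 'cV[R]_d -> 'cV[R]_d) (sigma : 'M[R]_d)
    (Pt : R -> noise d H * noise d H -> noise d H)
    (DH : noise d H -> noise d (1 - H))
    (Phi : R -> noise d H * noise d H -> 'cV[R]_d -> 'cV[R]_d) :
  dissipative_flow F sigma Pt DH Phi ->
  forall n (t : R) w x, 0 <= t ->
    Phi (n%:R + t) w x = Phi t (iter n (noise_step H01 Pt) w) (Phi n%:R w x).
Proof.
move=> hf; have [_ _ _ _ hPhi] := hf.
elim=> [|n IHn] t w x t0; first by rewrite add0r (flow0 _ _ hPhi).
rewrite -natr1 addrAC (flow_step H01 hf) ?addr_ge0//.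
by rewrite [LHS]IHn// iterSr (flow_step H01 hf).
Qed.

Lemma omega_iter (R : realType) (d : nat) (H : R) (H01 : 0 < H < 1)
    (Pt : R -> noise d H * noise d H -> noise d H)
    (Phi : R -> noise d H * noise d H -> 'cV[R]_d -> 'cV[R]_d) n z :
  omega (iter n (skew_step H01 Pt Phi) z) = iter n (noise_step H01 Pt) (omega z).
Proof. by elim: n => // n IHn; rewrite !iterS -IHn. Qed.

Lemma skew_iter (R : realType) (d : nat) (H : R) (H01 : 0 < H < 1)
    (F : 'cV[R]_d -> 'cV[R]_d) (sigma : 'M[R]_d)
    (Pt : R -> noise d H * noise d H -> noise d H)
    (DH : noise d H -> noise d (1 - H))
    (Phi : R -> noise d H * noise d H -> 'cV[R]_d -> 'cV[R]_d) :
  dissipative_flow F sigma Pt DH Phi ->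
  forall n z, (iter n (skew_step H01 Pt Phi) z).1.1 = Phi n%:R (omega z) z.1.1.
Proof.
move=> hf n z; have [_ _ _ _ hPhi] := hf.
elim: n => [|n IHn]; first by rewrite (flow0 _ _ hPhi).
rewrite iterS /skew_step -/(skew_step H01 Pt Phi) [LHS]/= IHn omega_iter.
by rewrite -(flow_cocycle H01 hf)// natr1.
Qed.

(** * Growth along orbits *)

(** Here 1 + |s| + |t| <= 3 + |s'| + |t'| <= 4 (1 + |s'| + |t'|), and the square root of 4 gives the
    factor. *)
Lemma hweight_le2 (R : realType) (H s t s' t' : R) : 0 < H < 1 ->
  `|s| <= `|s'| + 1 -> `|t| <= `|t'| + 1 -> `|s - t| <= `|s' - t'| ->
  hweight H s t <= 2 * hweight H s' t'.
Proof.
move=> /andP[H0 H1] hs ht hst; rewrite mulrA; apply: ler_pM.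
- exact: sqrtr_ge0.
- exact: powR_ge0.
- have -> : (2 : R) = Num.sqrt (2 ^+ 2) by rewrite sqrtr_sqr ger0_norm.
  rewrite -sqrtrM ?exprn_ge0//; apply: ler_wsqrtr.
  by have := normr_ge0 s'; have := normr_ge0 t'; lra.
- by apply: ge0_ler_powR; rewrite ?nnegrE//; lra.
Qed.

Lemma update_hn (R : realType) (d : nat) (H : R)
    (Pt : R -> noise d H * noise d H -> noise d H) (t : R) w :
  0 < H < 1 -> is_noise_update Pt -> 0 <= t <= 1 ->
  hn (Pt t w) <= 2 * (hn w.1 + hn w.2).
Proof.
move=> H01 hPt /andP[t0 t1]; apply: hn_le => //.
have [h1 h2] := hPt t w t0.
(* The weight is taken at an auxiliary pair [s'], [u'], so that both pieces of a pair straddling -t,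
   where old and new noise are glued, can be measured against the weight of the whole pair. *)
have near (s u s' u' : R) : - t <= s <= 0 -> - t <= u <= 0 -> `|s - u| <= `|s' - u'| ->
    enorm (val (Pt t w) s - val (Pt t w) u) <= 2 * hn w.2 * hweight H s' u'.
  move=> st ut su; rewrite !h1// opprB addrA subrK.
  case/andP: st => st s0; case/andP: ut => ut u0.
  apply: le_trans (hn_bound w.2 H01 _ _) _; [lra|lra|].
  rewrite (mulrC 2) -mulrA ler_wpM2l ?hn_ge0//; apply: hweight_le2 => //.
  - by rewrite ler0_norm; have := normr_ge0 s'; lra.
  - by rewrite ler0_norm; have := normr_ge0 u'; lra.
  - have -> : - s - t - (- u - t) = u - s by ring.
    by rewrite distrC.
have far (s u s' u' : R) : s <= - t -> u <= - t -> `|s - u| <= `|s' - u'| ->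
    `|s| <= `|s'| + 1 -> `|u| <= `|u'| + 1 ->
    enorm (val (Pt t w) s - val (Pt t w) u) <= 2 * hn w.1 * hweight H s' u'.
  move=> st ut su s's u'u; rewrite !h2// opprB addrA subrK.
  apply: le_trans (hn_bound w.1 H01 _ _) _; [lra|lra|].
  rewrite (mulrC 2) -mulrA ler_wpM2l ?hn_ge0//; apply: hweight_le2 => //.
  - by apply: le_trans s's; rewrite !ler0_norm; lra.
  - by apply: le_trans u'u; rewrite !ler0_norm; lra.
  - by have -> : s + t - (u + t) = s - u by ring.
have mixed (s u : R) : s <= 0 -> u <= 0 -> s <= u ->
    enorm (val (Pt t w) s - val (Pt t w) u) <= 2 * (hn w.1 + hn w.2) * hweight H s u.
  move=> s0 u0 su; rewrite mulrDr mulrDl.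
  have [st|/ltW st] := leP s (- t); last first.
    apply: (le_trans (near s u s u _ _ (lexx _))); rewrite ?lerDr ?mulr_ge0 ?hn_ge0 ?hweight_ge0//.
      by rewrite st s0.
    by apply/andP; split; lra.
  have [ut|/ltW ut] := leP u (- t).
    apply: (le_trans (far s u s u _ _ (lexx _) _ _)); rewrite ?lerDl ?mulr_ge0 ?hn_ge0 ?hweight_ge0//.
  rewrite -(subrK (val (Pt t w) (- t)) (val (Pt t w) s)) -addrA.
  apply: le_trans (ler_enormD _ _) _; apply: lerD.
    apply: far => //; rewrite ?lerDl//.
      by rewrite !ler0_norm; lra.
    by rewrite (ler0_norm (x := - t)); have := normr_ge0 u; lra.
  apply: near; [by apply/andP; split; lra|by apply/andP; split; lra|].
  by rewrite !ler0_norm; lra.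
move=> s u s0 u0; have [su|/ltW su] := leP s u; first exact: mixed.
by rewrite enormB /hweight distrC -addrA (addrC `|s|) addrA; exact: mixed.
Qed.

Lemma shift_hn (R : realType) (d : nat) (H : R) (H01 : 0 < H < 1)
    (w : noise d H) : hn (shift_noise H01 w) <= 2 * hn w.
Proof.
apply: hn_le => //; have := hbound_shift ler01 (hn_ge0 w) (hn_bound w H01).
apply: hboundW; rewrite mulrC ler_wpM2r ?hn_ge0//.
have {2}-> : (2 : R) = Num.sqrt (2 ^+ 2) by rewrite sqrtr_sqr ger0_norm.
by apply: ler_wsqrtr; lra.
Qed.

(** The value at time t is an evaluation of [DH (Pt t w)] at distance at most 1 from 0, where its
    weight is at most 2; [DH_growth] and [update_hn] bound the norm. *)
Lemma fbm_bound (R : realType) (d : nat) (H : R) (sigma : 'M[R]_d)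
    (Pt : R -> noise d H * noise d H -> noise d H)
    (DH : noise d H -> noise d (1 - H)) :
  0 < H < 1 -> is_noise_update Pt -> is_DH DH ->
  exists2 c : R, 1 <= c & forall (t : R) w, 0 <= t <= 1 ->
    enorm (sigma *m fbm Pt DH t w) <= c * (1 + (hn w.1 + hn w.2)).
Proof.
move=> H01 hPt hDH; have [C C0 hC] := DH_growth H01 hDH.
have H01' : 0 < 1 - H < 1 by case/andP: H01 => *; apply/andP; split; lra.
pose cs : R := \sum_i enorm (sigma *m evec R i).
have cs0 : 0 <= cs by apply: sumr_ge0 => i _; exact: enorm_ge0.
have ls : linear (mulmx sigma : 'cV[R]_d -> 'cV[R]_d).
  by move=> a u v; rewrite mulmxDr -scalemxAr.
exists (1 + cs * (C * 2 * 2)); first by rewrite lerDl !mulr_ge0.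
move=> t w t01; have h0 : 0 <= hn w.1 + hn w.2 by rewrite addr_ge0 ?hn_ge0.
apply: le_trans (linear_le_sum ls _) _.
rewrite mulrDl; apply: (@le_trans _ _ (cs * (C * 2 * 2) * (1 + (hn w.1 + hn w.2)))); last first.
  by rewrite lerDr mul1r addr_ge0.
rewrite -[leRHS]mulrA ler_wpM2l// /fbm enormN.
case/andP: (t01) => t0 t1.
have tm : - t <= 0 by rewrite oppr_le0.
have := hn_bound (DH (Pt t w)) H01' tm (lexx 0).
rewrite [val _ 0]noise_ge0// subr0 => /le_trans; apply.
have h1 : hweight (1 - H) (- t) 0 <= 2.
  rewrite /hweight normr0 addr0 subr0 normrN ger0_norm// -[leRHS]mulr1.
  apply: ler_pM; rewrite ?sqrtr_ge0 ?powR_ge0//.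
    have -> : (2 : R) = Num.sqrt (2 ^+ 2) by rewrite sqrtr_sqr ger0_norm.
    by apply: ler_wsqrtr; lra.
  have : t `^ ((1 - (1 - H)) / 2) <= 1 `^ ((1 - (1 - H)) / 2).
    by apply: ge0_ler_powR; rewrite ?nnegrE//; case/andP: H01 => *; lra.
  by rewrite powR1.
have h2 : hn (DH (Pt t w)) <= C * (2 * (1 + (hn w.1 + hn w.2))).
  apply: le_trans (hC _) _; rewrite ler_wpM2l//.
  have := update_hn w H01 hPt t01; clear -h0.
  by move: (hn _) (hn _ + hn _) h0 => a b; lra.
apply: le_trans (ler_pM (hn_ge0 _) (hweight_ge0 _ _ _) h2 h1) _.
by rewrite -!mulrA ler_wpM2l// mulrA (mulrC _ 2) mulrA.
Qed.

(* Bounds the orbit over one unit of time and grows at most by a constant factor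
   under one step, which is all that temperedness requires of it. *)
Definition gauge (R : realType) (d : nat) (H : R) (N : nat)
    (z : (euclid R d * noise d H) * noise d H) : R :=
  1 + enorm (z.1.1 : 'cV[R]_d) + (1 + (hn z.1.2 + hn z.2)) ^+ N.

Lemma gauge_ge1 (R : realType) (d : nat) (H : R) (N : nat)
    (z : (euclid R d * noise d H) * noise d H) : 1 <= gauge N z.
Proof.
rewrite /gauge -addrA lerDl addr_ge0 ?enorm_ge0// exprn_ge0// addr_ge0//.
by rewrite addr_ge0 ?hn_ge0.
Qed.

Lemma measurable_gauge (R : realType) (d : nat) (H : R) (N : nat) :
  0 < H < 1 -> measurable_fun setT (@gauge R d H N).
Proof.
move=> H01; apply: measurable_funD.
  apply: measurable_funD => //; apply: measurable_enorm => i.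
  exact: (measurableT_comp (@measurable_euclid_coord R d i)
    (measurableT_comp measurable_fst measurable_fst)).
have m1 : measurable_fun setT (fun z : (euclid R d * noise d H) * noise d H => z.1.2).
  exact: measurableT_comp measurable_snd measurable_fst.
apply: measurable_funX; apply: measurable_funD => //.
apply: measurable_funD.
  have := measurableT_comp (@measurable_hn R d H H01) m1; exact.
have := measurableT_comp (@measurable_hn R d H H01)
  (@measurable_snd _ _ (euclid R d * noise d H)%type (noise d H)); exact.
Qed.

(** The exponent of the gauge is n + 1, with n the growth degree of [F]: [solution_bound] produces F
    of the noise, of degree n in the noise size, and the noise itself, of degree 1, and the power n
    + 1 dominates both. *)
Lemma gauge_growth (R : realType) (d : nat) (H : R) (H01 : 0 < H < 1)
    (F : 'cV[R]_d -> 'cV[R]_d) (sigma : 'M[R]_d)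
    (Pt : R -> noise d H * noise d H -> noise d H)
    (DH : noise d H -> noise d (1 - H))
    (Phi : R -> noise d H * noise d H -> 'cV[R]_d -> 'cV[R]_d) :
  dissipative_flow F sigma Pt DH Phi ->
  exists (N : nat) (K : R), [/\ 2 <= K,
    forall z, gauge N (skew_step H01 Pt Phi z) <= K * gauge N z &
    forall z (t : R), 0 <= t <= 1 ->
      1 + 2 * enorm (Phi t (omega z) z.1.1) <= K * gauge N z].
Proof.
move=> [hD hF hPt hDH hPhi].
have [C [K [n [C0 hC dF K0 hK]]]] := assumption_D_bounds hD.
have [c c1 hc] := fbm_bound sigma H01 hPt hDH.
have c0 : 0 <= c by lra.
pose E := expR C.
have E1 : 1 <= E by rewrite -[leLHS]expR0 ler_expR ltW.
have E0 : 0 <= E by lra.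
pose B := E * (K * (2 * c) ^+ n).
have B0 : 0 <= B by rewrite !mulr_ge0 ?(ltW K0)// exprn_ge0// mulr_ge0.
pose A := E + B + c.
have A0 : 0 <= A by rewrite !addr_ge0.
have bound z (t : R) : 0 <= t <= 1 ->
    enorm (Phi t (omega z) z.1.1) <= A * gauge n.+1 z.
  move=> t01; pose h := hn z.1.2 + hn z.2.
  have h0 : 0 <= h by rewrite addr_ge0 ?hn_ge0.
  pose b := fun t => sigma *m fbm Pt DH t (omega z).
  have hb (s : R) : 0 <= s <= 1 -> enorm (b s) <= c * (1 + h) by exact: hc.
  have hFb (s : R) : 0 <= s <= 1 -> enorm (F (b s)) <= K * (2 * c * (1 + h)) ^+ n.
    move=> s01; have [hKs _] := hK (b s); apply: le_trans hKs _.
    rewrite ler_wpM2l ?(ltW K0)// lerXn2r ?nnegrE//.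
    - by rewrite addr_ge0 ?enorm_ge0.
    - by rewrite !mulr_ge0//; lra.
    - have := hb s s01.
      have : 1 <= c * (1 + h) by rewrite mulr_ege1//; lra.
      by rewrite -mulrA; lra.
  have e0 : 0 <= K * (2 * c * (1 + h)) ^+ n.
    by rewrite mulr_ge0 ?(ltW K0)// exprn_ge0// !mulr_ge0//; lra.
  have sol := flow_solution dF hPhi (omega z) z.1.1 1.
  have := solution_bound (ltW C0) e0 hC hb hFb sol t01.
  case/andP: (t01) => t0 t1; rewrite max_r// => /le_trans; apply.
  set x := enorm (z.1.1 : 'cV[R]_d); have x0 : 0 <= x by exact: enorm_ge0.
  have hE : expR (C * t) <= E by rewrite ler_expR ler_piMr ?(ltW C0).
  have q1 : (1 + h) ^+ n <= (1 + h) ^+ n.+1.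
    by rewrite exprS ler_peMl ?exprn_ge0//; lra.
  have q2 : 1 + h <= (1 + h) ^+ n.+1.
    rewrite -[leLHS]mulr1 exprS ler_wpM2l//; first by lra.
    by apply: exprn_ege1; lra.
  have q0 : 0 <= (1 + h) ^+ n.+1 by rewrite exprn_ge0//; lra.
  have k1 : t * (K * (2 * c * (1 + h)) ^+ n) <= K * (2 * c) ^+ n * (1 + h) ^+ n.+1.
    apply: (@le_trans _ _ (1 * (K * (2 * c * (1 + h)) ^+ n))); first by rewrite ler_wpM2r.
    rewrite mul1r exprMn mulrA ler_wpM2l// mulr_ge0 ?(ltW K0)// exprn_ge0//.
    by rewrite mulr_ge0.
  apply: (@le_trans _ _ (E * (x + K * (2 * c) ^+ n * (1 + h) ^+ n.+1) + c * (1 + h) ^+ n.+1)).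
    apply: lerD; last by rewrite ler_wpM2l.
    apply: ler_pM; rewrite ?expR_ge0//; last by rewrite lerD2l.
    by rewrite addr_ge0// mulr_ge0.
  rewrite /gauge -/x -/h; set q := (1 + h) ^+ n.+1 in q0 *.
  have -> : E * (x + K * (2 * c) ^+ n * q) + c * q = E * x + B * q + c * q by rewrite /B; ring.
  have := mulr_ge0 B0 x0; have := mulr_ge0 c0 x0; have := mulr_ge0 E0 q0.
  by rewrite /A !mulrDl !mulrDr !mulr1; lra.
(* The term 2 A serves the bound on [0, 1]. The 4 comes from the noise: an update and a shift send
   h1 + h2 to at most 2 (h1 + h2) + 2 h2. *)
pose KK := 1 + 2 * A + 4 ^+ n.+1.
have f1 : 1 <= 4 ^+ n.+1 :> R by rewrite exprn_ege1// ler1n.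
exists n.+1, KK; split.
- by rewrite /KK; lra.
- move=> z; have g1 := gauge_ge1 n.+1 z.
  have b1 := bound z 1 ltac:(rewrite ler01 lexx//).
  rewrite {1}/gauge.
  have -> : (skew_step H01 Pt Phi z).1.1 = Phi 1 (omega z) z.1.1 by [].
  have h1 := update_hn (omega z) H01 hPt (t := 1) ltac:(rewrite ler01 lexx//).
  have h2 := shift_hn H01 z.2.
  have n1 := hn_ge0 z.1.2; have n2 := hn_ge0 z.2.
  have h3 : (1 + (hn (skew_step H01 Pt Phi z).1.2 + hn (skew_step H01 Pt Phi z).2)) ^+ n.+1 <=
      4 ^+ n.+1 * gauge n.+1 z.
    apply: (@le_trans _ _ ((4 * (1 + (hn z.1.2 + hn z.2))) ^+ n.+1)).
      apply: lerXn2r; rewrite ?nnegrE.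
      - by rewrite addr_ge0// addr_ge0 ?hn_ge0.
      - by lra.
      - by move: h1 h2; rewrite /skew_step/=; lra.
    rewrite exprMn ler_wpM2l// /gauge lerDr addr_ge0 ?enorm_ge0//.
  move: h3 b1 g1; set q := _ ^+ n.+1; set g := gauge _ _; set e := enorm _.
  move=> h3 b1 g1; rewrite /KK !mulrDl mul1r.
  by have := mulr_ge0 A0 (le_trans ler01 g1); lra.
- move=> z t t01; have g1 := gauge_ge1 n.+1 z; have b1 := bound z t t01.
  move: g1 b1; set g := gauge _ _; set e := enorm _ => g1 b1.
  have g0 : 0 <= g by lra.
  rewrite /KK !mulrDl mul1r; have := mulr_ge0 (le_trans ler01 f1) g0.
  by rewrite -mulrA; lra.
Qed.

(** * The linearised flow *)

(** Difference quotients along 1/(m+1) make the derivative of the flow a pointwise limit of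
    measurable maps. *)
Lemma differential_limit (R : realType) (d : nat) (f : 'cV[R]_d -> 'cV[R]_d)
    (x v : 'cV[R]_d) (i : 'I_d) : differentiable f x ->
  (m.+1%:R * (f (x + m.+1%:R^-1 *: v) - f x) i 0) @[m --> \oo] --> 'd f x v i 0.
Proof.
move=> dfx; have hd : derivable f x v by exact: diff_derivable.
rewrite -deriveE//; apply/cvgrPdist_lt => e e0.
have /cvgrPdist_lt/(_ e e0) := hd.
rewrite near_withinE -nbhs_ballE => -[del /= del0 hdel].
exists (Num.truncn del^-1) => // m /= hm.
have hm1 : (m.+1%:R^-1 : R) < del.
  rewrite -[ltRHS]invrK ltf_pV2 ?posrE ?invr_gt0//.
  by apply: lt_le_trans (truncnS_gt _) _; rewrite ler_nat.
have hm0 : (m.+1%:R^-1 : R) != 0 by rewrite invr_eq0 pnatr_eq0.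
have hb : ball 0 del (m.+1%:R^-1 : R).
  by rewrite -ball_normE/= sub0r normrN ger0_norm.
have := hdel _ hb hm0; rewrite invrK; apply: le_lt_trans.
set q := m.+1%:R *: _; set D := lim _.
have -> : m.+1%:R * (f (x + m.+1%:R^-1 *: v) - f x) i 0 = q i 0.
  by rewrite /q [RHS]mxE (addrC x).
have -> : D i 0 - q i 0 = (D - q) i 0 by rewrite !mxE.
exact: coord_le_norm.
Qed.

(** The expansion at h v, divided by h, transfers the Lipschitz bound on increments to the
    differential, up to an error of order h^s. *)
Lemma differential_bound (R : realType) (d : nat) (f : 'cV[R]_d -> 'cV[R]_d)
    (x : 'cV[R]_d) (E A s : R) : 0 <= A -> 0 < s ->
  differentiable f x ->
  (forall y, enorm y <= 1 ->
    enorm (f (x + y) - f x - 'd f x y) <= A * enorm y `^ (1 + s)) ->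
  (forall y, enorm (f (x + y) - f x) <= E * enorm y) ->
  forall v, enorm ('d f x v) <= E * enorm v.
Proof.
move=> A0 s0 dfx hA hE v; apply/ler_addgt0Pr => e e0.
have v0 := enorm_ge0 v.
have c0 : 0 <= A * enorm v `^ (1 + s) by rewrite mulr_ge0 ?powR_ge0.
have [N hN] := powR_small c0 s0 e0.
pose n := maxn N (Num.truncn (enorm v)).
pose h : R := n.+1%:R^-1.
have h0 : 0 < h by rewrite invr_gt0.
have hv : enorm (h *: v) = h * enorm v by rewrite enormZ gtr0_norm.
have hv1 : enorm (h *: v) <= 1.
  rewrite hv ler_pdivrMl// mulr1; apply/ltW/(lt_le_trans (truncnS_gt _)).
  by rewrite ler_nat ltnS leq_maxr.
have := hA _ hv1; have := hE (h *: v); rewrite hv => h1 h2.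
have h3 : enorm ('d f x (h *: v)) <= E * (h * enorm v) + A * (h * enorm v) `^ (1 + s).
  rewrite -(subrK ('d f x (h *: v)) (f (x + h *: v) - f x)) in h1.
  have -> : 'd f x (h *: v) = (f (x + h *: v) - f x) - (f (x + h *: v) - f x - 'd f x (h *: v)).
    by rewrite opprB addrCA subrr addr0.
  rewrite subrK in h1.
  by apply: le_trans (ler_enormD _ _) _; rewrite enormN lerD.
rewrite linearZ enormZ gtr0_norm// in h3.
have h4 : h * enorm ('d f x v) <= h * (E * enorm v + A * enorm v `^ (1 + s) * h `^ s).
  apply: le_trans h3 _; rewrite powRM ?(ltW h0)//.
  have -> : h `^ (1 + s) = h * h `^ s.
    rewrite powRD ?powRr1 ?(ltW h0)//.
    by apply/implyP => _; rewrite gt_eqF.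
  by rewrite le_eqVlt; apply/orP; left; apply/eqP; ring.
have {}h4 : enorm ('d f x v) <= E * enorm v + A * enorm v `^ (1 + s) * h `^ s.
  by move: h4; rewrite ler_pM2l.
apply: le_trans h4 _; rewrite lerD2l ltW//.
by apply: hN; exact: leq_maxl.
Qed.

Lemma flow_time_one (R : realType) (d : nat) (H : R)
    (F : 'cV[R]_d -> 'cV[R]_d) (sigma : 'M[R]_d)
    (Pt : R -> noise d H * noise d H -> noise d H)
    (DH : noise d H -> noise d (1 - H))
    (Phi : R -> noise d H * noise d H -> 'cV[R]_d -> 'cV[R]_d) :
  dissipative_flow F sigma Pt DH Phi ->
  exists (C r K : R) (p : nat), [/\ 0 < C, 0 < r, 0 < K,
    forall (t : R) w x y, 0 <= t ->
      enorm (Phi t w x - Phi t w y) <= expR (C * t) * enorm (x - y) &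
    forall w x G, (forall t : R, 0 <= t <= 1 -> 1 + 2 * enorm (Phi t w x) <= G) ->
      [/\ differentiable (Phi 1 w) x,
       forall y, enorm y <= 1 ->
        enorm (Phi 1 w (x + y) - Phi 1 w x - 'd (Phi 1 w) x y) <=
          K * G ^+ p * enorm y `^ (1 + r) &
       forall v, enorm ('d (Phi 1 w) x v) <= expR C * enorm v]].
Proof.
move=> [hD hF hPt hDH hPhi].
have [C [K [n [C0 hC dF K0 hK]]]] := assumption_D_bounds hD.
have [r [C' [p [r01 C'0 hexp]]]] := first_order_expansion dF hF.
have [K1 K10 hK1] := flow_expansion (ltW C0) r01 C'0 hC dF hexp.
have hcon := flow_contract (ltW C0) dF hC hPhi.
have [r0 _] := andP r01.
exists C, r, K1, p; split=> // w x G hG.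
pose X y t := Phi (Num.max 0 t) w y.
have hX y : is_solution F (fun t => sigma *m fbm Pt DH t w) 1 y (X y).
  exact: flow_solution.
have hXG (t : R) : 0 <= t <= 1 -> 1 + 2 * enorm (X x t) <= G.
  by move=> t01; rewrite /X max_r; [exact: hG|case/andP: t01].
have X1 : (fun y => X y 1) = Phi 1 w by apply/funext => y; rewrite /X max_r.
have [] := hK1 _ X x G hX hXG; rewrite X1 => d1 e1.
have e1' y : enorm y <= 1 -> enorm (Phi 1 w (x + y) - Phi 1 w x - 'd (Phi 1 w) x y) <=
          K1 * G ^+ p * enorm y `^ (1 + r).
  by move=> /e1; rewrite /X !max_r.
split=> //; apply: (differential_bound _ r0 d1 e1').
  rewrite mulr_ge0 ?(ltW K10)// exprn_ge0//.
  have := hG 0 ltac:(rewrite lexx ler01//).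
  by have := enorm_ge0 (Phi 0 w x); lra.
by move=> y; have := hcon 1 w (x + y) x ler01; rewrite mulr1 addrAC subrr add0r.
Qed.

(** The cocycle property writes an integer-time map as a composition of time-one maps; the chain
    rule then needs differentiability at time 1 only. *)
Lemma flow_differentiable (R : realType) (d : nat) (H : R) (H01 : 0 < H < 1)
    (F : 'cV[R]_d -> 'cV[R]_d) (sigma : 'M[R]_d)
    (Pt : R -> noise d H * noise d H -> noise d H)
    (DH : noise d H -> noise d (1 - H))
    (Phi : R -> noise d H * noise d H -> 'cV[R]_d -> 'cV[R]_d) :
  dissipative_flow F sigma Pt DH Phi ->
  forall n w x, differentiable (Phi n%:R w) x /\
    'd (Phi n.+1%:R w) x = 'd (Phi n%:R (noise_step H01 Pt w)) (Phi 1 w x)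
       \o 'd (Phi 1 w) x :> ('cV[R]_d -> 'cV[R]_d).
Proof.
move=> hf; have [_ _ _ _ hPhi] := hf.
have [C [r [K1 [p [C0 r0 K10 _ h1]]]]] := flow_time_one hf.
have [N [K [_ _ hG]]] := gauge_growth H01 hf.
have d1 w x : differentiable (Phi 1 w) x.
  case: w => w1 w2; have := hG ((x, w1), w2).
  by move=> /(h1 (w1, w2) x)[].
have comp n w : Phi n.+1%:R w = Phi n%:R (noise_step H01 Pt w) \o Phi 1 w.
  by apply/funext => x; rewrite -natr1 (flow_step H01 hf).
have dn n w x : differentiable (Phi n%:R w) x.
  elim: n w x => [|n IHn] w x.
    have -> : Phi 0%:R w = id by apply/funext => y; rewrite (flow0 _ _ hPhi).
    exact: ex_diff.
  by rewrite comp; apply: differentiable_comp.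
move=> n w x; split; first exact: dn.
by rewrite comp; exact: (diff_comp (d1 w x) (dn n _ _)).
Qed.

(* Comparable to the operator norm of the derivative, and a finite sum of limits
   of difference quotients, hence measurable. *)
Definition dsize (R : realType) (d : nat) (H : R)
    (Phi : R -> noise d H * noise d H -> 'cV[R]_d -> 'cV[R]_d) (k : nat)
    (z : (euclid R d * noise d H) * noise d H) : R :=
  \sum_i enorm ('d (Phi k%:R (omega z)) (z.1.1 : 'cV[R]_d) (evec R i)).

Lemma dsizeP (R : realType) (d : nat) (H : R)
    (Phi : R -> noise d H * noise d H -> 'cV[R]_d -> 'cV[R]_d) (k : nat)
    (z : (euclid R d * noise d H) * noise d H) v :
  enorm ('d (Phi k%:R (omega z)) (z.1.1 : 'cV[R]_d) v) <= dsize Phi k z * enorm v.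
Proof. by apply: linear_le_sum => a u u'; rewrite linearP. Qed.

Lemma dsize_ge0 (R : realType) (d : nat) (H : R)
    (Phi : R -> noise d H * noise d H -> 'cV[R]_d -> 'cV[R]_d) (k : nat)
    (z : (euclid R d * noise d H) * noise d H) : 0 <= dsize Phi k z.
Proof. by apply: sumr_ge0 => i _; exact: enorm_ge0. Qed.

Lemma measurable_dsize (R : realType) (d : nat) (H : R) (H01 : 0 < H < 1)
    (F : 'cV[R]_d -> 'cV[R]_d) (sigma : 'M[R]_d)
    (Pt : R -> noise d H * noise d H -> noise d H)
    (DH : noise d H -> noise d (1 - H))
    (Phi : R -> noise d H * noise d H -> 'cV[R]_d -> 'cV[R]_d) :
  dissipative_flow F sigma Pt DH Phi ->
  forall k, measurable_fun setT (dsize Phi k).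
Proof.
move=> hf k; have [hD hF hPt hDH hPhi] := hf.
apply: measurable_sum => i; apply: measurable_enorm => j.
pose T := ((euclid R d * noise d H) * noise d H)%type.
pose pert (v : 'cV[R]_d) (z : T) : T := (((z.1.1 : 'cV[R]_d) + v, z.1.2), z.2).
have mx : measurable_fun setT (fun z : T => z.1.1).
  exact: measurableT_comp measurable_fst measurable_fst.
have mp v : measurable_fun setT (pert v).
  apply: measurable_fun_pair; last exact: measurable_snd.
  apply: measurable_fun_pair; last exact: measurableT_comp measurable_snd measurable_fst.
  apply: euclid_measurable_fun => l.
  have -> : (fun z : T => ((z.1.1 : 'cV[R]_d) + v) l 0) =
      (fun z : T => (z.1.1 : 'cV[R]_d) l 0 + v l 0).
    by apply/funext => z; rewrite mxE.
  apply: measurable_funD => //.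
  exact: measurableT_comp (@measurable_euclid_coord R d l) mx.
have mPhi v : measurable_fun setT
    (fun z : T => Phi k%:R (omega z) ((z.1.1 : 'cV[R]_d) + v) j 0).
  have mT := measurable_iter k (skew_measurable H01 hD hF hPt hDH hPhi).
  have -> : (fun z : T => Phi k%:R (omega z) ((z.1.1 : 'cV[R]_d) + v) j 0) =
      (fun z : T => ((iter k (skew_step H01 Pt Phi) (pert v z)).1.1 : 'cV[R]_d) j 0).
    by apply/funext => z; rewrite (skew_iter H01 hf).
  have h1 := measurableT_comp mT (mp v).
  have h2 := measurableT_comp mx h1.
  exact: measurableT_comp (@measurable_euclid_coord R d j) h2.
apply: (@measurable_fun_cvg _ _ R setT
  (fun m (z : T) => m.+1%:R *
     (Phi k%:R (omega z) ((z.1.1 : 'cV[R]_d) + m.+1%:R^-1 *: evec R i) j 0 -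
      Phi k%:R (omega z) ((z.1.1 : 'cV[R]_d) + 0) j 0))
  (fun z : T => 'd (Phi k%:R (omega z)) (z.1.1 : 'cV[R]_d) (evec R i) j 0)).
  by move=> m; apply: measurable_funM => //; apply: measurable_funB; exact: mPhi.
move=> z _.
have [dz _] := flow_differentiable H01 hf k (omega z) z.1.1.
have := @differential_limit _ _ _ _ (evec R i) j dz; apply: cvg_trans.
by apply: near_eq_cvg; near=> m; rewrite addr0 !mxE.
Unshelve. all: end_near. Qed.

(** Super-level set of sup_k exp(kap k) |D Phi^k| at the geometric level K^M. *)
Definition expanding (R : realType) (d : nat) (H : R)
    (Phi : R -> noise d H * noise d H -> 'cV[R]_d -> 'cV[R]_d) (kap K : R)
    (M : nat) : set ((euclid R d * noise d H) * noise d H) :=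
  \bigcup_k [set z | K ^+ M < expR (kap * k%:R) * dsize Phi k z].

(** By the chain rule, expansion over k + 1 steps from [z] is expansion over k steps from its image,
    up to the factor d exp(C + kap) <= K, that is, up to one level. *)
Lemma expanding_step (R : realType) (d : nat) (H : R) (H01 : 0 < H < 1)
    (F : 'cV[R]_d -> 'cV[R]_d) (sigma : 'M[R]_d)
    (Pt : R -> noise d H * noise d H -> noise d H)
    (DH : noise d H -> noise d (1 - H))
    (Phi : R -> noise d H * noise d H -> 'cV[R]_d -> 'cV[R]_d) (C kap K : R) :
  dissipative_flow F sigma Pt DH Phi ->
  (forall w x v, enorm ('d (Phi 1 w) x v) <= expR C * enorm v) ->
  1 <= K -> d%:R <= K -> d%:R * expR (C + kap) <= K ->
  forall M z, expanding Phi kap K M.+1 z ->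
    expanding Phi kap K M (skew_step H01 Pt Phi z).
Proof.
(* The index k = 0 cannot occur: the derivative is then the identity, of size d <= K. *)
move=> hf hC K1 dK hK M z [[|k] _ /= hz].
  have [_ _ _ _ hPhi] := hf.
  move: hz; rewrite mulr0 expR0 mul1r.
  have -> : dsize Phi 0 z = d%:R.
    rewrite /dsize; have -> : Phi 0%:R (omega z) = id.
      by apply/funext => y; rewrite (flow0 _ _ hPhi).
    have E : 'd (@id 'cV[R]_d) (z.1.1 : 'cV[R]_d) = id :> ('cV[R]_d -> 'cV[R]_d).
      exact: diff_val.
    under eq_bigr => i _ do rewrite [X in enorm (X _)]E enorm_evec.
    by rewrite sumr_const card_ord.
  rewrite ltNge => /negP[]; apply: le_trans dK _.
  by rewrite exprS ler_peMr ?(le_trans ler01)// exprn_ege1.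
have [_ E] := flow_differentiable H01 hf k (omega z) z.1.1.
have [z' Ez'] : {z' | z' = skew_step H01 Pt Phi z} by eexists.
have Eo : omega z' = noise_step H01 Pt (omega z) by rewrite Ez'.
have Ex : z'.1.1 = Phi 1 (omega z) z.1.1 by rewrite Ez'.
rewrite -Eo -Ex in E; rewrite -Ez'.
have E' v : 'd (Phi k.+1%:R (omega z)) (z.1.1 : 'cV[R]_d) v =
    'd (Phi k%:R (omega z')) (z'.1.1 : 'cV[R]_d) ('d (Phi 1 (omega z)) (z.1.1 : 'cV[R]_d) v).
  by rewrite [in LHS]E.
suff s1 : K ^+ M < expR (kap * k%:R) * dsize Phi k z' by exists k.
rewrite -(ltr_pM2l (lt_le_trans ltr01 K1)) -exprS.
apply: lt_le_trans hz _.
have e0 : 0 <= expR (kap * k%:R) by exact: expR_ge0.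
have s0 := dsize_ge0 Phi k z'.
have h1 : dsize Phi k.+1 z <= d%:R * expR C * dsize Phi k z'.
  apply: (@le_trans _ _ (\sum_(i < d) expR C * dsize Phi k z')).
    apply: ler_sum => i _.
    rewrite E'.
    apply: (le_trans (dsizeP Phi k z' _)).
    rewrite mulrC ler_wpM2r//.
    by have := hC (omega z) z.1.1 (evec R i); rewrite enorm_evec mulr1.
  by rewrite sumr_const card_ord -mulrA mulr_natl.
rewrite -natr1 mulrDr mulr1 expRD.
apply: le_trans (ler_wpM2l _ h1) _; first by rewrite mulr_ge0 ?expR_ge0.
have -> : expR (kap * k%:R) * expR kap * (d%:R * expR C * dsize Phi k z')
  = d%:R * expR (C + kap) * (expR (kap * k%:R) * dsize Phi k z').
  by rewrite expRD; ring.
by rewrite ler_wpM2r// mulr_ge0.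
Qed.

Lemma lne_lt_expR (R : realType) (x c : R) :
  (lne x%:E < c%:E)%E -> x < expR c.
Proof.
have [x0|x0] := leP x 0; first by move=> _; apply: le_lt_trans x0 (expR_gt0 _).
by rewrite lne_EFin// lte_fin => h; rewrite -[x]lnK ?posrE// ltr_expR.
Qed.

(** Along integer times the Lyapunov limit, being below -kap, makes exp(kap k) |D Phi^k| eventually
    bounded, so almost every point lies outside some level. The case of an exponent -oo is
    included. *)
Lemma expanding_null (R : realType) (d : nat) (H : R) (H01 : 0 < H < 1)
    (F : 'cV[R]_d -> 'cV[R]_d) (sigma : 'M[R]_d)
    (P : probability (noise d H) R)
    (Pt : R -> noise d H * noise d H -> noise d H)
    (DH : noise d H -> noise d (1 - H))
    (Phi : R -> noise d H * noise d H -> 'cV[R]_d -> 'cV[R]_d)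
    (mu : probability (euclid R d * noise d H)%type R)
    (lambda1 : \bar R) (kap K : R) :
  dissipative_flow F sigma Pt DH Phi -> top_lyapunov P Phi mu lambda1 ->
  0 < kap -> (kap%:E < - lambda1)%E -> 2 <= K ->
  (forall M, measurable (expanding Phi kap K M)) /\
  (mu \x P)%E (\bigcap_M expanding Phi kap K M) = 0%E.
Proof.
move=> hf [_ hl] kap0 hkap K2.
have mE M : measurable (expanding Phi kap K M).
  apply: bigcup_measurable => k _.
  apply: measurable_gt; apply: measurable_funM => //.
  exact: measurable_dsize hf k.
split=> //; apply/negligibleP; first exact: bigcap_measurable.
apply: negligibleS hl => z hz /= hcv.
have hlk : (lambda1 < (- kap)%:E)%E by rewrite EFinN lteNr.
have hnb : nbhs lambda1 [set y | (y < (- kap)%:E)%E].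
  clear -hlk; case: lambda1 hlk => [l| |] h.
  - by rewrite lte_fin in h; exact: (@nbhs_open_ereal_lt R l (fun=> - kap)).
  - by [].
  - exact: nbhs_open_ereal_ninfty.
have [A [_ hA]] := hcv _ hnb.
have small (k : nat) : 0 < k%:R :> R -> A < k%:R ->
    expR (kap * k%:R) * dsize Phi k z <= d%:R.
  move=> k0 /hA hk0.
  have hk : ((k%:R^-1)%:E * lne (opnorm ('d (Phi k%:R (omega z)) (z.1.1 : 'cV[R]_d)))%:E
      < (- kap)%:E)%E by exact: hk0.
  have hop : opnorm ('d (Phi k%:R (omega z)) (z.1.1 : 'cV[R]_d)) < expR (- kap * k%:R).
    apply: lne_lt_expR; move: hk; move: (lne _) => [y| |].
    - by rewrite -EFinM !lte_fin ltr_pdivrMl// mulrC.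
    - by rewrite gt0_muley ?lte_fin ?invr_gt0.
    - by move=> _; rewrite ltNyr.
  have hds : dsize Phi k z <= d%:R * expR (- kap * k%:R).
    apply: (@le_trans _ _ (\sum_(i < d) expR (- kap * k%:R))).
      apply: ler_sum => i _; apply: le_trans (ltW hop).
      apply: opnorm_ge; last by rewrite enorm_evec.
      by move=> a u u'; rewrite linearP.
    by rewrite sumr_const card_ord mulr_natl.
  apply: le_trans (ler_wpM2l (expR_ge0 _) hds) _.
  by rewrite mulrCA -expRD mulNr subrr expR0 mulr1.
(* Beyond [k0] the Lyapunov limit gives the bound d; the finitely many earlier terms are summed. *)
pose k0 := (Num.truncn `|A|).+1.
pose S : R := d%:R + \sum_(k < k0) expR (kap * k%:R) * dsize Phi k z.
have hS k : expR (kap * k%:R) * dsize Phi k z <= S.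
  have t0 (j : nat) : 0 <= expR (kap * j%:R) * dsize Phi j z.
    by rewrite mulr_ge0 ?expR_ge0 ?dsize_ge0.
  have [kk|kk] := ltnP k k0.
    rewrite /S (bigD1 (Ordinal kk))//= addrCA lerDl addr_ge0// sumr_ge0//.
  apply: (@le_trans _ _ d%:R); last by rewrite /S lerDl sumr_ge0.
  apply: small; first by rewrite ltr0n (leq_trans _ kk).
  apply: le_lt_trans (ler_norm A) _; apply: lt_le_trans (truncnS_gt _) _.
  by rewrite ler_nat.
have [M hM] : exists M : nat, S <= K ^+ M.
  exists (Num.truncn S).+1; apply: le_trans (ltW (truncnS_gt _)) _.
  elim: (Num.truncn S).+1 => [|n IHn]; first by rewrite expr0 ler01.
  have h1 : 1 <= K ^+ n by apply: exprn_ege1; lra.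
  rewrite exprS -natr1; have : 2 * K ^+ n <= K * K ^+ n by rewrite ler_wpM2r//; lra.
  lra.
have [k _ /= hk] := hz M I.
by have := lt_le_trans hk (le_trans (hS k) hM); rewrite ltxx.
Qed.

(** * Nonlinear stability *)

(* Discrete Duhamel formula: [L n k] is the linearised motion from time [n] to
   time [n + k], and [L j (n - j) (delta j)] telescopes in [j]. *)
Lemma discrete_stability (R : realType) (d : nat) (c1 c2 e1 e2 kap r : R) :
  0 < c1 -> 0 <= c2 -> 0 < kap -> 0 < r -> e1 + e2 < kap * r ->
  exists2 rho : R, 0 < rho &
  forall (delta : nat -> 'cV[R]_d) (L : nat -> nat -> 'cV[R]_d -> 'cV[R]_d),
    (forall n k, linear (L n k)) -> (forall n v, L n 0%N v = v) ->
    (forall n k v, L n k.+1 v = L n.+1 k (L n 1%N v)) ->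
    (forall n k v, enorm (L n k v) <=
       c1 * expR (e1 * n%:R) * expR (- kap * k%:R) * enorm v) ->
    (forall n, enorm (delta n) <= 1 -> enorm (delta n.+1 - L n 1%N (delta n)) <=
       c2 * expR (e2 * n%:R) * enorm (delta n) `^ (1 + r)) ->
    enorm (delta 0%N) <= rho ->
    forall n, enorm (delta n) <= expR (- kap * n%:R).
Proof.
move=> c10 c20 kap0 r0 e12.
(* Ratio of the geometric series formed by the nonlinear errors in the Duhamel sum; the condition on
   the rates makes it less than 1. *)
pose q := expR (e1 + e2 - kap * r).
have q0 : 0 < q by exact: expR_gt0.
have q1 : q < 1 by rewrite -expR0 ltr_expR subr_lt0.
have q10 : 0 < 1 - q by rewrite subr_gt0.
pose B := c1 * c2 * expR (e1 + kap).
have B0 : 0 <= B by rewrite !mulr_ge0 ?expR_ge0// ltW.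
have q2 : 0 < (1 - q) / 2 by rewrite divr_gt0.
(* The amplitude eta is so small that the whole series of errors stays below eta/2. *)
have [N /(_ N (leqnn _)) hN] := powR_small B0 r0 q2.
pose eta : R := N.+1%:R^-1.
have eta0 : 0 < eta by rewrite invr_gt0.
have eta1 : eta <= 1 by rewrite invf_le1// ler1n.
(* This radius leaves eta/2 for the linearised motion of the initial perturbation. *)
exists (eta / (2 * c1)); first by rewrite divr_gt0// mulr_gt0.
move=> delta L lL L0 LS hL hd d0.
have Bq : B * eta `^ (1 + r) / (1 - q) <= eta / 2.
  have -> : eta `^ (1 + r) = eta * eta `^ r.
    rewrite powRD ?powRr1 ?(ltW eta0)//.
    by apply/implyP => _; rewrite gt_eqF.
  rewrite ler_pdivrMr//.
  have -> : B * (eta * eta `^ r) = eta * (B * eta `^ r) by ring.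
  have -> : eta / 2 * (1 - q) = eta * ((1 - q) / 2) by ring.
  by rewrite ler_pM2l// ltW.
have cd : c1 * enorm (delta 0%N) <= eta / 2.
  apply: le_trans (ler_wpM2l (ltW c10) d0) _.
  have -> : c1 * (eta / (2 * c1)) = eta / 2 by field; rewrite gt_eqF.
  exact: lexx.
suff main n : enorm (delta n) <= eta * expR (- kap * n%:R).
  move=> n; apply: le_trans (main n) _.
  by rewrite ler_piMl ?expR_ge0.
elim/ltn_ind: n => n IHn.
(* Linearised motion up to time n of the perturbation at time j. Passing from j to j + 1 adds the
   transported nonlinear error of step j, of size exp(-kap n) B eta^(1 + r) q^j. *)
have tele j : (j <= n)%N -> enorm (L j (n - j)%N (delta j)) <=
    expR (- kap * n%:R) * (c1 * enorm (delta 0%N) +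
      B * eta `^ (1 + r) * ((1 - q ^+ j) / (1 - q))).
  elim: j => [_|j IHj jn].
    rewrite subn0 expr0 subrr mul0r mulr0 addr0.
    apply: le_trans (hL 0%N n (delta 0%N)) _.
    by rewrite mulr0 expR0 mulr1 mulrCA mulrA.
  have E : (n - j)%N = (n - j.+1).+1 by rewrite subnSK.
  have -> : L j.+1 (n - j.+1)%N (delta j.+1) = L j (n - j)%N (delta j) +
      L j.+1 (n - j.+1)%N (delta j.+1 - L j 1%N (delta j)).
    rewrite E LS.
    have := lL j.+1 (n - j.+1)%N (-1) (L j 1%N (delta j)) (delta j.+1).
    by rewrite !scaleN1r (addrC (- L j 1%N _)) => ->; rewrite addrA subrr add0r.
  apply: le_trans (ler_enormD _ _) _.
  apply: le_trans (lerD (IHj (ltnW jn)) (hL _ _ _)) _.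
  have dj := IHn j jn.
  have dj1 : enorm (delta j) <= 1.
    apply: le_trans dj _; rewrite mulr_ile1 ?expR_ge0 ?(ltW eta0)//.
    by rewrite -[leRHS]expR0 ler_expR mulNr oppr_le0 mulr_ge0// ltW.
  have h1 : enorm (delta j) `^ (1 + r) <=
      eta `^ (1 + r) * expR (- kap * (1 + r) * j%:R).
    have -> : expR (- kap * (1 + r) * j%:R) = expR (- kap * j%:R) `^ (1 + r).
      by rewrite -expRM; congr expR; ring.
    rewrite -powRM ?expR_ge0 ?(ltW eta0)//.
    by apply: ge0_ler_powR; rewrite ?nnegrE ?enorm_ge0 ?mulr_ge0 ?expR_ge0 ?(ltW eta0)//; lra.
  have h2 := le_trans (hd j dj1)
    (ler_wpM2l (mulr_ge0 c20 (expR_ge0 (e2 * j%:R))) h1).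
  have h3 : 0 <= c1 * expR (e1 * j.+1%:R) * expR (- kap * (n - j.+1)%N%:R).
    by rewrite !mulr_ge0 ?expR_ge0 ?(ltW c10).
  apply: le_trans (lerD (lexx _) (ler_wpM2l h3 h2)) _.
  rewrite le_eqVlt; apply/orP; left; apply/eqP.
  have Eq : q ^+ j = expR ((e1 + e2 - kap * r) * j%:R) by rewrite mulrC expRM_natl.
  have key : expR (e1 * j.+1%:R) * expR (- kap * (n - j.+1)%N%:R) *
     (expR (e2 * j%:R) * expR (- kap * (1 + r) * j%:R)) =
     expR (- kap * n%:R) * (expR (e1 + kap) * q ^+ j).
    rewrite Eq -!expRD; congr expR; rewrite natrB// -natr1; ring.
  transitivity (expR (- kap * n%:R) * (c1 * enorm (delta 0%N) +
      B * eta `^ (1 + r) * ((1 - q ^+ j) / (1 - q))) +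
      c1 * c2 * eta `^ (1 + r) * (expR (e1 * j.+1%:R) * expR (- kap * (n - j.+1)%N%:R) *
     (expR (e2 * j%:R) * expR (- kap * (1 + r) * j%:R)))); first by ring.
  rewrite key /B exprS; field; by rewrite gt_eqF.
have := tele n (leqnn _); rewrite subnn L0 => /le_trans; apply.
rewrite mulrC ler_wpM2r ?expR_ge0//.
rewrite [leRHS](splitr eta) lerD//.
apply: le_trans Bq; apply: ler_wpM2l; first by rewrite mulr_ge0 ?powR_ge0.
rewrite -[leRHS]mul1r ler_wpM2r ?invr_ge0 ?(ltW q10)//.
by rewrite gerBl exprn_ge0// ltW.
Qed.

(** [J] is the first index whose set contains the point: it is constant on the disjoint pieces of
    [seqDU], so any function of it is measurable. *)
Lemma measurable_index d (T : measurableType d) (R : realType)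
    (G : nat -> set T) : (forall j, measurable (G j)) ->
  exists J : T -> nat, (forall z, (\bigcup_j G j) z -> G (J z) z) /\
    forall h : nat -> R, measurable_fun (\bigcup_j G j) (fun z => h (J z)).
Proof.
move=> mG; pose D := seqDU G.
have mD j : measurable (D j).
  by apply: measurableD => //; exact: bigsetU_measurable.
have hJ z : exists j, (\bigcup_j G j) z -> D j z.
  have [h|h] := pselect ((\bigcup_j G j) z); last by exists 0%N.
  move: (h);  by rewrite [X in X z -> _](seqDU_bigcup_eq G) => -[j _ hj]; exists j.
have /choice[J JP] := hJ.
exists J; split; first by move=> z /JP; exact: subset_seqDU.
move=> h mU Y mY.
have -> : (\bigcup_j G j) `&` (fun z => h (J z)) @^-1` Y =
    \bigcup_(j in [set j | Y (h j)]) D j.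
  apply/seteqP; split => [z [/JP Dz Yz]|z [j Yj Dz]]; first by exists (J z).
  have Uz : (\bigcup_j G j) z by exists j => //; exact: subset_seqDU Dz.
  split=> //=; suff -> : J z = j by [].
  apply: (@trivIset_seqDU _ G _ _ I I); exists z; split => //; exact: JP.
by apply: bigcup_measurable => j _.
Qed.

(** Turns a growth of one level every q steps into an exponential rate; any q above ln K / e
    works. *)
Lemma expr_divn_le (R : realType) (K e : R) : 1 <= K -> 0 < e ->
  exists2 q : nat, (0 < q)%N &
    forall n : nat, K ^+ (n %/ q)%N <= expR (e * n%:R).
Proof.
move=> K1 e0; have K0 : 0 < K by apply: lt_le_trans K1.
have l0 : 0 <= ln K by rewrite ln_ge0.
pose q := (Num.truncn (ln K / e)).+1; exists q => // n.
have -> : K ^+ (n %/ q)%N = expR ((n %/ q)%:R * ln K).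
  by rewrite expRM_natl lnK ?posrE.
rewrite ler_expR.
have hq : ln K <= e * q%:R.
  by rewrite mulrC -ler_pdivrMr// ltW// truncnS_gt.
apply: le_trans (ler_wpM2l (ler0n _ _) hq) _.
by rewrite mulrCA ler_wpM2l ?(ltW e0)// -natrM ler_nat leq_divM.
Qed.

(** The deterministic half of the argument. [q] depends on [kap] and [K] alone, whereas the radius
    depends on the starting level [j], so that temperedness at the fixed rate 1/q provides some
    admissible [j]. *)
Lemma regular_stability (R : realType) (d : nat) (H : R) (H01 : 0 < H < 1)
    (F : 'cV[R]_d -> 'cV[R]_d) (sigma : 'M[R]_d)
    (Pt : R -> noise d H * noise d H -> noise d H)
    (DH : noise d H -> noise d (1 - H))
    (Phi : R -> noise d H * noise d H -> 'cV[R]_d -> 'cV[R]_d) :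
  dissipative_flow F sigma Pt DH Phi ->
  exists (C K0 : R) (N : nat), [/\ 2 <= K0,
    forall w x v, enorm ('d (Phi 1 w) x v) <= expR C * enorm v,
    forall z, gauge N (skew_step H01 Pt Phi z) <= K0 * gauge N z &
    forall kap K : R, 0 < kap -> K0 <= K ->
    exists2 q : nat, (0 < q)%N & forall j : nat, exists2 rho : R, 0 < rho &
    forall z,
      (forall n : nat,
        ~ expanding Phi kap K (j + n %/ q)%N (iter n (skew_step H01 Pt Phi) z) /\
        gauge N (iter n (skew_step H01 Pt Phi) z) <= K ^+ (j + n %/ q)%N) ->
      forall y : 'cV[R]_d, enorm y <= rho -> forall t : R, 0 <= t ->
        enorm (Phi t (omega z) ((z.1.1 : 'cV[R]_d) + y) - Phi t (omega z) z.1.1)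
          <= expR (C + kap) * expR (- kap * t)].
Proof.
move=> hf; have [hD hF hPt hDH hPhi] := hf.
have [C [r [K1 [p [C0 r0 K10 hcon h1]]]]] := flow_time_one hf.
have [N [K0 [K02 hgau hG]]] := gauge_growth H01 hf.
have hG' w x : exists G, forall t : R, 0 <= t <= 1 -> 1 + 2 * enorm (Phi t w x) <= G.
  by case: w => w1 w2; exists (K0 * gauge N ((x, w1), w2)); exact: (hG ((x, w1), w2)).
exists C, K0, N; split=> //.
  by move=> w x v; have [G hGx] := hG' w x; have [_ _] := h1 w x G hGx; exact.
move=> kap K kap0 K0K.
have KK1 : 1 <= K by lra.
have Kp : 0 < K by lra.
(* The linearised motion costs the rate e and the p-th power of the gauge costs e p; together they
   amount to half of kap r. *)
pose e := kap * r / (2 * (1 + p%:R)).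
have p1 : 0 < 1 + p%:R :> R by rewrite ltr_wpDr.
have e0 : 0 < e by rewrite !divr_gt0 ?mulr_gt0.
have ep : e + e * p%:R < kap * r.
  have -> : e + e * p%:R = kap * r / 2 by rewrite /e; field; rewrite gt_eqF.
  by rewrite ltr_pdivrMr// ltr_pMr ?mulr_gt0// ltr1n.
have [q q0 hq] := expr_divn_le KK1 e0.
exists q => // j.
have c10 : 0 < K ^+ j by rewrite exprn_gt0.
have c20 : 0 <= K1 * (K * K ^+ j) ^+ p.
  by rewrite mulr_ge0 ?(ltW K10)// exprn_ge0// mulr_ge0 ?(ltW Kp)// ltW.
have [rho rho0 hrho] := @discrete_stability R d _ _ e (e * p%:R) kap r c10 c20 kap0 r0 ep.
exists rho => // z hz y yrho t t0.
have Kj n : K ^+ (j + n %/ q)%N <= K ^+ j * expR (e * n%:R).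
  by rewrite exprD ler_wpM2l// ltW.
pose x0 : 'cV[R]_d := z.1.1.
pose w0 := omega z.
pose T := skew_step H01 Pt Phi.
pose zn n := iter n T z.
pose xn n : 'cV[R]_d := Phi n%:R w0 x0.
have znx n : (zn n).1.1 = xn n by exact: (skew_iter H01 hf).
have znw n : omega (zn n) = iter n (noise_step H01 Pt) w0 by exact: omega_iter.
pose delta n : 'cV[R]_d := Phi n%:R w0 (x0 + y) - xn n.
pose L n k (v : 'cV[R]_d) : 'cV[R]_d :=
  'd (Phi k%:R (omega (zn n))) ((zn n).1.1 : 'cV[R]_d) v.
have lL n k : linear (L n k) by move=> a u v; rewrite /L linearP.
have L0 n v : L n 0%N v = v.
  have E : Phi 0%:R (omega (zn n)) = id.
    by apply/funext => u; rewrite (flow0 _ _ hPhi).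
  rewrite /L E.
  have E' : 'd (@id 'cV[R]_d) ((zn n).1.1 : 'cV[R]_d) = id :> ('cV[R]_d -> 'cV[R]_d).
    exact: diff_val.
  by rewrite [LHS](congr1 (fun f => f v) E').
have LS n k v : L n k.+1 v = L n.+1 k (L n 1%N v).
  have [_ E] := flow_differentiable H01 hf k (omega (zn n)) (zn n).1.1.
  rewrite /L [LHS](congr1 (fun f => f v) E).
  have Ew : omega (zn n.+1) = noise_step H01 Pt (omega (zn n)) by rewrite !znw.
  have Ex : (zn n.+1).1.1 = Phi 1 (omega (zn n)) (zn n).1.1.
    by rewrite !znx znw -(flow_cocycle H01 hf)// natr1.
  by rewrite Ew Ex.
have hL n k v : enorm (L n k v) <=
    K ^+ j * expR (e * n%:R) * expR (- kap * k%:R) * enorm v.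
  apply: (le_trans (dsizeP Phi k (zn n) v)); rewrite ler_wpM2r ?enorm_ge0//.
  have [hU _] := hz n.
  have hs : expR (kap * k%:R) * dsize Phi k (zn n) <= K ^+ j * expR (e * n%:R).
    apply: le_trans (Kj n); rewrite leNgt; apply/negP => hk.
    by apply: hU; exists k.
  have E1 : expR (kap * k%:R) * expR (- kap * k%:R) = 1.
    by rewrite -expRD mulNr subrr expR0.
  have -> : dsize Phi k (zn n) = expR (kap * k%:R) * dsize Phi k (zn n) * expR (- kap * k%:R).
    by rewrite mulrAC E1 mul1r.
  by rewrite ler_wpM2r ?expR_ge0.
have hd n : enorm (delta n) <= 1 -> enorm (delta n.+1 - L n 1%N (delta n)) <=
     K1 * (K * K ^+ j) ^+ p * expR (e * p%:R * n%:R) * enorm (delta n) `^ (1 + r).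
  move=> dn1.
  have [_ hV] := hz n.
  have [_ hexp _] := h1 (omega (zn n)) (xn n) (K0 * gauge N (zn n))
    (fun t t01 => eq_ind _ (fun u => 1 + 2 * enorm (Phi t (omega (zn n)) u) <= _)
       (hG (zn n) t t01) _ (znx n)).
  have E u : Phi n.+1%:R w0 u = Phi 1 (omega (zn n)) (Phi n%:R w0 u).
    by rewrite znw -(flow_cocycle H01 hf)// natr1.
  have -> : delta n.+1 - L n 1%N (delta n) =
     Phi 1 (omega (zn n)) (xn n + delta n) - Phi 1 (omega (zn n)) (xn n) -
       'd (Phi 1 (omega (zn n))) (xn n) (delta n).
    by rewrite /delta /xn !E -/(xn n) addrCA subrr addr0 /L znx.
  apply: le_trans (hexp _ dn1) _; rewrite ler_wpM2r ?powR_ge0//.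
  rewrite -mulrA ler_wpM2l ?(ltW K10)//.
  have -> : expR (e * p%:R * n%:R) = expR (e * n%:R) ^+ p.
    by rewrite -expRM_natl; congr expR; ring.
  rewrite -exprMn; apply: lerXn2r.
  - by rewrite nnegrE mulr_ge0 ?(le_trans ler01 (gauge_ge1 _ _))//; lra.
  - by rewrite nnegrE !mulr_ge0 ?expR_ge0 ?(ltW Kp) ?(ltW c10).
  - rewrite -mulrA; apply: ler_pM => //.
    + by lra.
    + by apply: le_trans (gauge_ge1 _ _).
    + exact: le_trans hV (Kj n).
have hdn : forall n, enorm (delta n) <= expR (- kap * n%:R).
  apply: (hrho delta L lL L0 LS hL hd).
  by rewrite /delta /xn !(flow0 _ _ hPhi) addrAC subrr add0r.
(* From integer to real times: the remaining time s <= 1 costs exp(C) in the flow and exp(kap) in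
   the decay. *)
pose n := Num.truncn t.
have /andP[n1 n2] := truncn_itv t0.
pose s := t - n%:R.
have s0 : 0 <= s by rewrite subr_ge0.
have s1 : s <= 1 by rewrite /s lerBlDr addrC natr1 ltW.
have Et : t = n%:R + s by rewrite /s addrC subrK.
rewrite -/w0 -/x0 Et !(flow_cocycle H01 hf)//.
apply: le_trans (hcon s _ _ _ s0) _.
apply: (@le_trans _ _ (expR C * expR (- kap * n%:R))).
  apply: ler_pM; rewrite ?expR_ge0 ?enorm_ge0//; last exact: hdn.
  by rewrite ler_expR ler_piMr ?(ltW C0).
rewrite -!expRD ler_expR mulrDr.
have : kap * s <= kap by rewrite ler_piMr ?(ltW kap0).
by rewrite !mulNr; lra.
Qed.

(** Off a null set both levels start below some common [j] and rise by at most one every q steps;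
    the radius is the one that [regular_stability] attaches to the first such [j]. *)
Lemma rate_set (R : realType) (d : nat) (H : R) (H01 : 0 < H < 1)
    (F : 'cV[R]_d -> 'cV[R]_d) (sigma : 'M[R]_d)
    (P : probability (noise d H) R)
    (Pt : R -> noise d H * noise d H -> noise d H)
    (DH : noise d H -> noise d (1 - H))
    (Phi : R -> noise d H * noise d H -> 'cV[R]_d -> 'cV[R]_d)
    (mu : probability (euclid R d * noise d H)%type R)
    (lambda1 : \bar R) (kap : R) :
  dissipative_flow F sigma Pt DH Phi -> reversed_brownian P ->
  stationary P Pt Phi mu -> top_lyapunov P Phi mu lambda1 ->
  0 < kap -> (kap%:E < - lambda1)%E ->
  exists (A : R) (S : set ((euclid R d * noise d H) * noise d H))
    (rad : (euclid R d * noise d H) * noise d H -> R),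
  [/\ measurable S, (mu \x P)%E (~` S) = 0%E, measurable_fun S rad,
      (forall z, S z -> 0 < rad z) &
      forall z, S z -> forall y : 'cV[R]_d, enorm y <= rad z ->
      forall t : R, 0 <= t ->
        enorm (Phi t (omega z) ((z.1.1 : 'cV[R]_d) + y) - Phi t (omega z) z.1.1)
          <= A * expR (- kap * t)].
Proof.
move=> hf hP hmu hl kap0 hkap; have [hD hF hPt hDH hPhi] := hf.
have [C [K0 [N [K02 hC hgau hreg]]]] := regular_stability H01 hf.
(* One base for all levels, large enough for [regular_stability], for [expanding_step] and for the
   growth of the gauge. *)
pose K : R := K0 + d%:R + d%:R * expR (C + kap).
have dC0 : 0 <= d%:R * expR (C + kap) by rewrite mulr_ge0 ?expR_ge0.
have d0 : 0 <= d%:R :> R by [].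
have K0K : K0 <= K by rewrite /K; lra.
have dK : d%:R <= K by rewrite /K; lra.
have dCK : d%:R * expR (C + kap) <= K by rewrite /K; lra.
have K2 : 2 <= K by lra.
have K1 : 1 <= K by lra.
have Kp : 0 < K by lra.
have [q q0 hq] := hreg kap K kap0 K0K.
have /choice[rho hrho] : forall j, exists rho : R, 0 < rho /\ forall z,
      (forall n : nat,
        ~ expanding Phi kap K (j + n %/ q)%N (iter n (skew_step H01 Pt Phi) z) /\
        gauge N (iter n (skew_step H01 Pt Phi) z) <= K ^+ (j + n %/ q)%N) ->
      forall y : 'cV[R]_d, enorm y <= rho -> forall t : R, 0 <= t ->
        enorm (Phi t (omega z) ((z.1.1 : 'cV[R]_d) + y) - Phi t (omega z) z.1.1)
          <= expR (C + kap) * expR (- kap * t).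
  by move=> j; have [rho rho0 h] := hq j; exists rho.
pose T := skew_step H01 Pt Phi.
have mT : measurable_fun setT T := skew_measurable H01 hD hF hPt hDH hPhi.
have invT A : measurable A -> (mu \x P)%E (T @^-1` A) = (mu \x P)%E A.
  by move=> mA; exact: (skew_preserves H01 hD hF hP hPt hDH hPhi hmu mA).
have m1 : (mu \x P)%E setT = 1%E.
  rewrite -setXTT.
  transitivity (mu setT * P setT)%E; first exact: product_measure1E.
  by rewrite !probability_setT mule1.
pose U M := expanding Phi kap K M.
pose V M : set ((euclid R d * noise d H) * noise d H) := [set z | K ^+ M < gauge N z].
have [mU U0] := expanding_null H01 hf hl kap0 hkap K2.
have powK M : K ^+ M <= K ^+ M.+1 by rewrite exprS ler_peMl// exprn_ge0// ltW.
have dU M : U M.+1 `<=` U M.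
  move=> z [k _ /= hk]; exists k => //=; exact: le_lt_trans (powK M) hk.
have dV M : V M.+1 `<=` V M by move=> z; exact: le_lt_trans.
have mV M : measurable (V M) by apply: measurable_gt; exact: measurable_gauge.
have V0 : (mu \x P)%E (\bigcap_M V M) = 0%E.
  suff -> : \bigcap_M V M = set0 by rewrite measure0.
  rewrite -subset0 => z hz.
  suff [M hM] : exists M : nat, gauge N z <= K ^+ M.
    by have := hz M I; rewrite /V/= ltNge hM.
  exists (Num.truncn (gauge N z)).+1; apply: le_trans (ltW (truncnS_gt _)) _.
  elim: (Num.truncn _).+1 => [|n IHn]; first by rewrite expr0 ler01.
  have h1 : 1 <= K ^+ n by exact: exprn_ege1.
  rewrite exprS -natr1; have h2 : 2 * K ^+ n <= K * K ^+ n by rewrite ler_wpM2r//; lra.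
  by lra.
have hU M z : U M.+1 z -> U M (T z) by exact: (@expanding_step _ _ _ H01 _ _ _ _ _ _ _ _ hf hC K1 dK dCK M z).
(* Growth of the gauge by at most K per step, read backwards: if the image is above level M + 1, the
   point is above level M. *)
have hV M z : V M.+1 (T z) -> V M z.
  move=> h; have {}h : K * K ^+ M < gauge N (T z) by rewrite -exprS; exact: h.
  suff h' : K ^+ M < gauge N z by [].
  rewrite -(ltr_pM2l Kp); apply: lt_le_trans h _; apply: le_trans (hgau z) _.
  by rewrite ler_wpM2r// (le_trans ler01 (gauge_ge1 _ _)).
have [mBU BU0] := @never_tempered_null _ _ R (mu \x P)%E T U q mT m1 invT mU dU U0 q0 (or_introl hU).
have [mBV BV0] := @never_tempered_null _ _ R (mu \x P)%E T V q mT m1 invT mV dV V0 q0 (or_intror hV).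
pose BU j := \bigcup_n (iter n T @^-1` U (j + n %/ q)%N).
pose BV j := \bigcup_n (iter n T @^-1` V (j + n %/ q)%N).
have mpre n A : measurable A -> measurable (iter n T @^-1` A).
  by move=> mA; rewrite -[X in measurable X]setTI; exact: (measurable_iter n mT).
have mG j : measurable (~` (BU j `|` BV j)).
  apply: measurableC; apply: measurableU; apply: bigcup_measurable => n _; exact: mpre.
have [J [JG mJ]] := measurable_index R mG.
pose S := ~` ((\bigcap_j BU j) `|` (\bigcap_j BV j)).
have SG : S `<=` \bigcup_j ~` (BU j `|` BV j).
  move=> z; rewrite /S /= => /not_orP[hu hv].
  have [j1 h1] : exists j, ~ BU j z.
    by apply: contrapT => h; apply: hu => j _; apply: contrapT => h'; apply: h; exists j.
  have [j2 h2] : exists j, ~ BV j z.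
    by apply: contrapT => h; apply: hv => j _; apply: contrapT => h'; apply: h; exists j.
  have mono (W : nat -> set ((euclid R d * noise d H) * noise d H)) :
      (forall M, W M.+1 `<=` W M) -> forall a b, W (a + b)%N `<=` W a.
    move=> dW a; elim=> [|b IHb] u; first by rewrite addn0.
    by rewrite addnS => /dW; exact: IHb.
  (* The sets shrink as the level rises, so the sum of the two starting levels serves both
     conditions. *)
  exists (j1 + j2)%N => // -[[n _ hn]|[n _ hn]].
    apply: h1; exists n => //; apply: (mono U dU _ j2).
    by rewrite addnAC.
  apply: h2; exists n => //; apply: (mono V dV _ j1).
  by rewrite addnAC (addnC j2).
exists (expR (C + kap)), S, (fun z => rho (J z)); split.
- by apply: measurableC; exact: measurableU.
- rewrite setCK; apply/eqP; rewrite eq_le measure_ge0 andbT.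
  apply: (le_trans (measureU2 _ mBU mBV)).
  rewrite le_eqVlt; apply/orP; left; apply/eqP.
  transitivity (0 + 0 : \bar R)%E; last exact: adde0.
  by congr (_ + _)%E; [exact: BU0|exact: BV0].
- apply: measurable_funS SG _; last exact: mJ.
  by apply: bigcup_measurable => j _; exact: mG.
- by move=> z _; have [] := hrho (J z).
- move=> z Sz y hy t t0; have [_ h] := hrho (J z).
  apply: h hy _ t0 => n; have hJ := JG z (SG z Sz).
  split; first by move=> hn; apply: hJ; left; exists n.
  by rewrite leNgt; apply/negP => hn; apply: hJ; right; exists n.
Qed.

Theorem proposition4p17 (R : realType) (d : nat) (H : R) (hH : 0 < H < 1)
  (sigma : 'M[R]_d) (hsigma : sigma \in unitmx)
  (F : 'cV[R]_d -> 'cV[R]_d) (hD : assumption_D H F)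
  (hF : holder_derivative F)
  (P : probability (noise d H) R) (hP : reversed_brownian P)
  (Pt : R -> noise d H * noise d H -> noise d H) (hPt : is_noise_update Pt)
  (DH : noise d H -> noise d (1 - H)) (hDH : is_DH DH)
  (Phi : R -> noise d H * noise d H -> 'cV[R]_d -> 'cV[R]_d)
  (hPhi : is_flow F sigma (fbm Pt DH) Phi)
  (mu : probability (euclid R d * noise d H)%type R)
  (hmu : stationary P Pt Phi mu)
  (lambda1 : \bar R) (hlambda1 : top_lyapunov P Phi mu lambda1)
  (hneg : (lambda1 < 0)%E) :
  exists M : set ((euclid R d * noise d H) * noise d H),
    [/\ measurable M, (mu \x P)%E M = 1%E &
      forall nu : R, 0 < nu -> (nu%:E < - lambda1)%E ->
        exists Rnu : (euclid R d * noise d H) * noise d H -> R,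
          [/\ measurable_fun M Rnu, (forall z, M z -> 0 < Rnu z) &
            forall (z : (euclid R d * noise d H) * noise d H), M z ->
            forall y : 'cV[R]_d, enorm y <= Rnu z ->
              (ereal_sup [set (expR (t * nu) *
                   enorm (Phi t (omega z) ((z.1.1 : 'cV[R]_d) + y)
                          - Phi t (omega z) (z.1.1 : 'cV[R]_d)))%R%:E
                 | t in [set t : R | (0 <= t)%R]] < +oo)%E]].
Proof.
have hf : dissipative_flow F sigma Pt DH Phi by split.
(* The set must not depend on nu, so it is fixed beforehand for all rational rates; inadmissible
   rates receive the whole space. *)
have /choice[S hS] : forall c : rat,
    exists S : set ((euclid R d * noise d H) * noise d H),
    [/\ measurable S, (mu \x P)%E (~` S) = 0%E &
      (0 < ratr c :> R) -> ((ratr c)%:E < - lambda1)%E ->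
      exists (A : R) (rad : (euclid R d * noise d H) * noise d H -> R),
      [/\ measurable_fun S rad, (forall z, S z -> 0 < rad z) &
      forall z, S z -> forall y : 'cV[R]_d, enorm y <= rad z ->
      forall t : R, 0 <= t ->
        enorm (Phi t (omega z) ((z.1.1 : 'cV[R]_d) + y) - Phi t (omega z) z.1.1)
          <= A * expR (- ratr c * t)]].
  move=> c.
  have [[c0 cl]|nc] := pselect ((0 < ratr c :> R) /\ ((ratr c)%:E < - lambda1)%E).
    have [A [S [rad [mS S0 mr r0 hr]]]] := rate_set hH hf hP hmu hlambda1 c0 cl.
    by exists S; split=> // _ _; exists A, rad.
  exists setT; split=> //; first by rewrite setCT; exact: measure0.
  by move=> c0 cl; case: nc.
pose W n := if (unpickle n : option rat) is Some c then S c else setT.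
have mW n : measurable (W n).
  by rewrite /W; case: unpickle => // c; have [] := hS c.
have W0 n : (mu \x P)%E (~` W n) = 0%E.
  rewrite /W; case: unpickle => [c|]; first by have [] := hS c.
  by rewrite setCT; exact: measure0.
have mM : measurable (\bigcap_n W n) by exact: bigcapT_measurable.
have M0 : (mu \x P)%E (~` (\bigcap_n W n)) = 0%E.
  apply/negligibleP; first exact: measurableC.
  rewrite setC_bigcap; apply: negligible_bigcup => n.
  by apply/negligibleP; [exact: measurableC|exact: W0].
have m1 : (mu \x P)%E setT = 1%E.
  rewrite -setXTT.
  transitivity (mu setT * P setT)%E; first exact: product_measure1E.
  by rewrite !probability_setT mule1.
exists (\bigcap_n W n); split=> //.
  transitivity ((mu \x P) (\bigcap_n W n) + (mu \x P) (~` (\bigcap_n W n)))%E.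
    by rewrite M0 adde0.
  rewrite -m1 -(setUv (\bigcap_n W n)); apply/esym/measureU => //.
    exact: measurableC.
  exact: setICr.
move=> nu nu0 nul.
(* A rational rate strictly between nu and -lambda1. For lambda1 = -oo there is no finite upper end,
   and nu + 1 takes its place. *)
have [c nuc cl] : exists2 c : rat, nu < ratr c & ((ratr c)%:E < - lambda1)%E.
  have [b nub bl] : exists2 b : R, nu < b & (b%:E <= - lambda1)%E.
    clear -nul hneg; case: lambda1 nul hneg => [l| |] //= nul _.
      by exists (- l).
    by exists (nu + 1); [rewrite ltrDl|exact: leey].
  have [c] := rat_in_itvoo nub; rewrite in_itv/= => /andP[c1 c2].
  by exists c => //; apply: lt_le_trans bl; rewrite lte_fin.
have [mS _ /(_ (lt_trans nu0 nuc) cl)[A [rad [mr r0 hr]]]] := hS c.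
have MS : \bigcap_n W n `<=` S c.
  by move=> z /(_ (pickle c) I); rewrite /W pickleK.
exists rad; split.
- exact: measurable_funS MS mr.
- by move=> z /MS; exact: r0.
- move=> z /MS Sz y hy.
  (* Since c > nu, the product exp(nu t) exp(-c t) is at most 1; the absolute value is taken because
     the sign of [A] is not recorded. *)
  apply: (@le_lt_trans _ _ `|A|%:E); last exact: ltry.
  apply: ge_ereal_sup => _ [t /= t0 <-]; rewrite lee_fin.
  apply: le_trans (ler_wpM2l (expR_ge0 _) (hr z Sz y hy t t0)) _.
  rewrite mulrCA -expRD; apply: (@le_trans _ _ (`|A| * expR (t * nu + - ratr c * t))).
    by rewrite ler_wpM2r ?expR_ge0// ler_norm.
  rewrite ler_piMr// -[leRHS]expR0 ler_expR.
  have : nu * t <= ratr c * t by rewrite ler_wpM2r// ltW.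
  by rewrite mulNr (mulrC t); lra.
Qed.
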